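(* There is a constant $C>0$ such that if $u(t,x)$ is the solution of $\partial_t^2u+|D|u=0$ with $(u(0,x),u_t(0,x))=(u_0,u_1)\in\mathscr{S}(\mathbb{R})\times\mathscr{S}(\mathbb{R})$, then for all $t>0$ $$\sup_{y\in\mathbb{R}}|u(t,yt^2)|\le\frac{C}{t^{5/14}}\sum_{|k|\le2}\left(\|\Gamma^ku_0\|_{L^2}+\left\|\Gamma^k|D|^{-1/2}u_1\right\|_{L^2}\right).$$
   Context: $|D|^s$ is the Fourier multiplier in $x\in\mathbb{R}$ with symbol $|\xi|^s$. $L=\frac t2\partial_t+x\partial_x$; for a multiindex $k=(k_1,k_2,k_3)$, $\Gamma^k=\partial_t^{k_1}\partial_x^{k_2}L^{k_3}$ and $|k|=k_1+k_2+k_3$. By convention $\Gamma^ku_0:=(\Gamma^ku)(0,\cdot)$ and $\Gamma^k|D|^{-1/2}u_1:=(\Gamma^k|D|^{-1/2}\partial_tu)(0,\cdot)$. $\mathscr{S}(\mathbb{R})$ is the Schwartz class. *)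

(* Defs.v *)
From mathcomp Require Import all_boot all_order all_algebra.
From mathcomp Require Import all_classical all_reals all_analysis.
From mathcomp Require Import complex.

Set Implicit Arguments.
Unset Strict Implicit.
Unset Printing Implicit Defensive.

Import Order.TTheory GRing.Theory Num.Theory.
Import numFieldNormedType.Exports.
Import ComplexField.

Local Open Scope classical_set_scope.
Local Open Scope complex_scope.
Local Open Scope ring_scope.

(** Functions [R -> R[i]] are differentiated and integrated componentwise. *)

Definition cderivable (R : realType) (f : R -> R[i]) (x : R) : Prop :=
  derivable (fun y => complex.Re (f y)) x 1 /\ derivable (fun y => complex.Im (f y)) x 1.

Definition cderive (R : realType) (f : R -> R[i]) (x : R) : R[i] :=
  derive1 (fun y => complex.Re (f y)) x +i* derive1 (fun y => complex.Im (f y)) x.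

Definition ccontinuous (R : realType) (f : R -> R[i]) : Prop :=
  continuous (fun y => complex.Re (f y)) /\ continuous (fun y => complex.Im (f y)).

Definition cintegrable (R : realType) (f : R -> R[i]) : Prop :=
  (@lebesgue_measure R).-integrable setT (EFin \o (fun x => complex.Re (f x))) /\
  (@lebesgue_measure R).-integrable setT (EFin \o (fun x => complex.Im (f x))).

Definition cintegral (R : realType) (f : R -> R[i]) : R[i] :=
  Rintegral (@lebesgue_measure R) setT (fun x => complex.Re (f x)) +i*
  Rintegral (@lebesgue_measure R) setT (fun x => complex.Im (f x)).

(** Extended-real valued: it is [+oo] when [f] is not square integrable. *)
Definition L2norm (R : realType) (f : R -> R[i]) : \bar R :=
  Lnorm (@lebesgue_measure R) 2%:E (fun x => (Normc.normc (f x))%:E).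

Definition schwartz (R : realType) (f : R -> R[i]) : Prop :=
  (forall (n : nat) (x : R), cderivable (iter n (@cderive R) f) x) /\
  (forall a b : nat, exists M : R, forall x : R,
     `|x| ^+ a * Normc.normc (iter b (@cderive R) f x) <= M).

Definition cis (R : realType) (a : R) : R[i] := cos a +i* sin a.

Definition fourier (R : realType) (f : R -> R[i]) (xi : R) : R[i] :=
  cintegral (fun x => cis (- (x * xi)) * f x).

Definition inv_fourier (R : realType) (g : R -> R[i]) (x : R) : R[i] :=
  ((2 * pi)^-1)%:C * cintegral (fun xi => cis (x * xi) * g xi).

(** The operator [|D|^s].  The value of the symbol at [xi = 0] (where
    [0 `^ s] is [0] for [s < 0]) is irrelevant. *)
Definition absD (R : realType) (s : R) (f : R -> R[i]) : R -> R[i] :=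
  inv_fourier (fun xi => (`|xi| `^ s)%:C * fourier f xi).

(** Functions of space-time take the time variable first. *)
Definition dt (R : realType) (u : R -> R -> R[i]) : R -> R -> R[i] :=
  fun t x => cderive (fun s => u s x) t.

Definition dx (R : realType) (u : R -> R -> R[i]) : R -> R -> R[i] :=
  fun t x => cderive (u t) x.

Definition Lfield (R : realType) (u : R -> R -> R[i]) : R -> R -> R[i] :=
  fun t x => (t / 2)%:C * dt u t x + x%:C * dx u t x.

Definition Gamma (R : realType) (k1 k2 k3 : nat) (u : R -> R -> R[i]) :
    R -> R -> R[i] :=
  iter k1 (@dt R) (iter k2 (@dx R) (iter k3 (@Lfield R) u)).

(** [u] is the (global in time) classical solution of
    [dt^2 u + |D| u = 0], [u(0) = u0], [dt u(0) = u1].  The equation holds at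
    every point; the integrability conditions give a meaning to [|D| u(t)]
    through the Fourier integral and single out one solution: without some
    condition at spatial infinity there is no uniqueness.  For Schwartz data
    they hold for the solution with Fourier transform
    [cos (t |xi|^(1/2)) u0^ + sin (t |xi|^(1/2)) / |xi|^(1/2) u1^], because it
    and its time derivatives are [O(1 / (1 + x^2))], locally uniformly in
    [t]. *)
Record is_solution (R : realType) (u0 u1 : R -> R[i]) (u : R -> R -> R[i]) :
    Prop := IsSolution {
  sol_derivable : forall t x, cderivable (fun s => u s x) t ;
  sol_derivable2 : forall t x, cderivable (fun s => dt u s x) t ;
  sol_continuous : forall t, ccontinuous (u t) ;
  sol_dominated : forall T : R, exists g : R -> R,
    (@lebesgue_measure R).-integrable setT (EFin \o g) /\
    forall t x, `|t| <= T ->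
      [/\ Normc.normc (u t x) <= g x,
          Normc.normc (dt u t x) <= g x &
          Normc.normc (dt (dt u) t x) <= g x] ;
  sol_multiplier : forall t,
    cintegrable (fun xi => `|xi|%:C * fourier (u t) xi) ;
  sol_equation : forall t x, dt (dt u) t x + absD 1 (u t) x = 0 ;
  sol_init : forall x, u 0 x = u0 x ;
  sol_init_dt : forall x, dt u 0 x = u1 x
}.

(* Main.v *)
Require Import Defs.
From mathcomp Require Import all_boot all_order all_algebra.
From mathcomp Require Import all_classical all_reals all_analysis.
From mathcomp Require Import measurable_realfun complex ring lra.

(**
Real multipliers that are even act separately on the real and imaginary parts
of [u], and on real functions they are diagonalised by the Hartley transform,
whose kernel is [cas = cos + sin].  For each frequency the Hartley transform
of [u t] solves a harmonic oscillator, so that [u t x] is a sum of two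
integrals with phase [x xi + t |xi|^(1/2)] and amplitude [G], the transform of
[v = u 0] or of [v = |D|^(-1/2) (dt u 0)].

The substitution [xi = s^4] turns the phase into the quartic [x s^4 + t s^2];
by van der Corput's lemma the integral of its cosine over an interval of
[s >= 0] is at most [C t^(-1/2)], uniformly in [x].  Integrating by parts in [xi] leaves the integral of
[|xi|^(-1/4) (|G| + |(xi G)'|)], which Cauchy-Schwarz bounds by the [L^2] norms
of [G], [xi G], [(xi G)'] and [xi (xi G)'], that is of [v], [v'], [x v'] and
[(x v')'].  These are the terms [Gamma^k] with [k1 = 0] and [k2, k3 <= 1] at
time 0, where [L] reduces to [x dx].  The trivial bound by the integral of
[|G|] replaces [t^(-1/2)] by [1] for small [t], and both are at most
[t^(-5/14)] in their range.
*)

Set Implicit Arguments.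
Unset Strict Implicit.
Unset Printing Implicit Defensive.

Import Order.TTheory GRing.Theory Num.Theory.
Import numFieldNormedType.Exports.
Import ComplexField.

Local Open Scope classical_set_scope.
Local Open Scope complex_scope.
Local Open Scope ring_scope.

(** The phase [x xi + t xi^(1/2)] has curvature of size [t xi^(-3/2)], which dies at high frequency,
    so van der Corput's lemma in [xi] gives no uniform bound. In [s = xi^(1/4)] the second
    derivative is [12 x s^2 + 2 t], at least [2 t] for [x >= 0]. The price is the Jacobian: the
    amplitude keeps a factor [xi^(3/4) = xi / xi^(1/4)], which is where the weight [xi^(-1/4)] comes
    from. Keeping [xi G] together matters twice: [d/dxi xi] is dual to [x d/dx], and for
    [v = |D|^(-1/2) (dt u 0)] the symbol [G] may blow up like [|xi|^(-1/2)] at the origin, where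
    [xi G] still vanishes. For this [v] integrability may fail, so the passage from the norms of [v]
    to those of [G] cannot start from a transform of [v]. It starts from the integrable [G] and uses
    only the inequality in Plancherel's theorem that bounds [G] by its transform. This half follows
    from Abel summation: damping by [exp (- e |x|)] produces Poisson averages. The Hartley transform
    is its own inverse up to [2 * pi], so that all of this stays within real integrals. *)

Section pointwise_derivatives.
Context {R : realType}.
Implicit Types (f g : R -> R) (x a b c : R).

Lemma derD f g x a b : is_derive x 1 f a -> is_derive x 1 g b ->
  is_derive x 1 (fun y => f y + g y) (a + b).
Proof. by move=> df dg; exact: is_deriveD. Qed.

Lemma derB f g x a b : is_derive x 1 f a -> is_derive x 1 g b ->
  is_derive x 1 (fun y => f y - g y) (a - b).
Proof. by move=> df dg; exact: is_deriveB. Qed.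

Lemma derN f x a : is_derive x 1 f a -> is_derive x 1 (fun y => - f y) (- a).
Proof. by move=> df; exact: is_deriveN. Qed.

Lemma derM f g x a b : is_derive x 1 f a -> is_derive x 1 g b ->
  is_derive x 1 (fun y => f y * g y) (a * g x + f x * b).
Proof.
move=> df dg; apply: is_derive_eq (is_deriveM df dg) _.
by rewrite addrC /GRing.scale /= (mulrC a).
Qed.

Lemma derZ f c x a : is_derive x 1 f a -> is_derive x 1 (fun y => c * f y) (c * a).
Proof. by move=> df; exact: is_deriveZ. Qed.

Lemma dercst c x : is_derive x 1 (fun=> c) 0.
Proof. exact: is_derive_cst. Qed.

Lemma derid x : is_derive x 1 (fun y : R => y) 1.
Proof. exact: is_derive_id. Qed.

Lemma derX f n x a : is_derive x 1 f a ->
  is_derive x 1 (fun y => f y ^+ n) (n%:R * f x ^+ n.-1 * a).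
Proof.
move=> df; elim: n => [|[|n] ih].
- by rewrite mul0r mul0r; exact: is_derive_cst.
- rewrite expr0 mulr1 mul1r. under eq_fun do rewrite expr1. exact: df.
- under eq_fun do rewrite exprS.
  apply: is_derive_eq (derM df ih) _; rewrite /= (exprS _ n).
  by rewrite -[n.+2%:R]natr1; ring.
Qed.

Lemma dercomp f g x a b : is_derive (g x) 1 f a -> is_derive x 1 g b ->
  is_derive x 1 (fun y => f (g y)) (a * b).
Proof. by move=> df dg; exact: is_derive1_comp. Qed.

Lemma dersin f x a : is_derive x 1 f a ->
  is_derive x 1 (fun y => sin (f y)) (cos (f x) * a).
Proof. by move=> df; apply: dercomp => //; exact: is_derive_sin. Qed.

Lemma dercos f x a : is_derive x 1 f a ->
  is_derive x 1 (fun y => cos (f y)) (- sin (f x) * a).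
Proof. by move=> df; apply: dercomp => //; exact: is_derive_cos. Qed.

Lemma derexp f x a : is_derive x 1 f a ->
  is_derive x 1 (fun y => expR (f y)) (expR (f x) * a).
Proof. by move=> df; apply: dercomp => //; exact: is_derive_expR. Qed.

Lemma deratan f x a : is_derive x 1 f a ->
  is_derive x 1 (fun y => atan (f y)) ((1 + f x ^+ 2)^-1 * a).
Proof. by move=> df; apply: dercomp => //; exact: is_derive1_atan. Qed.

Lemma der_eq f x a b : is_derive x 1 f a -> a = b -> is_derive x 1 f b.
Proof. by move=> df <-. Qed.

Lemma derinv f x a : f x != 0 -> is_derive x 1 f a ->
  is_derive x 1 (fun y => (f y)^-1) (- (f x) ^- 2 * a).
Proof.
move=> fx0 df; have dfx := @ex_derive _ _ _ _ _ _ _ df.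
apply: DeriveDef; first exact: derivableV.
by rewrite deriveV// derive_val.
Qed.

Lemma derP f x a : is_derive x 1 f a -> derivable f x 1 /\ derive1 f x = a.
Proof.
by move=> df; split; [exact: (@ex_derive _ _ _ _ _ _ _ df)|rewrite derive1E derive_val].
Qed.

Lemma derI f x a : derivable f x 1 -> derive1 f x = a -> is_derive x 1 f a.
Proof. by move=> df <-; apply: DeriveDef => //; rewrite derive1E. Qed.

Lemma der_cont f x a : is_derive x 1 f a -> {for x, continuous f}.
Proof.
by move=> /derP[df _]; apply/differentiable_continuous/derivable1_diffP.
Qed.

Lemma der_near f g x a : (\forall y \near x, f y = g y) ->
  is_derive x 1 f a -> is_derive x 1 g a.
Proof.
move=> fg df; have dfx := @ex_derive _ _ _ _ _ _ _ df.
apply: DeriveDef.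
  exact: near_eq_derivable dfx.
by rewrite -(@near_eq_derive _ _ _ f g x (1 : R) fg) derive_val.
Qed.

Lemma cont_sqr f x : {for x, continuous f} -> {for x, continuous (fun y => f y ^+ 2)}.
Proof. by move=> cf; apply: (@continuousM _ _ f f). Qed.

End pointwise_derivatives.

(** Differentiation by the shape of the expression. Left over are the nonvanishing of each inverted
    term, the derivative of each abstract function and, for [derive], the equality between the value
    obtained and the one claimed. *)
Ltac der :=
  lazymatch goal with
  | |- is_derive _ _ (fun x => x) _ => notypeclasses refine (derid _)
  | |- is_derive _ _ (fun _ => ?c) _ => notypeclasses refine (dercst c _)
  | |- is_derive _ _ (fun x => @?f x * @?g x) _ => notypeclasses refine (@derM _ f g _ _ _ _ _);  [der..]
  | |- is_derive _ _ (fun x => @?f x - @?g x) _ => notypeclasses refine (@derB _ f g _ _ _ _ _);  [der..]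
  | |- is_derive _ _ (fun x => @?f x + @?g x) _ => notypeclasses refine (@derD _ f g _ _ _ _ _);  [der..]
  | |- is_derive _ _ (fun x => - (@?f x)) _ => notypeclasses refine (@derN _ f _ _ _);  [der..]
  | |- is_derive _ _ (fun x => (@?f x) ^+ ?n) _ => notypeclasses refine (@derX _ f n _ _ _);  [der..]
  | |- is_derive _ _ (fun x => (@?f x)^-1) _ => notypeclasses refine (@derinv _ f _ _ _ _); [|der]
  | |- is_derive _ _ (fun x => sin (@?f x)) _ => notypeclasses refine (@dersin _ f _ _ _);  [der..]
  | |- is_derive _ _ (fun x => cos (@?f x)) _ => notypeclasses refine (@dercos _ f _ _ _);  [der..]
  | |- is_derive _ _ (fun x => expR (@?f x)) _ => notypeclasses refine (@derexp _ f _ _ _);  [der..]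
  | |- is_derive _ _ (fun x => atan (@?f x)) _ => notypeclasses refine (@deratan _ f _ _ _);  [der..]
  | |- _ => idtac
  end.

Ltac derive := notypeclasses refine (@der_eq _ _ _ _ _ _ _); [der|rewrite /=].

(** * Integration over the real line *)

Section integrals.
Context {R : realType}.
Notation mu := (@lebesgue_measure R).
Notation T := (measurableTypeR R).
Implicit Types (f g h : T -> R) (D E : set T).

Definition intble D f : Prop := mu.-integrable D (EFin \o f).

Lemma cont_meas (f : R -> R) : continuous f -> measurable_fun (setT : set T) f.
Proof. by move=> cf; exact: continuous_measurable_fun. Qed.

Lemma meas_itv (i : interval R) : measurable ([set` i] : set T).
Proof. exact: measurable_itv. Qed.

Lemma open_cont_meas (A : set R) (f : R -> R) : open A ->
  {in A, continuous f} -> measurable_fun (A : set T) f.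
Proof. by move=> oA cf; exact: open_continuous_measurable_fun. Qed.

Lemma meas_sub D E f : measurable E -> D `<=` E ->
  measurable_fun E f -> measurable_fun D f.
Proof. by move=> mE DE; exact: measurable_funS. Qed.

Lemma intble_meas D f : intble D f -> measurable_fun D f.
Proof. by move=> /measurable_int/measurable_EFinP. Qed.

Lemma eq_intble D f g : measurable D -> (forall x, D x -> f x = g x) -> intble D f -> intble D g.
Proof.
by move=> mD fg; apply: eq_integrable => // x /set_mem Dx /=; rewrite fg.
Qed.

Lemma intbleD D f g : measurable D -> intble D f -> intble D g ->
  intble D (fun x => f x + g x).
Proof. by move=> mD fi gi; exact: (integrableD mD fi gi). Qed.

Lemma intbleB D f g : measurable D -> intble D f -> intble D g ->
  intble D (fun x => f x - g x).
Proof. by move=> mD fi gi; exact: (integrableB mD fi gi). Qed.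

Lemma intbleZ D f c : measurable D -> intble D f -> intble D (fun x => c * f x).
Proof. by move=> mD fi; exact: (integrableZl mD c fi). Qed.

Lemma intbleN D f : measurable D -> intble D f -> intble D (fun x => - f x).
Proof. move=> mD fi; apply: eq_intble (intbleZ (-1) mD fi) => // x _.
by rewrite mulN1r. Qed.

Lemma intble_norm D f : intble D f -> intble D (fun x => `|f x|).
Proof. exact: integrable_norm. Qed.

Lemma intbleS D E f : measurable D -> measurable E -> E `<=` D ->
  intble D f -> intble E f.
Proof. by move=> mD mE ED; exact: integrableS. Qed.

Lemma intble_le D f g : measurable D -> measurable_fun D f ->
  (forall x, D x -> `|f x| <= g x) -> intble D g -> intble D f.
Proof.
move=> mD mf fg; apply: le_integrable => //; first exact/measurable_EFinP.
by move=> x Dx /=; rewrite lee_fin (le_trans (fg _ Dx))// ler_norm.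
Qed.

Lemma intble_bddM D h f M : measurable D -> measurable_fun D h ->
  (forall x, D x -> `|h x| <= M) -> intble D f -> intble D (fun x => h x * f x).
Proof.
move=> mD mh hM intf; apply: (@intble_le _ _ (fun x => M * `|f x|)) => //.
- by apply: measurable_funM => //; exact: intble_meas.
- by move=> x Dx; rewrite normrM ler_wpM2r// hM.
- exact/intbleZ/intble_norm.
Qed.

Lemma eq_int D f g : (forall x, D x -> f x = g x) ->
  \int[mu]_(x in D) f x = \int[mu]_(x in D) g x.
Proof. by move=> fg; apply: eq_Rintegral => x /set_mem; exact: fg. Qed.

Lemma norm_int_le D f g : measurable D -> measurable_fun D f -> intble D g ->
  (forall x, D x -> `|f x| <= g x) ->
  `|\int[mu]_(x in D) f x| <= \int[mu]_(x in D) g x.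
Proof.
move=> mD mf ig fg; have fi := intble_le mD mf fg ig.
rewrite (le_trans (le_normr_Rintegral mD fi))//.
by apply: le_Rintegral => //; exact: intble_norm.
Qed.

Lemma fatou_le D (f_ : nat -> T -> R) f (B : \bar R) : measurable D ->
  (forall n, measurable_fun D (f_ n)) ->
  (forall n x, D x -> 0 <= f_ n x) ->
  (forall x, D x -> f_ n x @[n --> \oo] --> f x) ->
  (forall n, (\int[mu]_(x in D) (f_ n x)%:E <= B)%E) ->
  (\int[mu]_(x in D) (f x)%:E <= B)%E.
Proof.
move=> mD mf f0 ff fB.
have := @fatou _ _ _ mu D mD (fun n x => (f_ n x)%:E).
move=> /(_ (fun n => (measurable_EFinP _ _).2 (mf n))).
move=> /(_ (fun n x Dx => f0 n x Dx)) fat.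
have -> : (\int[mu]_(x in D) (f x)%:E =
    \int[mu]_(x in D) limn_einf (fun n => (f_ n x)%:E))%E.
  apply: eq_integral => x /set_mem Dx; symmetry.
  have /cvg_limn_einf_sup[-> _] // : (f_ n x)%:E @[n --> \oo] --> (f x)%:E.
  by apply: cvg_EFin; [exact: nearW|exact: ff].
apply: (le_trans fat); rewrite limn_einf_lim.
apply: lime_le; first exact: is_cvg_einfs.
apply: nearW => n; apply: le_trans (fB n).
by apply: ereal_inf_lbound; exists n => /=.
Qed.

Lemma dominated_cvgR D (f_ : nat -> T -> R) f g : measurable D ->
  (forall n, measurable_fun D (f_ n)) ->
  (forall x, D x -> f_ n x @[n --> \oo] --> f x) ->
  intble D g -> (forall n x, D x -> `|f_ n x| <= g x) ->
  intble D f /\ (\int[mu]_(x in D) f_ n x) @[n --> \oo] --> \int[mu]_(x in D) f x.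
Proof.
move=> mD mf ff ig fg.
have mfl : measurable_fun D f.
  by apply: (measurable_fun_cvg mf).
have [] := @dominated_convergence _ _ _ mu D mD (fun n x => (f_ n x)%:E)
  (EFin \o f) (EFin \o g).
- by move=> n; exact/measurable_EFinP.
- exact/measurable_EFinP.
- apply/aeW => x Dx; apply: cvg_EFin; [exact: nearW|exact: ff].
- exact: ig.
- by apply/aeW => x n Dx; rewrite lee_fin; exact: fg.
move=> fi _ fcv; split=> //.
apply: fine_cvg; rewrite fineK//; exact: (integrable_fin_num mD fi).
Qed.

Lemma opp_meas : measurable_fun (setT : set T) (-%R : T -> T).
Proof. exact: oppr_measurable. Qed.

(** Reflection preserves Lebesgue measure: the preimage of []a, b]] is [[- b, - a[], of the same
    length, and a measure is determined by its values on such intervals. *)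
Lemma integral_pushforward_opp (g : T -> \bar R) :
  (\int[mu]_x g x = \int[pushforward mu (-%R : T -> T)]_x g x)%E.
Proof.
pose nu := measure_function_pushforward__canonical__measure_function_Measure
  mu opp_meas.
rewrite (@eq_measure_integral _ _ _ setT nu)// => A mA _.
apply: (@lebesgue_measure_unique _ nu) => // X [[a b] _ <-].
rewrite /nu/= /pushforward /=.
rewrite (_ : _ @^-1` _ = `[- b, - a[%classic); last first.
  by apply/seteqP; split=> x /=; rewrite !in_itv/= => /andP[? ?]; apply/andP; lra.
rewrite !lebesgue_measure_itv /= !lte_fin ltrN2; case: ifP => // _.
by rewrite -!EFinB; congr EFin; ring.
Qed.

Lemma intble_opp f : intble setT f -> intble setT (fun x => f (- x)).
Proof.
move=> fi; have mf := intble_meas fi; have mo := opp_meas.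
apply/integrableP; split.
  by apply/measurable_EFinP; exact: (measurableT_comp mf mo).
have /integrableP[_] := fi; rewrite integral_pushforward_opp.
rewrite (ge0_integral_pushforward mo)//=.
by apply/measurable_EFinP; exact: measurableT_comp.
Qed.

Lemma int_opp f : intble setT f ->
  \int[mu]_x f (- x) = \int[mu]_x f x.
Proof.
move=> fi; have mf := intble_meas fi.
rewrite /Rintegral; congr fine.
rewrite [RHS]integral_pushforward_opp (@integral_pushforward _ _ _ _ _ _ opp_meas _ _ (EFin \o f))//.
- exact/measurable_EFinP.
- exact: intble_opp.
Qed.

Lemma int_odd f : intble setT f -> (forall x, f (- x) = - f x) ->
  \int[mu]_x f x = 0.
Proof.
move=> fi fo; have := int_opp fi; under eq_Rintegral do rewrite fo.
have -> : \int[mu]_x (- f x) = - \int[mu]_x f x.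
  under eq_Rintegral do rewrite -mulN1r.
  by rewrite RintegralZl// mulN1r.
by move/eqP; rewrite eq_sym -addr_eq0 -mulr2n mulrn_eq0 => /eqP.
Qed.

(** Folding at the origin reduces integrals of functions singular there to the open half-line. *)
Lemma int_split_half f : intble setT f ->
  \int[mu]_x f x = \int[mu]_(x in `]0, +oo[) (f x + f (- x)).
Proof.
move=> fi.
have fio := intble_opp fi.
have m0 : measurable (`]0, +oo[%classic : set T) by exact: meas_itv.
rewrite RintegralD//; [|exact: intbleS fi|exact: intbleS fio].
rewrite -(setUv (`]0, +oo[%classic : set T)) Rintegral_setU//; first last.
- by apply/disj_setPCl.
- by rewrite setUv.
- exact: measurableC.
congr (_ + _).
have fmi : intble setT (f \_ `]-oo, 0]).
  apply: (intble_le measurableT _ _ (intble_norm fi)) => [|x _].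
    apply: (measurable_restrictT f (meas_itv `]-oo, 0])).1.
    by apply: meas_sub (intble_meas fi).
  by rewrite patchE; case: ifP => // _; rewrite normr0.
rewrite [RHS]Rintegral_itv_obnd_cbnd; last exact: intbleS fio.
rewrite setCitvr Rintegral_mkcond -(int_opp fmi) [RHS]Rintegral_mkcond.
apply: eq_Rintegral => x _; rewrite !patchE; congr (if _ then _ else _).
by apply/idP/idP; rewrite !inE/= !in_itv/= andbT oppr_le0.
Qed.

End integrals.

(** * The fundamental theorem of calculus on unbounded intervals *)

Section calculus.
Context {R : realType}.
Notation mu := (@lebesgue_measure R).
Notation T := (measurableTypeR R).
Implicit Types (h dh f : R -> R) (a b l x M : R) (n : nat).

Lemma within_cont (A : set R) f : (forall x, A x -> {for x, continuous f}) ->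
  {within A, continuous f}.
Proof. by move=> cf; apply: continuous_in_subspaceT => x /set_mem; exact: cf. Qed.

Lemma ftc_compact h dh a b : a <= b ->
  (forall x, a <= x <= b -> is_derive x 1 h (dh x)) ->
  (forall x, a <= x <= b -> {for x, continuous dh}) ->
  \int[mu]_(x in `[a, b]) dh x = h b - h a.
Proof.
rewrite le_eqVlt => /predU1P[<- _ _|ab Hd ch].
  by rewrite set_itv1 Rintegral_set1 subrr.
rewrite /Rintegral (@continuous_FTC2 _ dh h)//.
- by apply: within_cont => x /=; rewrite in_itv/=; exact: ch.
- split.
  + move=> x; rewrite in_itv/= => /andP[ax xb].
    by have [] := derP (Hd x _) => //; rewrite (ltW ax) (ltW xb).
  + apply: cvg_at_right_filter; apply: (der_cont (Hd a _)).
    by rewrite lexx ltW.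
  + apply: cvg_at_left_filter; apply: (der_cont (Hd b _)).
    by rewrite lexx ltW.
- move=> x; rewrite in_itv/= => /andP[ax xb].
  by have [] := derP (Hd x _) => //; rewrite (ltW ax) (ltW xb).
Qed.

Lemma intble_compact f a b :
  (forall x, a <= x <= b -> {for x, continuous f}) -> intble `[a, b] f.
Proof.
move=> cf; apply: continuous_compact_integrable; first exact: segment_compact.
by apply: within_cont => x /=; rewrite in_itv/=; exact: cf.
Qed.

Let le_n2 n : n%:R <= n.+2%:R :> R.
Proof. by rewrite ler_nat -addn2 leq_addr. Qed.

(** A compact exhaustion of the open half-line; [n.+2] keeps both endpoints positive and in the
    right order. *)
Let Kn (n : nat) : set T := `[n.+2%:R^-1 : R, n.+2%:R]%classic.

Let KnP n (x : R) : Kn n x -> 0 < x.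
Proof. by rewrite /Kn/= in_itv/= => /andP[+ _]; apply: lt_le_trans; rewrite invr_gt0. Qed.

Let Kn_near (x : R) : 0 < x -> \forall n \near \oo, x \in Kn n.
Proof.
move=> x0; near=> n; rewrite inE /Kn/= in_itv/=; apply/andP; split.
  rewrite -[leRHS]invrK lef_pV2 ?posrE ?invr_gt0//.
  apply: (@le_trans _ _ n%:R); last exact: le_n2.
  by near: n; exact: nbhs_infty_ger.
apply: (@le_trans _ _ n%:R); last exact: le_n2.
by near: n; exact: nbhs_infty_ger.
Unshelve. all: by end_near. Qed.

Let Kn_int h dh n : (forall x, 0 < x -> is_derive x 1 h (dh x)) ->
  (forall x, 0 < x -> {for x, continuous dh}) ->
  \int[mu]_(x in `]0, +oo[) (dh \_ (Kn n)) x = h n.+2%:R - h n.+2%:R^-1.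
Proof.
move=> Hd ch; rewrite -Rintegral_mkcondr.
rewrite (_ : _ `&` _ = Kn n); last first.
  by apply/seteqP; split=> [x []//|x Kx]; split=> //=; rewrite in_itv/= andbT (KnP Kx).
apply: ftc_compact.
- by apply: (@le_trans _ _ 1); rewrite ?ler1n// invf_le1// ler1n.
- by move=> x xK; apply: Hd; apply: (@KnP n); rewrite /Kn/= in_itv.
- by move=> x xK; apply: ch; apply: (@KnP n); rewrite /Kn/= in_itv.
Qed.

Let Kn_intble f n : (forall x, 0 < x -> {for x, continuous f}) ->
  intble `]0, +oo[ (f \_ (Kn n)).
Proof.
move=> cf.
have : intble (`]0, +oo[ `&` Kn n) f.
  apply: (@intbleS _ (Kn n)) => //; first exact: meas_itv.
    by apply: measurableI; exact: meas_itv.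
  by apply: intble_compact => x xK; apply: cf; apply: (@KnP n); rewrite /Kn/= in_itv.
rewrite /intble => /integrable_restrict; rewrite -restrict_EFin; apply.
all: exact: meas_itv.
Qed.

Let Kn_cvg f (x : R) : 0 < x -> (f \_ (Kn n)) x @[n --> \oo] --> f x.
Proof.
move=> x0; apply: cvg_near_cst.
by near=> n; rewrite patchE (near (Kn_near x0) n).
Unshelve. all: by end_near. Qed.

Lemma meas_half_cont f : (forall x, 0 < x -> {for x, continuous f}) ->
  measurable_fun (`]0, +oo[%classic : set T) f.
Proof.
move=> cf; apply: open_cont_meas => // x; rewrite inE/= in_itv/= andbT; exact: cf.
Qed.

(** Over a compact interval the integral of a derivative is a difference of two values of [h], at
    most [M + M]; Fatou's lemma carries this to the half-line. Integrability of the damping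
    exponential, of the Poisson kernel and of [weight] comes from here. *)
Lemma intble_der_half h dh M : (forall x, 0 < x -> is_derive x 1 h (dh x)) ->
  (forall x, 0 < x -> {for x, continuous dh}) -> (forall x, 0 < x -> 0 <= dh x) ->
  (forall x, 0 < x -> `|h x| <= M) -> intble `]0, +oo[ dh.
Proof.
move=> Hd ch h0 hM; apply/integrableP; split.
  by apply/measurable_EFinP; exact: meas_half_cont.
apply: (@le_lt_trans _ _ (M + M)%:E); last exact: ltry.
have -> : (\int[mu]_(x in `]0%R, +oo[) `|(EFin \o dh) x| =
    \int[mu]_(x in `]0%R, +oo[) (dh x)%:E)%E.
  apply: eq_integral => x; rewrite inE/= in_itv/= andbT => x0.
  by rewrite ger0_norm// h0.
apply: (@fatou_le _ _ (fun n => dh \_ (Kn n))); first exact: meas_itv.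
- by move=> n; apply: intble_meas; exact: Kn_intble.
- move=> n x /=; rewrite in_itv/= andbT => x0.
  by rewrite patchE; case: ifP => // _; exact: h0.
- by move=> x /=; rewrite in_itv/= andbT; exact: Kn_cvg.
move=> n.
have /integrable_fin_num Kfin := Kn_intble n ch.
rewrite -[X in (X <= _)%E]fineK; last by apply: Kfin; exact: meas_itv.
rewrite lee_fin (_ : fine _ = \int[mu]_(x in `]0, +oo[) (dh \_ (Kn n)) x)//.
rewrite (Kn_int _ Hd ch) (le_trans (ler_norm _))// (le_trans (ler_normB _ _))//.
by rewrite lerD// hM// invr_gt0.
Qed.

Lemma int_der_half h dh l0 l1 : (forall x, 0 < x -> is_derive x 1 h (dh x)) ->
  (forall x, 0 < x -> {for x, continuous dh}) -> intble `]0, +oo[ dh ->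
  h x @[x --> 0^'+] --> l0 -> h x @[x --> +oo] --> l1 ->
  \int[mu]_(x in `]0, +oo[) dh x = l1 - l0.
Proof.
move=> Hd ch ih h0 h1.
have [] := @dominated_cvgR _ `]0, +oo[ (fun n => dh \_ (Kn n)) dh (fun x => `|dh x|).
- exact: meas_itv.
- by move=> n; apply: intble_meas; exact: Kn_intble.
- by move=> x /=; rewrite in_itv/= andbT; exact: Kn_cvg.
- exact: intble_norm.
- by move=> n x _; rewrite patchE; case: ifP => // _; rewrite normr0.
move=> _ cv; rewrite -(cvg_lim _ cv)//; apply/cvg_lim => //.
under eq_fun do rewrite (Kn_int _ Hd ch).
apply: cvgB.
  apply: (@cvg_comp _ _ _ (fun n : nat => n.+2%:R) h _ +oo) => //.
  apply/cvgryPge => A; near=> n; apply: (@le_trans _ _ n%:R); last exact: le_n2.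
  by near: n; exact: nbhs_infty_ger.
apply: (@cvg_comp _ _ _ (fun n : nat => n.+2%:R^-1) h _ 0^'+) => //.
move=> A [e /= e0 eA]; near=> n; apply: eA => /=; last by rewrite invr_gt0.
rewrite sub0r normrN ger0_norm// -[ltRHS]invrK ltf_pV2 ?posrE ?invr_gt0//.
apply: (@lt_le_trans _ _ n.+1%:R); last by rewrite ler_nat.
rewrite -natr1 ltr_pwDr//; near: n; exact: nbhs_infty_ger.
Unshelve. all: by end_near. Qed.

Lemma der_opp h x d : is_derive (- x) 1 h d -> is_derive x 1 (fun y => h (- y)) (- d).
Proof.
move=> Hd; rewrite -mulrN1; exact: dercomp.
Qed.

Lemma cont_opp h x : {for (- x), continuous h} -> {for x, continuous (fun y => h (- y))}.
Proof. by move=> ch; apply: (@continuous_comp _ _ _ (-%R) h) => //; exact: opp_continuous. Qed.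

(** The folded function [h x - h (- x)] tends to 0 at the origin by continuity of [h].
    Differentiability is asked away from 0, since the symbols in [|xi|] are singular at that
    point. *)
Lemma int_der_line h dh l1 l2 : (forall x, x != 0 -> is_derive x 1 h (dh x)) ->
  (forall x, x != 0 -> {for x, continuous dh}) -> intble setT dh ->
  {for 0, continuous h} -> h x @[x --> +oo] --> l1 -> h (- x) @[x --> +oo] --> l2 ->
  \int[mu]_x dh x = l1 - l2.
Proof.
move=> Hd ch ih h0 h1 h2; rewrite int_split_half//.
rewrite -[RHS]subr0.
apply: (@int_der_half (fun x => h x - h (- x)) (fun x => dh x + dh (- x)) 0).
- move=> x x0; rewrite -[dh (- x)]opprK; apply: derB; first by apply: Hd; rewrite gt_eqF.
  by apply: der_opp; apply: Hd; rewrite oppr_eq0 gt_eqF.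
- move=> x x0; apply: cvgD; first by apply: ch; rewrite gt_eqF.
  by apply: cont_opp; apply: ch; rewrite oppr_eq0 gt_eqF.
- apply: intbleD; first exact: meas_itv.
    exact: intbleS ih.
  exact: intbleS (intble_opp ih).
- have ho : h (- x) @[x --> (0 : R)] --> h 0.
    by rewrite -{2}oppr0; apply: (@cont_opp h); rewrite oppr0.
  have ho2 : (h x - h (- x)) @[x --> (0 : R)] --> (0 : R).
    by rewrite -[X in _ --> X](subrr (h 0)); exact: cvgB.
  exact: cvg_at_right_filter ho2.
- exact: cvgB.
Qed.

Lemma intble_restrictT f (D : set T) : measurable D -> intble D f ->
  intble setT (f \_ D).
Proof.
move=> mD fi; have : intble (setT `&` D) f by rewrite setTI.
by rewrite /intble => /integrable_restrict; rewrite -restrict_EFin; apply.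
Qed.

Lemma intble_halves f : intble `]0, +oo[ f -> intble `]0, +oo[ (fun x => f (- x)) ->
  intble setT f.
Proof.
move=> f1 f2.
have i1 := intble_restrictT (meas_itv _) f1.
have i2 := intble_opp (intble_restrictT (meas_itv _) f2).
have i0 : intble setT ((fun=> f 0) \_ `[0, 0]).
  by apply: intble_restrictT; [exact: meas_itv|apply: intble_compact => x _; exact: cvg_cst].
apply: eq_intble (intbleD measurableT i0 (intbleD measurableT i1 i2)) => // x _.
rewrite !patchE !mem_setE !in_itv/= !andbT opprK oppr_gt0 -eq_le eq_sym.
by case: ltgtP => [x0|x0|->]; rewrite ?addr0 ?add0r.
Qed.

Lemma intble_der_line h dh M : (forall x, is_derive x 1 h (dh x)) ->
  continuous dh -> (forall x, 0 <= dh x) -> (forall x, `|h x| <= M) -> intble setT dh.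
Proof.
move=> Hd ch h0 hM; apply: intble_halves.
  by apply: (@intble_der_half h _ M) => // x _; exact: ch.
apply: (@intble_der_half (fun x => - h (- x)) _ M) => // [x _|x _|x _].
- by rewrite -[dh (- x)]opprK; apply: derN; exact: der_opp.
- by apply: cont_opp; exact: ch.
- by rewrite normrN.
Qed.

End calculus.

(** * The Hartley transform *)

Section poisson.
Context {R : realType}.
Notation mu := (@lebesgue_measure R).
Notation T := (measurableTypeR R).
Implicit Types (f g : T -> R) (a b x y z e : R).

Definition cas z : R := cos z + sin z.

Lemma norm_cas_le2 z : `|cas z| <= 2.
Proof.
rewrite (le_trans (ler_normD _ _))// -[2]/(1 + 1) lerD//.
  by rewrite ler_norml cos_geN1 cos_le1.
by rewrite ler_norml sin_geN1 sin_le1.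
Qed.

Lemma cont_cas : continuous cas.
Proof. by move=> z; apply: cvgD; [exact: continuous_cos|exact: continuous_sin]. Qed.

Lemma der_cas z : is_derive z 1 cas (cas (- z)).
Proof.
rewrite /cas; derive.
by rewrite !mulr1 cosN sinN addrC.
Qed.

Lemma casM a b : cas a * cas b = cos (a - b) + sin (a + b).
Proof. by rewrite /cas cosB sinD; ring. Qed.

Lemma cont_lin (a : R) : continuous (fun x : R => x * a).
Proof. by move=> x; apply: cvgMl; exact: cvg_id. Qed.

Lemma cont_casl a : continuous (fun x => cas (x * a)).
Proof.
by move=> x; apply: (@continuous_comp _ _ _ (fun x => x * a) cas);
  [exact: cont_lin|exact: cont_cas].
Qed.

(** Abel damping: its Fourier transform is the Poisson kernel, so a damped double transform is a
    Poisson average. *)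
Definition expabs e x : R := expR (- (e * `|x|)).

Lemma expabs_gt0 e x : 0 < expabs e x. Proof. exact: expR_gt0. Qed.

Lemma expabs_le1 e x : 0 <= e -> expabs e x <= 1.
Proof. by move=> e0; rewrite -expR0 ler_expR oppr_le0 mulr_ge0. Qed.

Lemma cont_expabs e : continuous (expabs e).
Proof.
move=> x; apply: continuous_comp; last exact: continuous_expR.
by apply: cvgN; apply: cvgMr; exact: norm_continuous.
Qed.

Lemma expabs_half e x : 0 < x -> expabs e x = expR (- (e * x)).
Proof. by move=> x0; rewrite /expabs gtr0_norm. Qed.

Lemma expabsN e x : expabs e (- x) = expabs e x.
Proof. by rewrite /expabs normrN. Qed.

Lemma cvgy_affine (a b : R) : 0 < a -> (y - b) * a @[y --> +oo] --> +oo.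
Proof.
move=> a0; apply/cvgryPge => A; near=> y.
rewrite -ler_pdivrMr// lerBrDr; near: y; apply: nbhs_pinfty_ge; exact: num_real.
Unshelve. all: by end_near. Qed.

Lemma cvg_expRNM e : 0 < e -> expR (- (e * x)) @[x --> +oo] --> 0.
Proof.
move=> e0; under eq_fun do rewrite mulrC -[X in X * e]subr0.
by apply: (@cvg_comp _ _ _ (fun x => (x - 0) * e) (fun x => expR (- x)) _ +oo);
  [exact: cvgy_affine|exact: cvgr_expR].
Qed.

Lemma intble_expabs e : 0 < e -> intble setT (expabs e).
Proof.
move=> e0.
have ih : intble `]0, +oo[ (fun x => expR (- (e * x))).
  apply: (@intble_der_half _ (fun x => - (e^-1 * expR (- (e * x)))) _ e^-1) => x x0.
  - derive.
    by field; rewrite gt_eqF.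
  - by apply: der_cont; derive; reflexivity.
  - exact: expR_ge0.
  - rewrite normrN normrM !ger0_norm ?expR_ge0 ?invr_ge0 ?(ltW e0)//.
    by rewrite ler_piMr ?invr_ge0 ?(ltW e0)// -expR0 ler_expR oppr_le0 mulr_ge0// ltW.
have m0 : measurable (`]0, +oo[%classic : set T) by exact: meas_itv.
apply: intble_halves; apply: eq_intble ih => // x /=; rewrite in_itv/= andbT => x0.
  by rewrite expabs_half.
by rewrite expabsN expabs_half.
Qed.

(** Normalised as the Fourier transform of [expabs e], so that its mass is [2 * pi] and not 1; this
    is the constant of Hartley inversion. *)
Definition poisson e z : R := 2 * e / (e ^+ 2 + z ^+ 2).

Lemma poisson_den e z : 0 < e -> 0 < e ^+ 2 + z ^+ 2.
Proof. by move=> e0; rewrite ltr_wpDr ?sqr_ge0// exprn_gt0. Qed.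

Lemma poisson_ge0 e z : 0 < e -> 0 <= poisson e z.
Proof. by move=> e0; rewrite divr_ge0 ?mulr_ge0 ?(ltW e0)// ltW// poisson_den. Qed.

Lemma poissonN e z : poisson e (- z) = poisson e z.
Proof. by rewrite /poisson sqrrN. Qed.

Lemma intble_expabs_cos e z : 0 < e -> intble setT (fun x => expabs e x * cos (x * z)).
Proof.
move=> e0; apply: (intble_le _ _ _ (intble_expabs e0)) => //.
  apply: cont_meas => x; apply: cvgM; first exact: cont_expabs.
  by apply: continuous_comp; [exact: cont_lin|exact: continuous_cos].
move=> x _; rewrite normrM (gtr0_norm (expabs_gt0 _ _)).
by rewrite ler_piMr ?(ltW (expabs_gt0 _ _))// ler_norml cos_geN1 cos_le1.
Qed.

Lemma intble_expabs_sin e z : 0 < e -> intble setT (fun x => expabs e x * sin (x * z)).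
Proof.
move=> e0; apply: (intble_le _ _ _ (intble_expabs e0)) => //.
  apply: cont_meas => x; apply: cvgM; first exact: cont_expabs.
  by apply: continuous_comp; [exact: cont_lin|exact: continuous_sin].
move=> x _; rewrite normrM (gtr0_norm (expabs_gt0 _ _)).
by rewrite ler_piMr ?(ltW (expabs_gt0 _ _))// ler_norml sin_geN1 sin_le1.
Qed.

Lemma int_expabs_cos e z : 0 < e ->
  \int[mu]_x (expabs e x * cos (x * z)) = poisson e z.
Proof.
move=> e0; have ii := intble_expabs_cos z e0; have p0 := poisson_den z e0.
rewrite int_split_half//.
have m0 : measurable (`]0, +oo[%classic : set T) by exact: meas_itv.
pose dh x := 2 * (expR (- (e * x)) * cos (x * z)).
(* Twice the real part of [exp ((- e + i z) x) / (- e + i z)]. *)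
pose h x := 2 / (e ^+ 2 + z ^+ 2) *
  (expR (- (e * x)) * (z * sin (x * z) - e * cos (x * z))).
have dhE x : 0 < x -> expabs e x * cos (x * z) + expabs e (- x) * cos (- x * z) = dh x.
  by move=> x0; rewrite expabsN mulNr cosN expabs_half// -mulr2n -mulr_natl.
rewrite (@eq_int _ _ _ dh); last first.
  by move=> x /=; rewrite in_itv/= andbT => x0; rewrite dhE.
have Hd x : is_derive x 1 h (dh x).
  rewrite /h; derive.
  by rewrite /dh; field; rewrite gt_eqF.
have cd x : {for x, continuous dh} by rewrite /dh; apply: der_cont; derive; reflexivity.
rewrite (_ : poisson e z = 0 - h 0); last first.
  by rewrite /h /poisson mulr0 oppr0 expR0 mul0r sin0 cos0; ring.
apply: (@int_der_half _ h) => //.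
- have : intble `]0, +oo[ (fun x => expabs e x * cos (x * z) + expabs e (- x) * cos (- x * z)).
    by apply: intbleD => //; [exact: intbleS ii|exact: intbleS (intble_opp ii)].
  by apply: eq_intble => // x /=; rewrite in_itv/= andbT => x0; rewrite dhE.
- by apply: cvg_at_right_filter; apply: (der_cont (Hd 0)).
rewrite /h.
set M := 2 / (e ^+ 2 + z ^+ 2) * (`|z| + e).
have M0 : 0 <= M by apply: mulr_ge0; [exact: divr_ge0 _ (ltW p0)|exact: addr_ge0 _ (ltW e0)].
apply: (@squeeze_cvgr _ _ _ _ (fun x => - (M * expR (- (e * x)))) (fun x => M * expR (- (e * x)))).
- apply: nearW => x; rewrite -ler_norml normrM ger0_norm ?divr_ge0 ?(ltW p0)//.
  rewrite /M -!mulrA ler_wpM2l// ler_wpM2l ?invr_ge0 ?(ltW p0)//.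
  rewrite normrM (gtr0_norm (expR_gt0 _)) mulrC ler_wpM2r ?expR_ge0//.
  rewrite (le_trans (ler_normB _ _))// !normrM (gtr0_norm e0) lerD//.
    by rewrite ler_piMr// ler_norml sin_geN1 sin_le1.
  by rewrite ler_piMr ?(ltW e0)// ler_norml cos_geN1 cos_le1.
- rewrite -oppr0; apply: cvgN; rewrite -[0](mulr0 M); apply: cvgMr; exact: cvg_expRNM.
- rewrite -[0](mulr0 M); apply: cvgMr; exact: cvg_expRNM.
Qed.

Lemma intble_expabs_cas e a : 0 < e -> intble setT (fun x => expabs e x * cas (x * a)).
Proof.
move=> e0; apply: eq_intble (intbleD measurableT (intble_expabs_cos a e0) (intble_expabs_sin a e0)) => //.
by move=> x _; rewrite -mulrDr.
Qed.

(** In [casM] the sine of [a + b] is odd in the integration variable and disappears against the even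
    damping, while the cosine depends on [a - b] alone: a product of two kernels becomes a
    convolution kernel. *)
Lemma int_expabs_cas_cas e a b : 0 < e ->
  \int[mu]_x (expabs e x * (cas (x * a) * cas (x * b))) = poisson e (a - b).
Proof.
move=> e0.
rewrite (@eq_int _ _ _ (fun x => expabs e x * cos (x * (a - b)) +
    expabs e x * sin (x * (a + b)))); last first.
  by move=> x _; rewrite casM -mulrBr -mulrDr -mulrDr.
rewrite RintegralD//; [|exact: intble_expabs_cos|exact: intble_expabs_sin].
rewrite int_expabs_cos// int_odd ?addr0//; first exact: intble_expabs_sin.
by move=> x; rewrite expabsN mulNr sinN mulrN.
Qed.

Lemma der_poisson e z y : 0 < e ->
  is_derive y 1 (fun y => 2 * atan ((y - z) / e)) (poisson e (z - y)).
Proof.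
move=> e0; have p0 := poisson_den (z - y) e0.
derive; rewrite /poisson; by field; rewrite !gt_eqF.
Qed.

Lemma cont_poisson e z : 0 < e -> continuous (fun y => poisson e (z - y)).
Proof.
move=> e0 y; apply: (@der_cont _ _ _ (- (2 * e) / (e ^+ 2 + (z - y) ^+ 2) ^+ 2 * (2 * (z - y) * - 1))).
rewrite /poisson; derive; first by rewrite gt_eqF ?poisson_den.
by field; rewrite gt_eqF// poisson_den.
Qed.

Lemma intble_poisson e z : 0 < e -> intble setT (fun y => poisson e (z - y)).
Proof.
move=> e0; apply: (@intble_der_line _ (fun y => 2 * atan ((y - z) / e)) _ pi) => [y||y|y].
- exact: der_poisson.
- exact: cont_poisson.
- exact: poisson_ge0.
- rewrite normrM ger0_norm// -ler_pdivlMl// [leRHS]mulrC ler_norml.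
  by rewrite (ltW (atan_gtNpi2 _)) (ltW (atan_ltpi2 _)).
Qed.

Lemma int_poisson e z : 0 < e -> \int[mu]_y poisson e (z - y) = 2 * pi.
Proof.
move=> e0; rewrite (_ : 2 * pi = pi - - pi); last by ring.
apply: (@int_der_line _ (fun y => 2 * atan ((y - z) / e))).
- by move=> y _; exact: der_poisson.
- by move=> y _; exact: cont_poisson.
- exact: intble_poisson.
- exact: der_cont (der_poisson _ _ e0).
- rewrite (_ : pi = 2 * (pi / 2)); last by field.
  apply: cvgMr; apply: (@cvg_comp _ _ _ (fun y => (y - z) / e) atan _ +oo); last exact: cvgy_atan.
  by apply: cvgy_affine; rewrite invr_gt0.
- rewrite (_ : - pi = 2 * (- (pi / 2))); last by field.
  apply: cvgMr.
  under eq_fun do rewrite -[(- _ - _)]opprK opprB mulNr opprK atanN.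
  apply: cvgN; apply: (@cvg_comp _ _ _ (fun y => (z + y) / e) atan _ +oo); last exact: cvgy_atan.
  have : (y - (- z)) / e @[y --> +oo] --> +oo by apply: cvgy_affine; rewrite invr_gt0.
  by under eq_fun do rewrite opprK addrC.
Qed.

End poisson.

(** * Fubini's theorem for real integrands *)

Section fubini_real.
Context {R : realType}.
Notation mu := (@lebesgue_measure R).
Notation T := (measurableTypeR R).
Implicit Types (F : T * T -> R).

Lemma intble_prod F (c : T -> R) : measurable_fun setT F ->
  (forall y, intble setT (fun x => F (x, y))) ->
  (forall y, \int[mu]_x `|F (x, y)| <= c y) -> intble setT c ->
  (mu \x mu)%E.-integrable setT (EFin \o F).
Proof.
move=> mF iF Fc ic; have mEF : measurable_fun setT (EFin \o F) by exact/measurable_EFinP.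
apply/(@integrable21ltyP _ _ _ _ _ mu mu _ mEF).
have /integrableP[_] := ic; apply: le_lt_trans.
apply: ge0_le_integral => //.
- by move=> y _; exact: integral_ge0.
- apply: (measurable_fun_fubini_tonelli_G (abse \o (EFin \o F))) => //=.
  exact: measurableT_comp.
- by apply: measurableT_comp => //; apply/measurable_EFinP; exact: intble_meas ic.
move=> y _; rewrite -[X in (X <= _)%E]fineK; last first.
  exact: (integrable_fin_num measurableT (intble_norm (iF y))).
by rewrite lee_fin (le_trans (Fc y))// ler_norm.
Qed.

Lemma fubini_real F : (mu \x mu)%E.-integrable setT (EFin \o F) ->
  (forall x, intble setT (fun y => F (x, y))) ->
  (forall y, intble setT (fun x => F (x, y))) ->
  intble setT (fun x => \int[mu]_y F (x, y)) /\
  \int[mu]_x \int[mu]_y F (x, y) = \int[mu]_y \int[mu]_x F (x, y).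
Proof.
move=> iF iF1 iF2.
have E1 x : (\int[mu]_y (EFin \o F) (x, y) = (\int[mu]_y F (x, y))%:E)%E.
  by rewrite fineK//; exact: (integrable_fin_num measurableT (iF1 x)).
have E2 y : (\int[mu]_x (EFin \o F) (x, y) = (\int[mu]_x F (x, y))%:E)%E.
  by rewrite fineK//; exact: (integrable_fin_num measurableT (iF2 y)).
split.
  apply: eq_integrable (integrable_fubini_F iF) => // x _.
  exact: E1.
have := Fubini iF.
under eq_integral do rewrite E1.
under [X in _ = X -> _]eq_integral do rewrite E2.
by move=> fub; rewrite /Rintegral fub.
Qed.

End fubini_real.

(** * Multiplication formula, Poisson averages and inversion *)

Section hartley.
Context {R : realType}.
Notation mu := (@lebesgue_measure R).
Notation T := (measurableTypeR R).
Implicit Types (f g h a b q G : T -> R) (x y z e d k M : R).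

Definition hartley f : T -> R := fun xi => \int[mu]_x (cas (x * xi) * f x).

Lemma intble_cas f z : intble setT f -> intble setT (fun x => cas (x * z) * f x).
Proof.
apply: (@intble_bddM _ _ (fun x => cas (x * z)) _ 2) => // [|x _].
- by apply: cont_meas; exact: cont_casl.
- exact: norm_cas_le2.
Qed.

Lemma hartley_le f z : intble setT f -> `|hartley f z| <= 2 * \int[mu]_x `|f x|.
Proof.
move=> fi; rewrite -RintegralZl//; last exact: intble_norm.
apply: norm_int_le => //.
- exact: intble_meas (intble_cas z fi).
- exact: intbleZ _ measurableT (intble_norm fi).
- by move=> x _; rewrite normrM ler_wpM2r// norm_cas_le2.
Qed.

Lemma cont_hartley f : intble setT f -> continuous (hartley f).
Proof.
move=> fi z.
have := @continuity_under_integral R _ T mu (fun z x => cas (x * z) * f x) setT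
  measurableT (z - 1) (z + 1).
move=> /(_ (fun z _ => intble_cas z fi)) cui.
have := cui _ (fun x => 2 * `|f x|); apply.
- apply: aeW => x _ y _.
  apply: (@cvgM _ _ _ _ (fun z => cas (x * z)) (fun=> f x)); last exact: cvg_cst.
  apply: (@continuous_comp _ _ _ (fun y => x * y) cas); last exact: cont_cas.
  by apply: cvgMr; exact: cvg_id.
- by have := intbleZ 2 measurableT (intble_norm fi).
- move=> y _; apply: aeW => x _.
  by rewrite normrM ler_wpM2r// norm_cas_le2.
- by rewrite inE/= in_itv/=; apply/andP; split; lra.
Qed.

Lemma meas_hartley f : intble setT f -> measurable_fun setT (hartley f).
Proof. by move=> fi; apply: cont_meas; exact: cont_hartley. Qed.

(** The kernel satisfies [cas' (z) = cas (- z)], so differentiation reflects the frequency. This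
    reflection reappears below wherever derivatives are exchanged with multiplication by the
    variable. *)
Lemma der_hartley f z : intble setT f -> intble setT (fun x => x * f x) ->
  is_derive z 1 (hartley f) (hartley (fun x => x * f x) (- z)).
Proof.
move=> fi xfi.
pose F (z x : R) := cas (x * z) * f x.
have dF y x : is_derive y 1 (F ^~ x) (cas (- (x * y)) * (x * f x)).
  have dl : is_derive y 1 (fun y => x * y) x by derive; ring.
  have d1 : is_derive y 1 (fun y => cas (x * y)) (cas (- (x * y)) * x).
    exact: dercomp (der_cas _) dl.
  by rewrite /F; derive; [exact: d1|ring].
have Iz : (`]z - 1, z + 1[%classic : set R) z by rewrite /= in_itv/=; apply/andP; split; lra.
have i1 y : (`]z - 1, z + 1[%classic : set R) y -> mu.-integrable setT (EFin \o F y).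
  by move=> _; exact: intble_cas.
have i2 y x : (`]z - 1, z + 1[%classic : set R) y -> [set: T] x -> derivable (F ^~ x) y 1.
  by move=> _ _; have [] := derP (dF y x).
have i3 : mu.-integrable setT (EFin \o (fun x : T => 2 * `|x * f x|)).
  exact: intbleZ _ measurableT (intble_norm xfi).
have i4 y x : (`]z - 1, z + 1[%classic : set R) y -> [set: T] x ->
    `|partial1of2 F y x| <= 2 * `|x * f x|.
  move=> _ _; rewrite /partial1of2 (derP (dF y x)).2 normrM.
  by rewrite ler_wpM2r// norm_cas_le2.
apply: derI.
  exact: (derivable_under_integral measurableT Iz i1 i2 _ i3 i4).
rewrite (differentiation_under_integral measurableT Iz i1 i2 _ i3 i4)//.
apply: eq_int => x _; rewrite /partial1of2 (derP (dF z x)).2.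
by rewrite mulrN.
Qed.

(** Fubini and the symmetry of the kernel [cas (x * z)] in its two variables. *)
Lemma hartleyM a b : intble setT a -> intble setT b ->
  \int[mu]_z (a z * hartley b z) = \int[mu]_x (b x * hartley a x).
Proof.
move=> ia ib.
pose F (p : T * T) : R := (a p.1 * (cas (p.2 * p.1) * b p.2)).
have i1 z : intble setT (fun x => F (z, x)) by exact: (intbleZ (a z) measurableT (intble_cas z ib)).
have i2 x : intble setT (fun z => F (z, x)).
  apply: eq_intble (intbleZ (b x) measurableT (intble_cas x ia)) => // z _.
  by rewrite /F /= (mulrC x z); ring.
have mF : measurable_fun setT F.
  have ma := intble_meas ia; have mb := intble_meas ib.
  apply: measurable_funM; first exact: measurableT_comp.
  apply: measurable_funM; last exact: measurableT_comp.
  apply: (@measurableT_comp _ _ _ _ _ _ (cas : T -> R)).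
    by apply: cont_meas; exact: cont_cas.
  exact: measurable_funM.
have iF : (mu \x mu)%E.-integrable setT (EFin \o F).
  apply: (@intble_prod _ _ (fun x => `|b x| * (2 * \int[mu]_z `|a z|))) => //.
  - move=> x.
    have -> : `|b x| * (2 * \int[mu]_z `|a z|) = \int[mu]_z (`|b x| * (2 * `|a z|)).
      by rewrite RintegralZl// ?RintegralZl//; [exact: intble_norm|exact: intbleZ _ measurableT (intble_norm ia)].
    apply: le_Rintegral => //; first exact: intble_norm (i2 x).
      by apply: (intbleZ _ measurableT); exact: intbleZ _ measurableT (intble_norm ia).
    move=> z _; rewrite /F/= !normrM.
    rewrite (_ : `|b x| * _ = `|a z| * (2 * `|b x|)); last by ring.
    by rewrite ler_wpM2l// ler_wpM2r// norm_cas_le2.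
  - under eq_fun do rewrite mulrC.
    exact: intbleZ _ measurableT (intble_norm ib).
have [_ fub] := fubini_real iF i1 i2.
transitivity (\int[mu]_z \int[mu]_x F (z, x)).
  by apply: eq_int => z _; rewrite /F/= RintegralZl//; exact: intble_cas.
rewrite fub; apply: eq_int => x _; rewrite /F/= /hartley.
rewrite -RintegralZl//; last exact: intble_cas.
by apply: eq_int => z _; rewrite (mulrC x z); ring.
Qed.

Lemma hartley_poisson G e z : intble setT G -> 0 < e ->
  hartley (fun x => expabs e x * hartley G x) z =
  \int[mu]_y (G y * poisson e (z - y)).
Proof.
move=> iG e0.
transitivity (\int[mu]_x ((expabs e x * cas (x * z)) * hartley G x)).
  by apply: eq_int => x _; ring.
rewrite hartleyM//; last exact: intble_expabs_cas.
apply: eq_int => y _; congr (_ * _); rewrite -int_expabs_cas_cas//.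
by apply: eq_int => x _; ring.
Qed.

Lemma intble_expabsM f e M : 0 < e -> measurable_fun setT f ->
  (forall x, `|f x| <= M) -> intble setT (fun x => expabs e x * f x).
Proof.
move=> e0 mf fM.
have := intble_bddM measurableT mf (fun x _ => fM x) (intble_expabs e0).
by apply: eq_intble => // x _; rewrite mulrC.
Qed.

Lemma intble_convol q e z : 0 < e -> intble setT q ->
  intble setT (fun y => q y * poisson e (z - y)).
Proof.
move=> e0 iq.
have := @intble_bddM _ setT (fun y => poisson e (z - y)) q (2 / e) measurableT.
move=> /(_ (cont_meas (@cont_poisson _ e z e0))) H.
apply: eq_intble (H _ iq) => // [y _|y _]; first by rewrite mulrC.
rewrite ger0_norm ?poisson_ge0// /poisson ler_pdivrMr ?poisson_den//.
rewrite mulrDr -[leLHS]addr0 lerD//.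
  by rewrite expr2 mulrA mulfVK// gt_eqF.
by rewrite mulr_ge0 ?sqr_ge0// divr_ge0// ltW.
Qed.

Lemma int_convol q e : 0 < e -> intble setT q ->
  intble setT (fun x => \int[mu]_y (q y * poisson e (x - y))) /\
  \int[mu]_x (\int[mu]_y (q y * poisson e (x - y))) = 2 * pi * \int[mu]_y q y.
Proof.
move=> e0 iq.
pose F (p : T * T) : R := q p.2 * poisson e (p.1 - p.2).
have i1 x : intble setT (fun y => F (x, y)) by exact: intble_convol.
have pis y : intble setT (fun x : T => poisson e (x - y)).
  by apply: eq_intble (intble_poisson y e0) => // x _; rewrite -poissonN opprB.
have pint y : \int[mu]_x poisson e (x - y) = 2 * pi.
  by rewrite -(int_poisson y e0); apply: eq_int => x _; rewrite -poissonN opprB.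
have i2 y : intble setT (fun x => F (x, y)) by exact: (intbleZ (q y) measurableT (pis y)).
have mF : measurable_fun setT F.
  have mq := intble_meas iq.
  apply: measurable_funM; first exact: measurableT_comp.
  apply: (@measurableT_comp _ _ _ _ _ _ (poisson e : T -> R)).
    have := @cont_poisson R e 0 e0; under eq_fun do rewrite sub0r poissonN.
    exact: cont_meas.
  exact: measurable_funB.
have iF : (mu \x mu)%E.-integrable setT (EFin \o F).
  apply: (@intble_prod _ _ (fun y => 2 * pi * `|q y|)) => // [y|].
  - rewrite /F/= mulrC -(pint y) -RintegralZl; [|by []|exact: pis].
    rewrite le_eqVlt; apply/orP; left; apply/eqP; apply: eq_int => x _.
    by rewrite normrM [X in _ * X]ger0_norm ?poisson_ge0.
  - exact: intbleZ _ measurableT (intble_norm iq).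
have [ii ->] := fubini_real iF i1 i2; split => //.
rewrite -RintegralZl//; apply: eq_int => y _.
rewrite /F/= RintegralZl; [|by []|exact: pis].
by rewrite mulrC; congr (_ * _); exact: pint.
Qed.

(** Near [z] the oscillation [k] of [G] is multiplied by the mass [2 * pi]. Away from [z] the kernel
    is at most [2 e / d^2], which pairs with the integrable [G], and also at most [e (1 + d^(-2))]
    times the kernel of parameter 1, which pairs with the constant [G z]; both contributions are of
    order [e]. *)
Lemma poisson_approx_bound G z e d k : 0 < e -> 0 < d ->
  (forall y, `|z - y| < d -> `|G y - G z| <= k) -> 0 <= k ->
  intble setT G ->
  `|\int[mu]_y (G y * poisson e (z - y)) - 2 * pi * G z| <=
  2 * pi * k + e * (2 / d ^+ 2 * \int[mu]_y `|G y| +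
                    `|G z| * (1 + d ^- 2) * (2 * pi)).
Proof.
move=> e0 d0 Gd k0 iG.
have iP := intble_poisson z e0; have iP1 := @intble_poisson R 1 z ltr01.
have -> : \int[mu]_y (G y * poisson e (z - y)) - 2 * pi * G z =
    \int[mu]_y (G y * poisson e (z - y) - G z * poisson e (z - y)).
  rewrite RintegralB//; [|exact: intble_convol|exact: (intbleZ _ measurableT)].
  by rewrite RintegralZl// int_poisson// mulrC.
pose B y := k * poisson e (z - y) + (e * (2 / d ^+ 2) * `|G y| +
  e * (`|G z| * (1 + d ^- 2)) * poisson 1 (z - y)).
have iB1 : intble setT (fun y => k * poisson e (z - y)) by exact: (intbleZ _ measurableT).
have iB2 : intble setT (fun y => e * (2 / d ^+ 2) * `|G y|) by exact: intbleZ _ measurableT (intble_norm iG).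
have iB3 : intble setT (fun y => e * (`|G z| * (1 + d ^- 2)) * poisson 1 (z - y)) by exact: (intbleZ _ measurableT).
have iB23 := intbleD measurableT iB2 iB3.
have iB : intble setT B by exact: intbleD.
have -> : 2 * pi * k + e * (2 / d ^+ 2 * \int[mu]_y `|G y| +
    `|G z| * (1 + d ^- 2) * (2 * pi)) = \int[mu]_y B y.
  rewrite /B RintegralD// RintegralD// RintegralZl//.
  rewrite RintegralZl//; last exact: intble_norm.
  by rewrite RintegralZl// !int_poisson//; ring.
apply: norm_int_le => //.
  by apply: intble_meas; apply: intbleB => //; [exact: intble_convol|exact: (intbleZ _ measurableT)].
move=> y _; rewrite -mulrBl normrM [X in _ * X]ger0_norm ?poisson_ge0// /B.
have p0 := poisson_ge0 (z - y) e0; have p1 := @poisson_ge0 R 1 (z - y) ltr01.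
have dd : 0 <= 1 + d ^- 2 by rewrite addr_ge0// invr_ge0 exprn_ge0// ltW.
have [zyd|dzy] := ltP `|z - y| d.
  rewrite -[leLHS]addr0 lerD// ?ler_wpM2r// ?Gd//.
  apply: addr_ge0; last by apply: mulr_ge0 => //; rewrite mulr_ge0 ?(ltW e0)// mulr_ge0.
  by rewrite mulr_ge0// mulr_ge0 ?(ltW e0)// divr_ge0// exprn_ge0// ltW.
have zz : d ^+ 2 <= (z - y) ^+ 2.
  by rewrite -[leRHS]real_normK ?num_real// lerXn2r ?nnegrE ?(ltW d0).
have dd0 : 0 < d ^+ 2 by rewrite exprn_gt0.
have zz0 : 0 < (z - y) ^+ 2 by exact: lt_le_trans zz.
have q1 : poisson e (z - y) <= e * (2 / d ^+ 2).
  rewrite /poisson ler_pdivrMr ?poisson_den//.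
  rewrite (_ : e * (2 / d ^+ 2) * _ = 2 * e * ((e ^+ 2 + (z - y) ^+ 2) / d ^+ 2)); last by ring.
  rewrite ler_peMr ?mulr_ge0 ?(ltW e0)// ler_pdivlMr// mul1r.
  by rewrite (le_trans zz)// lerDr sqr_ge0.
have q2 : poisson e (z - y) <= e * (1 + d ^- 2) * poisson 1 (z - y).
  rewrite /poisson ler_pdivrMr ?poisson_den// expr1n.
  rewrite (_ : e * (1 + d ^- 2) * (2 * 1 / (1 + (z - y) ^+ 2)) * _ = 2 * e * ((1 + d ^- 2) * (e ^+ 2 + (z - y) ^+ 2) / (1 + (z - y) ^+ 2))); last by ring.
  rewrite ler_peMr ?mulr_ge0 ?(ltW e0)// ler_pdivlMr ?mul1r; last by rewrite ltr_wpDr// ltW.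
  apply: (@le_trans _ _ ((1 + d ^- 2) * (z - y) ^+ 2)).
    by rewrite mulrDl mul1r addrC lerD2l ler_pdivlMl// mulr1.
  by rewrite ler_wpM2l// lerDr sqr_ge0.
rewrite (le_trans (ler_wpM2r p0 (ler_normB _ _)))// mulrDl.
apply: (@le_trans _ _ (0 + (e * (2 / d ^+ 2) * `|G y| +
  e * (`|G z| * (1 + d ^- 2)) * poisson 1 (z - y)))); last by rewrite lerD// mulr_ge0.
rewrite add0r lerD//; first by rewrite mulrC ler_wpM2r.
rewrite (_ : e * (`|G z| * _) * _ = `|G z| * (e * (1 + d ^- 2) * poisson 1 (z - y))); last by ring.
by rewrite ler_wpM2l.
Qed.

Lemma poisson_approx G z : intble setT G -> {for z, continuous G} ->
  \int[mu]_y (G y * poisson n.+1%:R^-1 (z - y)) @[n --> \oo] --> 2 * pi * G z.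
Proof.
move=> iG cG; suff key (k : R) : 0 < k -> \forall n \near \oo,
    `|2 * pi * G z - \int[mu]_y (G y * poisson n.+1%:R^-1 (z - y))| <= k.
  by apply/cvgrPdist_le => k; exact: key.
move=> k0; have pi0 : 0 < 2 * pi :> R by rewrite mulr_gt0// pi_gt0.
(* By this choice [2 * pi * k1 = k / 2] pays for the oscillation of [G] near [z]; the other half is
   left for the tail [A / n.+1%:R]. *)
pose k1 : R := k / 2 / (2 * pi).
have kE : k = 2 * pi * k1 + k / 2 :> R.
  have e1 : 2 * pi * k1 = k / 2 by rewrite /k1 mulrC divfK// gt_eqF.
  by rewrite e1; lra.
have k10 : 0 < k1 by rewrite !divr_gt0.
have /cvgrPdist_le /(_ _ k10) [d /= d0 dG] := cG.
pose A := 2 / d ^+ 2 * \int[mu]_y `|G y| + `|G z| * (1 + d ^- 2) * (2 * pi).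
have A0 : 0 <= A.
  apply: addr_ge0; first by apply: mulr_ge0; [rewrite divr_ge0// exprn_ge0// ltW|exact: Rintegral_ge0].
  apply: mulr_ge0; last exact: ltW.
  by rewrite mulr_ge0// addr_ge0// invr_ge0 exprn_ge0// ltW.
near=> n.
have n0 : 0 < n.+1%:R^-1 :> R by rewrite invr_gt0.
rewrite distrC (le_trans (@poisson_approx_bound G z _ d k1 n0 d0 _ (ltW k10) iG))//.
  by move=> y yd; rewrite distrC; apply: dG.
rewrite -/A [leRHS]kE lerD2l mulrC ler_pdivrMr// -ler_pdivrMl ?divr_gt0//.
near: n.
have : \forall n \near \oo, (k / 2)^-1 * A <= n%:R by exact: nbhs_infty_ger.
by apply: filterS => n /le_trans; apply; rewrite ler_nat.
Unshelve. all: by end_near. Qed.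

Lemma cvg_expabs x : expabs n.+1%:R^-1 x @[n --> \oo] --> (1 : R).
Proof.
rewrite -[X in _ --> X](@expR0 R) -oppr0 -[X in - X](mul0r `|x|).
apply: (@cvg_comp _ _ _ (fun n => - (n.+1%:R^-1 * `|x|)) expR _ (nbhs (- (0 * `|x|))));
  last exact: continuous_expR.
by apply: cvgN; apply: cvgMl; exact: cvg_harmonic.
Qed.

(** The damped double transform has two limits: as a Poisson average it tends to [2 * pi * G z], and
    by dominated convergence to the undamped double transform. *)
Lemma hartley_inversion G z : intble setT G -> intble setT (hartley G) ->
  {for z, continuous G} -> hartley (hartley G) z = 2 * pi * G z.
Proof.
move=> iG iH cG; have cv := poisson_approx iG cG.
have n0 n : 0 < n.+1%:R^-1 :> R by rewrite invr_gt0.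
have /(_ _)/esym hp n := @hartley_poisson G _ z iG (n0 n).
rewrite (funext hp) in cv.
rewrite -(cvg_lim _ cv)//; apply/esym/cvg_lim => //.
have [] // := @dominated_cvgR _ setT
  (fun n x => cas (x * z) * (expabs n.+1%:R^-1 x * hartley G x))
  (fun x => cas (x * z) * hartley G x) (fun x => 2 * `|hartley G x|).
- move=> n; apply: intble_meas; apply: intble_cas.
  apply: intble_expabsM => //; first exact: intble_meas.
  by move=> x; exact: hartley_le.
- move=> x _; apply: cvgMr; rewrite -[X in _ --> X]mul1r.
  by apply: cvgMl; exact: cvg_expabs.
- exact: intbleZ _ measurableT (intble_norm iH).
- move=> n x _; rewrite !normrM ler_pM//; first exact: norm_cas_le2.
  by rewrite ler_piMl// ger0_norm ?(ltW (expabs_gt0 _ _))// expabs_le1// ltW.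
Qed.

End hartley.

(** * One half of Plancherel's theorem *)

Section bessel.
Context {R : realType}.
Notation mu := (@lebesgue_measure R).
Notation T := (measurableTypeR R).
Implicit Types (f g h G : T -> R) (x y z e M m : R) (D : set T).

Lemma sqr_intble D f m : measurable D -> measurable_fun D f ->
  (\int[mu]_(x in D) ((f x) ^+ 2)%:E <= m%:E)%E ->
  intble D (fun x => f x ^+ 2) /\ \int[mu]_(x in D) (f x ^+ 2) <= m.
Proof.
move=> mD mf fm.
have fi : intble D (fun x => f x ^+ 2).
  apply/integrableP; split; first by apply/measurable_EFinP; exact: measurable_funX.
  apply: (@le_lt_trans _ _ m%:E); last exact: ltry.
  apply: le_trans fm; rewrite le_eqVlt; apply/orP; left; apply/eqP.
  by apply: eq_integral => x _; rewrite /= ger0_norm// sqr_ge0.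
split=> //; rewrite -lee_fin fineK//; exact: (integrable_fin_num mD fi).
Qed.

Lemma intble_sqr D f m : measurable D -> intble D (fun x => f x ^+ 2) ->
  \int[mu]_(x in D) (f x ^+ 2) <= m ->
  (\int[mu]_(x in D) ((f x) ^+ 2)%:E <= m%:E)%E.
Proof.
move=> mD fi; rewrite -lee_fin fineK//; exact: (integrable_fin_num mD fi).
Qed.

(** The multiplication formula turns the left side into the pairing of [h] with its own Poisson
    average. Then [|h x * h y| <= (h x ^+ 2 + h y ^+ 2) / 2], and the kernel has mass [2 * pi] in
    either variable, whatever [e] is. *)
Lemma bessel h e m : 0 < e -> intble setT h ->
  (\int[mu]_x (h x ^+ 2)%:E <= m%:E)%E ->
  (\int[mu]_z (expabs e z * hartley h z ^+ 2)%:E <= (2 * pi * m)%:E)%E.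
Proof.
move=> e0 ih hm; have mh := intble_meas ih.
have [ih2 ihm] := sqr_intble measurableT mh hm.
have HM z : `|hartley h z| <= 2 * \int[mu]_x `|h x| by exact: hartley_le.
have ia : intble setT (fun z => expabs e z * hartley h z).
  by apply: intble_expabsM => //; exact: meas_hartley.
have ia2 : intble setT (fun z => expabs e z * hartley h z ^+ 2).
  apply: eq_intble (intble_bddM measurableT (meas_hartley ih) (fun z _ => HM z) ia) => // z _.
  by ring.
rewrite -[X in (X <= _)%E]fineK; last exact: (integrable_fin_num measurableT ia2).
rewrite lee_fin.
have -> : fine (\int[mu]_z (expabs e z * hartley h z ^+ 2)%:E) =
    \int[mu]_x (h x * \int[mu]_y (h y * poisson e (x - y))).
  transitivity (\int[mu]_z ((expabs e z * hartley h z) * hartley h z)).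
    by apply: eq_int => z _; ring.
  rewrite (hartleyM ia ih); apply: eq_int => x _; congr (_ * _).
  exact: hartley_poisson.
have [iI _] := int_convol e0 ih.
have [iJ intJ] := int_convol e0 ih2.
pose B x := pi * h x ^+ 2 + 2^-1 * \int[mu]_y (h y ^+ 2 * poisson e (x - y)).
have iB1 := intbleZ pi measurableT ih2.
have iB2 := intbleZ 2^-1 measurableT iJ.
have iB : intble setT B by exact: intbleD.
apply: (@le_trans _ _ (\int[mu]_x B x)); last first.
  rewrite /B RintegralD// RintegralZl// RintegralZl// intJ.
  have := pi_gt0 R; move: ihm; set s := Rintegral _ _ _ => sm p0.
  have : pi * s <= pi * m by rewrite ler_wpM2l// ltW.
  by lra.
apply: (le_trans (ler_norm _)); apply: norm_int_le => //.
  by apply: measurable_funM => //; exact: intble_meas iI.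
move=> x _; rewrite normrM.
have iC : intble setT (fun y => `|h y * poisson e (x - y)|).
  exact: intble_norm (intble_convol x e0 ih).
apply: (@le_trans _ _ (`|h x| * \int[mu]_y `|h y * poisson e (x - y)|)).
  by rewrite ler_wpM2l// le_normr_Rintegral//; exact: intble_convol.
rewrite -RintegralZl//.
have iD1 := intbleZ (2^-1 * h x ^+ 2) measurableT (intble_poisson x e0).
have iD2 := intbleZ 2^-1 measurableT (intble_convol x e0 ih2).
have -> : B x = \int[mu]_y (2^-1 * h x ^+ 2 * poisson e (x - y) +
    2^-1 * (h y ^+ 2 * poisson e (x - y))).
  rewrite RintegralD// RintegralZl//; last exact: intble_poisson.
  rewrite int_poisson// RintegralZl//; last exact: intble_convol.
  by rewrite /B; congr (_ + _); field.
apply: le_Rintegral => //; [exact: intbleZ|exact: intbleD|move=> y _].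
rewrite normrM [`|poisson _ _|]ger0_norm ?poisson_ge0//.
rewrite (_ : _ + 2^-1 * _ = (2^-1 * h x ^+ 2 + 2^-1 * h y ^+ 2) * poisson e (x - y)); last by ring.
rewrite mulrA ler_wpM2r ?poisson_ge0//.
rewrite -(real_normK (num_real (h x))) -(real_normK (num_real (h y))).
by have := sqr_ge0 (`|h x| - `|h y|); nra.
Qed.

(* Abel summation: [G] is recovered pointwise from the damped transforms of [hartley G], to which [bessel] applies. *)
Lemma hartley_L2_lower G m D : measurable D -> intble setT G ->
  (forall z, D z -> {for z, continuous G}) ->
  (\int[mu]_x (hartley G x ^+ 2)%:E <= m%:E)%E ->
  (\int[mu]_(z in D) (G z ^+ 2)%:E <= m%:E)%E.
Proof.
move=> mD iG cG Hm.
have n0 n : 0 < n.+1%:R^-1 :> R by rewrite invr_gt0.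
have p0 : 0 < 2 * pi :> R by rewrite mulr_gt0// pi_gt0.
have mH := meas_hartley iG.
have [iH2 _] := sqr_intble measurableT mH Hm.
pose h n x := expabs n.+1%:R^-1 x * hartley G x.
have ih n : intble setT (h n).
  by apply: intble_expabsM => // x; exact: hartley_le.
have hm n : (\int[mu]_x (h n x ^+ 2)%:E <= m%:E)%E.
  apply: le_trans Hm; apply: ge0_le_integral => //.
  - by move=> x _; rewrite lee_fin sqr_ge0.
  - by apply/measurable_EFinP/measurable_funX; exact: intble_meas (ih n).
  - by apply/measurable_EFinP/measurable_funX.
  move=> x _; rewrite lee_fin /h exprMn ler_piMl ?sqr_ge0//.
  by rewrite exprn_ile1 ?(ltW (expabs_gt0 _ _))// expabs_le1// ltW.
have hH n z : hartley (h n) z = \int[mu]_y (G y * poisson n.+1%:R^-1 (z - y)).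
  exact: hartley_poisson.
have key : (\int[mu]_(z in D) ((2 * pi * G z) ^+ 2)%:E <= (2 * pi * m)%:E)%E.
  apply: (@fatou_le _ _ (fun n z => expabs n.+1%:R^-1 z * hartley (h n) z ^+ 2)) => //.
  - move=> n; apply: measurable_funTS; apply: measurable_funM.
      by apply: cont_meas; exact: cont_expabs.
    by apply: measurable_funX; exact: meas_hartley.
  - by move=> n x _; rewrite mulr_ge0 ?sqr_ge0// ltW// expabs_gt0.
  - move=> z Dz; rewrite -[X in _ --> X]mul1r; apply: cvgM; first exact: cvg_expabs.
    have cv := poisson_approx iG (cG _ Dz).
    under eq_fun do rewrite hH expr2.
    by rewrite expr2; exact: cvgM.
  - move=> n; apply: le_trans (bessel (n0 n) (ih n) (hm n)).
    apply: ge0_subset_integral => //.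
      apply/measurable_EFinP; apply: measurable_funM.
        by apply: cont_meas; exact: cont_expabs.
      by apply: measurable_funX; exact: meas_hartley.
    by move=> x _; rewrite lee_fin mulr_ge0 ?sqr_ge0// ltW// expabs_gt0.
have mG : measurable_fun D G by apply: measurable_funTS; exact: intble_meas.
have [i1 i2] := sqr_intble mD (measurable_funM (measurable_cst _) mG : measurable_fun D (fun z => 2 * pi * G z)) key.
have iG2 : intble D (fun z => G z ^+ 2).
  apply: eq_intble (intbleZ ((2 * pi) ^- 2) mD i1) => // x _.
  by rewrite (exprMn _ (2 * pi)) mulKf// sqrf_eq0 gt_eqF.
apply: intble_sqr => //.
have E : \int[mu]_(z in D) ((2 * pi * G z) ^+ 2) = (2 * pi) ^+ 2 * \int[mu]_(z in D) (G z ^+ 2).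
  by rewrite -RintegralZl//; apply: eq_int => x _; rewrite exprMn.
(* One factor [2 * pi] cancels; the other is discarded, being at least 1. *)
move: i2; rewrite E expr2 -mulrA ler_pM2l// => /(le_trans _); apply.
rewrite ler_peMl//; first by apply: Rintegral_ge0 => x _; exact: sqr_ge0.
by have := pi_ge2 R; lra.
Qed.

End bessel.

(** * Oscillatory integrals *)

Section van_der_corput.
Context {R : realType}.
Notation mu := (@lebesgue_measure R).
Notation T := (measurableTypeR R).
Implicit Types (f g p k : R -> R) (a b c r s t x y z K : R).

Lemma int_itv_split f a b c : a <= c -> c <= b -> continuous f ->
  \int[mu]_(s in `[a, b]) f s = \int[mu]_(s in `[a, c]) f s + \int[mu]_(s in `[c, b]) f s.
Proof.
move=> ac cb cf.
have ii x y : intble `[x, y] f by apply: intble_compact => z _; exact: cf.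
have ab := le_trans ac cb.
have -> : \int[mu]_(s in `[c, b]) f s = \int[mu]_(s in `]c, b]) f s.
  rewrite -Rintegral_itv_obnd_cbnd//; apply: intbleS (ii c b).
  - exact: meas_itv.
  - exact: meas_itv.
  - exact: subset_itv_oc_cc.
have := @Rintegral_itvB _ f (BLeft a) (BRight b) c (ii a b).
by rewrite !bnd_simp => /(_ ac cb) <-; ring.
Qed.

Lemma int_itv_le f a b : a <= b -> continuous f -> (forall s, `|f s| <= 1) ->
  `|\int[mu]_(s in `[a, b]) f s| <= b - a.
Proof.
move=> ab cf f1; have mab := @meas_itv R `[a, b].
have -> : b - a = \int[mu]_(s in `[a, b]) (1 : R).
  by rewrite (@ftc_compact _ id (fun=> 1))// => x _; exact: cvg_cst.
apply: norm_int_le => //.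
  by apply: measurable_funTS; exact: cont_meas.
by apply: intble_compact => x _; exact: cvg_cst.
Qed.

Section oscillating.
Variables (p p1 p2 : R -> R).
Hypothesis dp : forall s, is_derive s 1 p (p1 s).
Hypothesis dp1 : forall s, is_derive s 1 p1 (p2 s).
Hypothesis cp2 : continuous p2.

Let cp : continuous p. Proof. by move=> s; exact: der_cont (dp s). Qed.
Let cp1 : continuous p1. Proof. by move=> s; exact: der_cont (dp1 s). Qed.

Lemma cont_cosp : continuous (fun s => cos (p s)).
Proof. by move=> s; apply: continuous_comp; [exact: cp|exact: continuous_cos]. Qed.

(** Integration by parts: [cos p] differs from the derivative of [sin p / p1] by
    [sin p * p2 / p1 ^+ 2]. The classical monotonicity of [p1] is replaced by a primitive [K] of a
    majorant of the error, because on one piece of the quartic [p1] may rise and then fall. *)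
Lemma vdc_first (K k : R -> R) a b r : 0 < r -> a <= b ->
  (forall s, a <= s <= b -> r <= p1 s) ->
  (forall s, a <= s <= b -> is_derive s 1 K (k s)) ->
  (forall s, a <= s <= b -> {for s, continuous k}) ->
  (forall s, a <= s <= b -> `|p2 s| / p1 s ^+ 2 <= k s) ->
  `|\int[mu]_(s in `[a, b]) cos (p s)| <= 2 / r + (K b - K a).
Proof.
move=> r0 ab p1r dK ck p2k.
have mab := @meas_itv R `[a, b].
have p10 s : a <= s <= b -> 0 < p1 s by move=> /p1r; exact: lt_le_trans.
pose h s := sin (p s) / p1 s.
pose e s := sin (p s) * (p2 s / p1 s ^+ 2).
have dh s : a <= s <= b -> is_derive s 1 h (cos (p s) - e s).
  move=> /p10 p0; rewrite /h; derive; [exact: dp|by rewrite gt_eqF|exact: dp1|].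
  by rewrite /e; field; rewrite gt_eqF.
have ce s : a <= s <= b -> {for s, continuous e}.
  move=> /p10 p0; apply: cvgM.
    by apply: continuous_comp; [exact: cp|exact: continuous_sin].
  apply: cvgM; first exact: cp2.
  apply: cvgV; first by rewrite expf_neq0// gt_eqF.
  by apply: cont_sqr; exact: cp1.
have icos : intble `[a, b] (fun s => cos (p s)).
  by apply: intble_compact => s _; exact: cont_cosp.
have ie : intble `[a, b] e by exact: intble_compact.
have ik : intble `[a, b] k by exact: intble_compact.
have ei : \int[mu]_(s in `[a, b]) cos (p s) = (h b - h a) + \int[mu]_(s in `[a, b]) e s.
  rewrite -(@ftc_compact _ h (fun s => cos (p s) - e s))//; last first.
    by move=> s sab; apply: cvgB; [exact: cont_cosp|exact: ce].
  by rewrite RintegralB// subrK.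
have hr s : a <= s <= b -> `|h s| <= r^-1.
  move=> sab; rewrite /h normrM normfV (gtr0_norm (p10 _ sab)).
  rewrite -[leRHS]mul1r ler_pM// ?invr_ge0 ?(ltW (p10 _ sab))//.
    by rewrite ler_norml sin_geN1 sin_le1.
  by rewrite lef_pV2 ?posrE ?p10// p1r.
rewrite ei (le_trans (ler_normD _ _))// lerD//.
  rewrite (le_trans (ler_normB _ _))// mulr_natl mulr2n lerD// hr// ?lexx ?ab//.
rewrite -(ftc_compact ab dK ck); apply: norm_int_le => //; first exact: intble_meas ie.
move=> s /=; rewrite in_itv/= => sab; rewrite /e normrM.
apply: le_trans (p2k _ sab); rewrite normrM normfV.
rewrite [X in _ / X]ger0_norm ?sqr_ge0// ler_piMl//.
  by rewrite divr_ge0// sqr_ge0.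
by rewrite ler_norml sin_geN1 sin_le1.
Qed.

Lemma der_invp1 s : 0 < p1 s -> is_derive s 1 (fun s => (p1 s)^-1) (- (p2 s / p1 s ^+ 2)).
Proof.
move=> p0; derive; [by rewrite gt_eqF|exact: dp1|].
by field; rewrite gt_eqF.
Qed.

Lemma cont_p2p1 s : 0 < p1 s -> {for s, continuous (fun s => p2 s / p1 s ^+ 2)}.
Proof.
move=> p0; apply: cvgM; first exact: cp2.
apply: cvgV; first by rewrite expf_neq0// gt_eqF.
by apply: cont_sqr; exact: cp1.
Qed.

(** When [p1] increases, the error majorant is itself the derivative of [- p1^-1], whose variation
    adds [1 / r] to the boundary terms [2 / r]. *)
Lemma vdc_first_incr a b r : 0 < r -> a <= b ->
  (forall s, a <= s <= b -> r <= p1 s) -> (forall s, a <= s <= b -> 0 <= p2 s) ->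
  `|\int[mu]_(s in `[a, b]) cos (p s)| <= 3 / r.
Proof.
move=> r0 ab p1r p20.
have p10 s : a <= s <= b -> 0 < p1 s by move=> /p1r; exact: lt_le_trans.
have aab : a <= a <= b by rewrite lexx.
have bab : a <= b <= b by rewrite lexx andbT.
apply: (le_trans (@vdc_first (fun s => - (p1 s)^-1) (fun s => p2 s / p1 s ^+ 2) a b r r0 ab p1r _ _ _)).
- move=> s sab; rewrite -[_ / _]opprK; apply: derN; apply: der_invp1; exact: p10.
- by move=> s sab; apply: cont_p2p1; exact: p10.
- by move=> s sab; rewrite ger0_norm ?p20.
rewrite (_ : 3 / r = 2 / r + r^-1); last by ring.
rewrite lerD2l opprK addrC; apply: (@le_trans _ _ (p1 a)^-1).
  by rewrite gerDl oppr_le0 invr_ge0 ltW// p10.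
by rewrite lef_pV2 ?posrE ?p10// p1r.
Qed.

Lemma vdc_first_decr a b r : 0 < r -> a <= b ->
  (forall s, a <= s <= b -> r <= p1 s) -> (forall s, a <= s <= b -> p2 s <= 0) ->
  `|\int[mu]_(s in `[a, b]) cos (p s)| <= 3 / r.
Proof.
move=> r0 ab p1r p20.
have p10 s : a <= s <= b -> 0 < p1 s by move=> /p1r; exact: lt_le_trans.
have aab : a <= a <= b by rewrite lexx.
have bab : a <= b <= b by rewrite lexx andbT.
apply: (le_trans (@vdc_first (fun s => (p1 s)^-1) (fun s => - (p2 s / p1 s ^+ 2)) a b r r0 ab p1r _ _ _)).
- by move=> s sab; apply: der_invp1; exact: p10.
- by move=> s sab; apply: cvgN; apply: cont_p2p1; exact: p10.
- by move=> s sab; rewrite ler0_norm ?p20// mulNr.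
rewrite (_ : 3 / r = 2 / r + r^-1); last by ring.
rewrite lerD2l; apply: (@le_trans _ _ (p1 b)^-1).
  by rewrite gerDl oppr_le0 invr_ge0 ltW// p10.
by rewrite lef_pV2 ?posrE ?p10// p1r.
Qed.

Lemma growth a b m : a <= b -> (forall s, a <= s <= b -> m <= p2 s) ->
  m * (b - a) <= p1 b - p1 a.
Proof.
rewrite le_eqVlt => /predU1P[<- _|ab p2m]; first by rewrite !subrr mulr0.
have [|c cab ->] := @MVT _ p1 p2 a b ab (fun s _ => dp1 s).
  by apply: continuous_subspaceT; exact: cp1.
move: cab; rewrite in_itv/= => /andP[ac cb].
by rewrite ler_wpM2r ?subr_ge0 ?(ltW ab)// p2m// (ltW ac) (ltW cb).
Qed.

End oscillating.

Section second.
Variables (p p1 p2 : R -> R).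
Hypothesis dp : forall s, is_derive s 1 p (p1 s).
Hypothesis dp1 : forall s, is_derive s 1 p1 (p2 s).
Hypothesis cp2 : continuous p2.

Let ccos := cont_cosp dp.
Let cos1 s : `|cos (p s)| <= 1. Proof. by rewrite ler_norml cos_geN1 cos_le1. Qed.

(** An initial piece of length [r^-1] is estimated trivially. Beyond it [p1] has grown to at least
    [r ^+ 2 * r^-1 = r] and keeps increasing, so the first-derivative bound gives [3 / r]. *)
Lemma vdc_second_pos a b r : 0 < r -> a <= b -> 0 <= p1 a ->
  (forall s, a <= s <= b -> r ^+ 2 <= p2 s) ->
  `|\int[mu]_(s in `[a, b]) cos (p s)| <= 4 / r.
Proof.
move=> r0 ab pa p2r.
have r0V : 0 < r^-1 by rewrite invr_gt0.
have [ba|ba] := leP b (a + r^-1).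
  apply: (le_trans (int_itv_le ab ccos cos1)).
  by move: ba r0V; lra.
rewrite (@int_itv_split _ _ _ (a + r^-1))//; [|by rewrite lerDl ltW|exact: ltW].
rewrite (le_trans (ler_normD _ _))//.
rewrite (_ : 4 / r = r^-1 + 3 / r); last by ring.
apply: lerD.
  apply: (le_trans (int_itv_le _ ccos cos1)); first by rewrite lerDl ltW.
  by rewrite addrAC subrr add0r.
apply: (vdc_first_incr dp dp1 cp2) => //; first exact: ltW.
  move=> s /andP[as_ sb].
  have g1 : r ^+ 2 * (s - a) <= p1 s - p1 a.
    apply: (growth dp1); first by apply: le_trans as_; rewrite lerDl ltW.
    by move=> z /andP[az zs]; apply: p2r; rewrite az (le_trans zs sb).
  have g2 : r <= r ^+ 2 * (s - a).
    apply: (@le_trans _ _ (r ^+ 2 * r^-1)); first by rewrite expr2 mulfK// gt_eqF.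
    by rewrite ler_wpM2l ?sqr_ge0// lerBrDl.
  by lra.
move=> s /andP[as_ sb]; apply: le_trans (p2r s _); first exact: sqr_ge0.
by rewrite sb andbT (le_trans _ as_)// lerDl ltW.
Qed.

Lemma vdc_second_neg a b r : 0 < r -> a <= b -> p1 b <= 0 ->
  (forall s, a <= s <= b -> r ^+ 2 <= p2 s) ->
  `|\int[mu]_(s in `[a, b]) cos (p s)| <= 4 / r.
Proof.
move=> r0 ab pa p2r.
have r0V : 0 < r^-1 by rewrite invr_gt0.
have [ba|ba] := leP b (a + r^-1).
  apply: (le_trans (int_itv_le ab ccos cos1)).
  by move: ba r0V; lra.
have br : b - r^-1 <= b by rewrite gerBl ltW.
have abr : a <= b - r^-1 by rewrite lerBrDr ltW.
rewrite (@int_itv_split _ _ _ (b - r^-1))//.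
rewrite (le_trans (ler_normD _ _))//.
rewrite (_ : 4 / r = 3 / r + r^-1); last by ring.
apply: lerD; last first.
  by apply: (le_trans (int_itv_le br ccos cos1)); rewrite opprB addrCA subrr addr0.
(* Mirror image of the previous case: the short piece sits at the right end, and negating the phase
   makes its derivative positive and decreasing. *)
have -> : \int[mu]_(s in `[a, b - r^-1]) cos (p s) = \int[mu]_(s in `[a, b - r^-1]) cos (- p s).
  by apply: eq_int => s _; rewrite cosN.
apply: (@vdc_first_decr (fun s => - p s) (fun s => - p1 s) (fun s => - p2 s)) => //.
- by move=> s; apply: cvgN; exact: cp2.
- move=> s /andP[as_ sb].
  have g1 : r ^+ 2 * (b - s) <= p1 b - p1 s.
    apply: (growth dp1); first exact: le_trans br.
    by move=> z /andP[sz zb]; apply: p2r; rewrite zb (le_trans as_ sz).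
  have g2 : r <= r ^+ 2 * (b - s).
    apply: (@le_trans _ _ (r ^+ 2 * r^-1)); first by rewrite expr2 mulfK// gt_eqF.
    by rewrite ler_wpM2l ?sqr_ge0//; move: sb; lra.
  by lra.
move=> s /andP[as_ sb]; rewrite oppr_le0; apply: le_trans (p2r s _); first exact: sqr_ge0.
by rewrite as_ (le_trans sb br).
Qed.

(** Since [p1] increases, a change of sign happens at a zero that separates the two preceding cases,
    each costing [4 / r]. *)
Lemma vdc_second a b r : 0 < r -> a <= b ->
  (forall s, a <= s <= b -> r ^+ 2 <= p2 s) ->
  `|\int[mu]_(s in `[a, b]) cos (p s)| <= 8 / r.
Proof.
move=> r0 ab p2r.
have r48 : 4 / r <= 8 / r by rewrite ler_wpM2r ?invr_ge0 ?(ltW r0)// ler_nat.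
have [pa|pa] := leP 0 (p1 a); first exact: le_trans (vdc_second_pos r0 ab pa p2r) r48.
have [pb|pb] := leP (p1 b) 0; first exact: le_trans (vdc_second_neg r0 ab pb p2r) r48.
have [c /[!in_itv]/= /andP[ac cb] pc] : exists2 c, c \in `[a, b] & p1 c = 0.
  apply: IVT => //.
    by apply: continuous_subspaceT => s; exact: der_cont (dp1 s).
  by rewrite minEle maxEle !(ltW (lt_trans pa pb)) (ltW pa) (ltW pb).
rewrite (@int_itv_split _ _ _ c)// (le_trans (ler_normD _ _))//.
rewrite (_ : 8 / r = 4 / r + 4 / r); last by ring.
apply: lerD.
  apply: vdc_second_neg => //; first by rewrite pc.
  by move=> s /andP[as_ sc]; apply: p2r; rewrite as_ (le_trans sc cb).
apply: vdc_second_pos => //; first by rewrite pc.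
by move=> s /andP[as_ sc]; apply: p2r; rewrite sc (le_trans ac as_).
Qed.

End second.

(** The predicate [P] restricts the left endpoint, so that gluings can be nested: a first cut for
    intervals starting at [0] or later, a second one for those starting beyond the first cut. *)
Lemma bound_glue f (P : R -> Prop) c B1 B2 : continuous f -> 0 <= B1 -> 0 <= B2 ->
  (forall a b, P a -> a <= b -> b <= c -> `|\int[mu]_(s in `[a, b]) f s| <= B1) ->
  (forall a b, c <= a -> a <= b -> `|\int[mu]_(s in `[a, b]) f s| <= B2) ->
  forall a b, P a -> a <= b -> `|\int[mu]_(s in `[a, b]) f s| <= B1 + B2.
Proof.
move=> cf B10 B20 h1 h2 a b Pa ab.
have [bc|cb] := leP b c; first by rewrite (le_trans (h1 _ _ Pa ab bc))// lerDl.
have [ca|ac] := leP c a; first by rewrite (le_trans (h2 _ _ ca ab))// lerDr.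
rewrite (@int_itv_split _ _ _ c) ?(ltW ac) ?(ltW cb)//.
by rewrite (le_trans (ler_normD _ _))// lerD ?h1 ?h2 ?(ltW ac) ?(ltW cb).
Qed.

(* With [xi = s ^+ 4] the half-wave phase [x xi + t (xi)^(1/2)] becomes this quartic. *)
Definition quartic x t c s : R := x * s ^+ 4 + t * s ^+ 2 + c.

Section quartic_bound.
Variables (x c r : R).
Hypothesis r0 : 0 < r.
Let t := r ^+ 2.
Let p1 s := 4 * x * s ^+ 3 + 2 * t * s.
Let p2 s := 12 * x * s ^+ 2 + 2 * t.

Let dp s : is_derive s 1 (quartic x t c) (p1 s).
Proof. by rewrite /quartic; derive; rewrite /p1; ring. Qed.

Let dp1 s : is_derive s 1 p1 (p2 s).
Proof. by rewrite /p1; derive; rewrite /p2; ring. Qed.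

Let cp2 : continuous p2.
Proof. by move=> s; rewrite /p2; apply: der_cont; derive; reflexivity. Qed.

Let t0 : 0 < t. Proof. by rewrite exprn_gt0. Qed.

Let ccos := cont_cosp dp.

Lemma quartic_bound_pos a b : 0 <= x -> a <= b ->
  `|\int[mu]_(s in `[a, b]) cos (quartic x t c s)| <= 8 / r.
Proof.
move=> x0 ab; apply: (vdc_second dp dp1 cp2) => // s _.
rewrite /p2 -/t; have : 0 <= x * s ^+ 2 by rewrite mulr_ge0// sqr_ge0.
by have := t0; lra.
Qed.

(* The interval is cut at [r^-1 = t^(-1/2)] and at [P2] with [P2^2 = t / (4 |x|)]: the
   first piece is short, [p1 s >= t s] on the second and [p2 <= - t] on the third. *)
Lemma quartic_bound_neg a b : x < 0 -> 0 <= a -> a <= b ->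
  `|\int[mu]_(s in `[a, b]) cos (quartic x t c s)| <= r^-1 + (7 / r + 8 / r).
Proof.
move=> x0; have r0V : 0 < r^-1 by rewrite invr_gt0.
pose P2 : R := Num.sqrt (t / (4 * - x)).
have tx0 : 0 <= t / (4 * - x).
  by apply: divr_ge0; [exact: ltW t0|rewrite mulr_ge0// oppr_ge0 ltW].
have sP2 s : 0 <= s -> s <= P2 -> - x * s ^+ 2 <= t / 4.
  move=> s0 sp; have : s ^+ 2 <= P2 ^+ 2 by rewrite lerXn2r ?nnegrE ?sqrtr_ge0.
  rewrite /P2 sqr_sqrtr// ler_pdivlMr ?mulr_gt0 ?oppr_gt0// => h.
  by rewrite ler_pdivlMr//; move: h; lra.
have Ps2 s : P2 <= s -> t / 4 <= - x * s ^+ 2.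
  move=> sp; have s0 : 0 <= s by exact: le_trans (sqrtr_ge0 _) sp.
  have : P2 ^+ 2 <= s ^+ 2 by rewrite lerXn2r ?nnegrE ?sqrtr_ge0.
  rewrite /P2 sqr_sqrtr// ler_pdivrMr ?mulr_gt0 ?oppr_gt0// => h.
  by rewrite ler_pdivrMr//; move: h; lra.
apply: (@bound_glue _ (fun a => 0 <= a) r^-1) => //.
- exact: ltW.
- by rewrite addr_ge0// divr_ge0// ltW.
- move=> {}a {}b a0 ab br; apply: (le_trans (int_itv_le ab ccos _)).
    by move=> s; rewrite ler_norml cos_geN1 cos_le1.
  by rewrite lerBlDr (le_trans br)// lerDl.
apply: (@bound_glue _ (fun a => r^-1 <= a) P2) => //.
- by rewrite divr_ge0// ltW.
- by rewrite divr_ge0// ltW.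
- move=> {}a {}b ra ab bP.
  have a0 : 0 < a by exact: lt_le_trans ra.
  have p1ts s : a <= s <= b -> t * s <= p1 s.
    move=> /andP[as_ sb]; have s0 : 0 <= s by rewrite (le_trans (ltW a0)).
    have h1 := sP2 s s0 (le_trans sb bP).
    have h2 : - x * s ^+ 2 * s <= t / 4 * s by rewrite ler_wpM2r.
    have h3 : 0 <= t * s by rewrite mulr_ge0// ltW.
    by rewrite /p1 exprSr; move: h2 h3; lra.
  have rts s : a <= s -> r <= t * s.
    move=> as_; apply: (@le_trans _ _ (t * r^-1)); first by rewrite /t expr2 mulfK// gt_eqF.
    by rewrite ler_wpM2l ?(ltW t0)// (le_trans ra).
  (* On this piece [p2] lies between [- t] and [2 * t], so [5 * t] bounds it amply, and
     [p1 s >= t * s]; hence the majorant [5 / (t s^2)]. As [a >= r^-1], its primitive contributes at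
     most [5 / r]. *)
  have dK s : a <= s <= b -> is_derive s 1 (fun s => - (5 / t * s^-1)) (5 / t * s ^- 2).
    move=> /andP[as_ sb]; have s0 : 0 < s by rewrite (lt_le_trans a0).
    derive; [by rewrite gt_eqF|].
    by field; rewrite !gt_eqF.
  apply: (@le_trans _ _ (2 / r + (- (5 / t * b^-1) - - (5 / t * a^-1)))).
    apply: (@vdc_first _ _ _ dp dp1 cp2 (fun s => - (5 / t * s^-1)) (fun s => 5 / t * s ^- 2)) => //.
    - by move=> s sab; have /andP[as_ _] := sab; exact: le_trans (rts s as_) (p1ts s sab).
    - move=> s /andP[as_ sb]; have s0 : 0 < s by rewrite (lt_le_trans a0).
      apply: cvgMr; apply: cvgV; first by rewrite expf_neq0// gt_eqF.
      by apply: (@cont_sqr _ id); exact: cvg_id.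
    - move=> s sab; have /andP[as_ sb] := sab.
      have s0 : 0 < s by rewrite (lt_le_trans a0).
      have ts0 : 0 < t * s by rewrite mulr_gt0.
      have q1 : `|p2 s| <= 5 * t.
        have h1 := sP2 s (ltW s0) (le_trans sb bP).
        have h2 : 0 <= - x * s ^+ 2 by rewrite mulr_ge0 ?sqr_ge0// oppr_ge0 ltW.
        by rewrite ler_norml /p2; apply/andP; split; have := t0; move: h1 h2; lra.
      apply: (@le_trans _ _ (5 * t / (t * s) ^+ 2)).
        apply: ler_pM => //; first by rewrite invr_ge0 sqr_ge0.
        rewrite lef_pV2 ?posrE ?exprn_gt0//; last exact: lt_le_trans ts0 (p1ts s sab).
        by rewrite lerXn2r ?nnegrE ?(ltW ts0)// ?p1ts// ltW// (lt_le_trans ts0)// p1ts.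
      rewrite le_eqVlt; apply/orP; left; apply/eqP.
      by field; rewrite !gt_eqF.
  have h5 : 0 <= 5 / t * b^-1 by rewrite mulr_ge0 ?divr_ge0 ?invr_ge0 ?(ltW t0)// (le_trans (ltW a0)).
  have h6 : 5 / t * a^-1 <= 5 / r.
    rewrite -mulrA ler_wpM2l// -invfM lef_pV2 ?posrE ?mulr_gt0//; exact: rts.
  rewrite (_ : 7 / r = 2 / r + 5 / r); last by ring.
  by move: h5 h6; set A := 5 / t * b^-1; set B := 5 / t * a^-1; lra.
move=> {}a {}b Pa ab.
have -> : \int[mu]_(s in `[a, b]) cos (quartic x t c s) = \int[mu]_(s in `[a, b]) cos (- quartic x t c s).
  by apply: eq_int => s _; rewrite cosN.
apply: (@vdc_second (fun s => - quartic x t c s) (fun s => - p1 s) (fun s => - p2 s)) => //.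
- by move=> s; exact: derN (dp s).
- by move=> s; exact: derN (dp1 s).
- by move=> s; apply: cvgN; exact: cp2.
move=> s /andP[as_ _]; have := Ps2 s (le_trans Pa as_).
by rewrite /p2 -/t; have := t0; lra.
Qed.

Lemma quartic_bound a b : 0 <= a -> a <= b ->
  `|\int[mu]_(s in `[a, b]) cos (quartic x t c s)| <= 16 / r.
Proof.
move=> a0 ab; have r0V : 0 <= r^-1 by rewrite invr_ge0 ltW.
have [x0|x0] := leP 0 x.
  by rewrite (le_trans (quartic_bound_pos x0 ab))// ler_wpM2r// ler_nat.
by rewrite (le_trans (quartic_bound_neg x0 a0 ab))//; lra.
Qed.

End quartic_bound.
End van_der_corput.

(** * Integration by parts in frequency on the half-line *)

Section half_line_oscillation.
Context {R : realType}.
Notation mu := (@lebesgue_measure R).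
Notation T := (measurableTypeR R).
Implicit Types (F K G f g h : R -> R) (a b c r s t x y z M m : R).

Definition root4 x : R := Num.sqrt (Num.sqrt x).

Lemma root4_gt0 x : 0 < x -> 0 < root4 x.
Proof. by move=> x0; rewrite !sqrtr_gt0. Qed.

Lemma root4_2 x : root4 x ^+ 2 = Num.sqrt x.
Proof. by rewrite sqr_sqrtr// sqrtr_ge0. Qed.

Lemma root4_4 x : 0 <= x -> root4 x ^+ 4 = x.
Proof. by move=> x0; rewrite (exprM _ 2 2) root4_2 sqr_sqrtr. Qed.

Lemma der_root4 x : 0 < x -> is_derive x 1 root4 ((4 * root4 x ^+ 3)^-1).
Proof.
move=> x0; have s0 : 0 < Num.sqrt x by rewrite sqrtr_gt0.
have q0 := root4_gt0 x0.
apply: (@der_eq _ _ _ _ _ (dercomp (is_derive1_sqrt s0) (is_derive1_sqrt x0))).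
rewrite -/(root4 x) -[in X in _ * X = _]root4_2.
by field; rewrite gt_eqF.
Qed.

Lemma cont_root4 : continuous root4.
Proof. by move=> x; apply: continuous_comp; exact: sqrt_continuous. Qed.

Lemma root40 : root4 0 = 0. Proof. by rewrite /root4 !sqrtr0. Qed.

Lemma cvgy_root4 : root4 x @[x --> +oo] --> +oo.
Proof.
apply/cvgryPge => A; near=> x.
have x1 : `|A| ^+ 4 <= x by near: x; apply: nbhs_pinfty_ge; exact: num_real.
apply: (le_trans (ler_norm _)).
have x0 : 0 <= x by apply: le_trans x1; rewrite exprn_ge0.
rewrite -(@ler_pXn2r _ 4)// ?nnegrE ?root4_4//; exact: sqrtr_ge0.
Unshelve. all: by end_near. Qed.

Definition phase x t c z : R := x * z + t * Num.sqrt z + c.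

Lemma phase_quartic x t c z : 0 <= z -> phase x t c z = quartic x t c (root4 z).
Proof. by move=> z0; rewrite /phase /quartic root4_4// root4_2. Qed.

(** Under [xi = s ^+ 4], [4 ds] is [xi^(-3/4) dxi]: this is the primitive from 0 of
    [xi^(-3/4) cos (phase)]. Integrating by parts against it leaves [xi^(3/4)] times the amplitude
    to differentiate. *)
Definition osc x t c z : R :=
  4 * \int[mu]_(s in `[0, root4 z]) cos (quartic x t c s).

Lemma der_osc x r c z : 0 < z ->
  is_derive z 1 (osc x (r ^+ 2) c) (cos (phase x (r ^+ 2) c z) / root4 z ^+ 3).
Proof.
move=> z0; have q0 := root4_gt0 z0; rewrite /osc.
pose J a := \int[mu]_(s in `[0, a]) cos (quartic x (r ^+ 2) c s).
have cq : continuous (fun s => cos (quartic x (r ^+ 2) c s)).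
  move=> s; apply: der_cont; rewrite /quartic; derive; reflexivity.
have dJ : is_derive (root4 z) 1 J (cos (quartic x (r ^+ 2) c (root4 z))).
  have [d1 d2] : derivable J (root4 z) 1 /\ derive1 J (root4 z) =
      cos (quartic x (r ^+ 2) c (root4 z)).
    apply: (@continuous_FTC1_closed _ (fun s => cos (quartic x (r ^+ 2) c s)) 0 (root4 z) (root4 z + 1)) => //.
      by rewrite ltrDl.
    by apply: intble_compact => s _; exact: cq.
    exact: cq.
  exact: derI.
apply: (@der_eq _ _ _ _ _ (derZ 4 (dercomp dJ (der_root4 z0)))).
rewrite phase_quartic ?(ltW z0)//; field; exact: lt0r_neq0.
Qed.

Lemma osc_bound x r c z : 0 < r -> `|osc x (r ^+ 2) c z| <= 64 / r.
Proof.
move=> r0; rewrite /osc normrM ger0_norm//.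
rewrite (_ : 64 / r = 4 * (16 / r)); last by ring.
by rewrite ler_wpM2l//; apply: quartic_bound => //; exact: sqrtr_ge0.
Qed.

Let mP : measurable (`]0, +oo[%classic : set T). Proof. exact: meas_itv. Qed.

Let inP z : (`]0, +oo[%classic : set T) z = (0 < z :> R).
Proof. by rewrite /= in_itv/= andbT. Qed.

(* [weight = 2 (atan (xi^(1/2)))'], so that its integral over the half-line is pi. *)
Definition weight z : R := (root4 z ^+ 2 * (1 + z))^-1.

Lemma weight_ge0 z : 0 < z -> 0 <= weight z.
Proof. by move=> z0; rewrite invr_ge0 mulr_ge0 ?exprn_ge0 ?addr_ge0 ?(ltW z0) ?sqrtr_ge0. Qed.

Lemma der_weight z : 0 < z -> is_derive z 1 (fun z => 2 * atan (Num.sqrt z)) (weight z).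
Proof.
move=> z0; have s0 : 0 < Num.sqrt z by rewrite sqrtr_gt0.
apply: (@der_eq _ _ _ _ _ (derZ 2 (deratan (is_derive1_sqrt z0)))).
rewrite /weight root4_2 sqr_sqrtr ?(ltW z0)//; field.
by rewrite !gt_eqF// addr_gt0.
Qed.

Lemma cont_weight z : 0 < z -> {for z, continuous weight}.
Proof.
move=> z0; have s0 : 0 < Num.sqrt z by rewrite sqrtr_gt0.
apply: cvgV.
  by rewrite mulf_neq0// ?root4_2 gt_eqF// addr_gt0.
apply: cvgM; last by apply: cvgD; [exact: cvg_cst|exact: cvg_id].
by apply: (cont_sqr (@cont_root4 z)).
Qed.

Lemma intble_weight : intble `]0, +oo[ weight.
Proof.
apply: (@intble_der_half _ _ _ pi der_weight cont_weight weight_ge0) => z z0.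
rewrite normrM ger0_norm// -ler_pdivlMl// [leRHS]mulrC ler_norml.
by rewrite (ltW (atan_gtNpi2 _)) (ltW (atan_ltpi2 _)).
Qed.

Lemma int_weight : \int[mu]_(z in `]0, +oo[) weight z = pi.
Proof.
rewrite -[RHS]subr0; apply: (@int_der_half _ (fun z => 2 * atan (Num.sqrt z)) weight 0 pi).
- exact: der_weight.
- exact: cont_weight.
- exact: intble_weight.
- have v0 : 2 * atan (Num.sqrt (0 : R)) = 0 by rewrite sqrtr0 atan0 mulr0.
  rewrite -[X in _ --> X]v0; apply: cvg_at_right_filter; apply: cvgMr.
  apply: (@continuous_comp _ _ _ Num.sqrt atan); first exact: sqrt_continuous.
  exact: continuous_atan.
- rewrite [X in _ --> X](_ : pi = 2 * (pi / 2)); last by field.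
  apply: cvgMr; apply: (@cvg_comp _ _ _ Num.sqrt atan _ +oo); last exact: cvgy_atan.
  apply/cvgryPge => A; near=> x.
  have x1 : `|A| ^+ 2 <= x by near: x; apply: nbhs_pinfty_ge; exact: num_real.
  apply: (le_trans (ler_norm _)); rewrite -sqrtr_sqr.
  by rewrite ler_sqrt ?(le_trans _ x1)// -?(real_normK (num_real A))// exprn_ge0.
Unshelve. all: by end_near. Qed.

(** Cauchy-Schwarz in additive form, balanced by [m]. In the constant, [pi] is the integral of
    [weight], and [3 = 2 + 1] collects the two squared norms divided by [m]. *)
Lemma weighted_bound F m : 0 < m -> (forall z, 0 < z -> {for z, continuous F}) ->
  intble `]0, +oo[ (fun z => F z ^+ 2) ->
  intble `]0, +oo[ (fun z => (z * F z) ^+ 2) ->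
  \int[mu]_(z in `]0, +oo[) (F z ^+ 2) <= m ^+ 2 ->
  \int[mu]_(z in `]0, +oo[) ((z * F z) ^+ 2) <= m ^+ 2 ->
  intble `]0, +oo[ (fun z => `|F z| / root4 z) /\
  \int[mu]_(z in `]0, +oo[) (`|F z| / root4 z) <= (pi + 3) * m.
Proof.
move=> m0 cF i0 i1 b0 b1.
pose B z := m * weight z + m^-1 * (2 * F z ^+ 2 + (z * F z) ^+ 2).
have iB1 : intble `]0, +oo[ (fun z => m * weight z) by exact: intbleZ intble_weight.
have iB2 : intble `]0, +oo[ (fun z => 2 * F z ^+ 2) by exact: intbleZ.
have iB3 : intble `]0, +oo[ (fun z => 2 * F z ^+ 2 + (z * F z) ^+ 2) by exact: intbleD.
have iB4 : intble `]0, +oo[ (fun z => m^-1 * (2 * F z ^+ 2 + (z * F z) ^+ 2)) by exact: intbleZ.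
have iB : intble `]0, +oo[ B by exact: intbleD.
have mF : measurable_fun (`]0, +oo[%classic : set T) (fun z => `|F z| / root4 z).
  apply: meas_half_cont => z z0; apply: cvgM.
    by apply: continuous_comp; [exact: cF|exact: norm_continuous].
  by apply: cvgV; [rewrite gt_eqF// root4_gt0|exact: cont_root4].
(* AM-GM: [2 f / q <= m / (q^2 (1 + z)) + (1 + z) f^2 / m], and [1 + z <= 2 + z^2]. *)
have le z : 0 < z -> `|F z| / root4 z <= B z.
  move=> z0; have q0 := root4_gt0 z0; rewrite /B /weight.
  have z10 : 0 < 1 + z by rewrite addr_gt0.
  set q := root4 z in q0 *; rewrite exprMn -(real_normK (num_real (F z))).
  set f : R := `|F z|; have f0 : 0 <= f by rewrite /f.
  have h1 : 2 * f / q <= m / (q ^+ 2 * (1 + z)) + m^-1 * ((1 + z) * f ^+ 2).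
    have -> : m / (q ^+ 2 * (1 + z)) + m^-1 * ((1 + z) * f ^+ 2) =
        2 * f / q + (m / (q * (1 + z)) - f) ^+ 2 * ((1 + z) / m).
      by field; rewrite !gt_eqF.
    by rewrite lerDl mulr_ge0 ?sqr_ge0// divr_ge0 ?ltW.
  have h2 : m^-1 * ((1 + z) * f ^+ 2) <= m^-1 * (2 * f ^+ 2 + z ^+ 2 * f ^+ 2).
    rewrite ler_wpM2l ?invr_ge0 ?(ltW m0)// -mulrDl ler_wpM2r ?sqr_ge0//.
    by have := sqr_ge0 (z - 1); nra.
  have h3 : 0 <= f / q by rewrite divr_ge0// ltW.
  by move: h1 h2 h3; rewrite -mulrA; lra.
split.
  apply: (intble_le mP mF _ iB) => z; rewrite inP => z0.
  by rewrite ger0_norm ?le// divr_ge0// sqrtr_ge0.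
apply: (@le_trans _ _ (\int[mu]_(z in `]0, +oo[) B z)).
  apply: le_Rintegral => //.
    apply: (intble_le mP mF _ iB) => z; rewrite inP => z0.
    by rewrite ger0_norm ?le// divr_ge0// sqrtr_ge0.
  by move=> z; rewrite inP; exact: le.
rewrite /B RintegralD// RintegralZl//; last exact: intble_weight.
rewrite RintegralZl// RintegralD// RintegralZl// int_weight.
set A := \int[mu]_(x in _) F x ^+ 2; set A' := \int[mu]_(x in _) (x * F x) ^+ 2.
have : m^-1 * (2 * A + A') <= m^-1 * (3 * m ^+ 2).
  by rewrite ler_wpM2l ?invr_ge0 ?(ltW m0)//; move: b0 b1; rewrite -/A -/A'; lra.
have -> : m^-1 * (3 * m ^+ 2) = 3 * m by field; rewrite gt_eqF.
by lra.
Qed.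

(** Additive Cauchy-Schwarz again, with the weight [1 / (1 + z^2)] expressed through [poisson 1]:
    [|F| <= m / (2 (1 + z^2)) + (1 + z^2) F^2 / m]. *)
Lemma abs_int_bound F m : 0 < m -> intble `]0, +oo[ F ->
  intble `]0, +oo[ (fun z => F z ^+ 2) ->
  intble `]0, +oo[ (fun z => (z * F z) ^+ 2) ->
  \int[mu]_(z in `]0, +oo[) (F z ^+ 2) <= m ^+ 2 ->
  \int[mu]_(z in `]0, +oo[) ((z * F z) ^+ 2) <= m ^+ 2 ->
  \int[mu]_(z in `]0, +oo[) `|F z| <= (pi + 2) * m.
Proof.
move=> m0 iF i0 i1 b0 b1.
have p01 : 0 < 1 :> R by [].
have iP : intble `]0, +oo[ (fun z => poisson 1 (0 - z)).
  exact: intbleS (intble_poisson 0 p01).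
pose B z := 4^-1 * m * poisson 1 (0 - z) + m^-1 * (F z ^+ 2 + (z * F z) ^+ 2).
have iB1 : intble `]0, +oo[ (fun z => 4^-1 * m * poisson 1 (0 - z)) by exact: intbleZ.
have iB3 : intble `]0, +oo[ (fun z => F z ^+ 2 + (z * F z) ^+ 2) by exact: intbleD.
have iB4 : intble `]0, +oo[ (fun z => m^-1 * (F z ^+ 2 + (z * F z) ^+ 2)) by exact: intbleZ.
have iB : intble `]0, +oo[ B by exact: intbleD.
apply: (@le_trans _ _ (\int[mu]_(z in `]0, +oo[) B z)).
  apply: le_Rintegral => //; first exact: intble_norm.
  move=> z _; rewrite /B /poisson sub0r sqrrN expr1n mulr1.
  have z0 : 0 < 1 + z ^+ 2 by rewrite ltr_wpDr ?sqr_ge0.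
  rewrite -[F z ^+ 2]real_normK ?num_real// exprMn -(real_normK (num_real (F z))).
  set f := `|F z|.
  have -> : 4^-1 * m * (2 / (1 + z ^+ 2)) + m^-1 * (f ^+ 2 + z ^+ 2 * f ^+ 2) =
     f + ((m / (1 + z ^+ 2) / 2 - f) ^+ 2 + (m / (1 + z ^+ 2) / 2) ^+ 2) * ((1 + z ^+ 2) / m).
    by field; rewrite !gt_eqF.
  by rewrite lerDl mulr_ge0 ?addr_ge0 ?sqr_ge0// divr_ge0 ?ltW.
rewrite /B RintegralD//.
have -> : \int[mu]_(z in `]0, +oo[) (4^-1 * m * poisson 1 (0 - z)) =
  4^-1 * m * \int[mu]_(z in `]0, +oo[) poisson 1 (0 - z) by rewrite RintegralZl.
have -> : \int[mu]_(z in `]0, +oo[) (m^-1 * (F z ^+ 2 + (z * F z) ^+ 2)) =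
  m^-1 * (\int[mu]_(z in `]0, +oo[) (F z ^+ 2) + \int[mu]_(z in `]0, +oo[) ((z * F z) ^+ 2)).
  by rewrite RintegralZl// RintegralD.
set A := \int[mu]_(x in _) F x ^+ 2; set A' := \int[mu]_(x in _) (x * F x) ^+ 2.
have : m^-1 * (A + A') <= m^-1 * (2 * m ^+ 2).
  by rewrite ler_wpM2l ?invr_ge0 ?(ltW m0)//; move: b0 b1; rewrite -/A -/A'; lra.
have -> : m^-1 * (2 * m ^+ 2) = 2 * m by field; rewrite gt_eqF.
have : \int[mu]_(z in `]0, +oo[) poisson 1 (0 - z) <= 2 * pi.
  rewrite -(int_poisson 0 p01) -(setUv (`]0, +oo[%classic : set T)) Rintegral_setU//.
  - by rewrite lerDl; apply: Rintegral_ge0 => x _; exact: poisson_ge0.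
  - exact: measurableC.
  - by rewrite setUv; exact: intble_poisson.
  - exact/disj_setPCl.
set P := Rintegral _ _ _ => hP.
have : 4^-1 * m * P <= 4^-1 * m * (2 * pi) by rewrite ler_wpM2l// mulr_ge0// ltW.
have : 0 <= m * pi by rewrite mulr_ge0 ?pi_ge0// ltW.
by lra.
Qed.

(** The integrand is the derivative of [osc] times [z F / z^(1/4)]. Up to the factor [64 / r], the
    two pointwise bounds make the boundary term at most [M z^(1/4)] near 0 and [M z^(-1/4)] at
    infinity, so it vanishes at both ends. Differentiating [z F / z^(1/4)] leaves [K / z^(1/4)] and
    a quarter of [F / z^(1/4)], each with integral at most [(pi + 3) * m]. *)
Lemma osc_half_bound F K M m x r c : 0 < r -> 0 < m ->
  (forall z, 0 < z -> is_derive z 1 (fun z => z * F z) (K z)) ->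
  (forall z, 0 < z -> {for z, continuous K}) ->
  (forall z, 0 < z -> `|F z| * Num.sqrt z <= M) ->
  (forall z, 0 < z -> `|F z| * z <= M) ->
  intble `]0, +oo[ F ->
  intble `]0, +oo[ (fun z => F z ^+ 2) ->
  intble `]0, +oo[ (fun z => (z * F z) ^+ 2) ->
  intble `]0, +oo[ (fun z => K z ^+ 2) ->
  intble `]0, +oo[ (fun z => (z * K z) ^+ 2) ->
  \int[mu]_(z in `]0, +oo[) (F z ^+ 2) <= m ^+ 2 ->
  \int[mu]_(z in `]0, +oo[) ((z * F z) ^+ 2) <= m ^+ 2 ->
  \int[mu]_(z in `]0, +oo[) (K z ^+ 2) <= m ^+ 2 ->
  \int[mu]_(z in `]0, +oo[) ((z * K z) ^+ 2) <= m ^+ 2 ->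
  `|\int[mu]_(z in `]0, +oo[) (cos (phase x (r ^+ 2) c z) * F z)| <=
    128 * (pi + 3) * m / r.
Proof.
move=> r0 m0 dF cK Fs Fz iF iF0 iF1 iK0 iK1 F0 F1 K0 K1.
have cF z : 0 < z -> {for z, continuous F}.
  move=> z0; have E y : 0 < y -> y * F y * y^-1 = F y.
    by move=> y0; rewrite mulrAC divff ?mul1r// gt_eqF.
  have cz : (y * F y) * y^-1 @[y --> z] --> (z * F z) * z^-1.
    apply: cvgM; first exact: der_cont (dF z z0).
    by apply: cvgV; [rewrite gt_eqF|exact: cvg_id].
  have : F y @[y --> z] --> F z; last by [].
  rewrite -[X in _ --> X](E z z0); apply: cvg_trans cz; apply: near_eq_cvg.
  by near=> y; rewrite E//; near: y; exact: lt_nbhsr.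
have [iwF bF] := weighted_bound m0 cF iF0 iF1 F0 F1.
have [iwK bK] := weighted_bound m0 cK iK0 iK1 K0 K1.
pose E z := osc x (r ^+ 2) c z.
pose W z := K z / root4 z - 4^-1 * (F z / root4 z).
have dW z : 0 < z -> is_derive z 1 (fun z => (z * F z) * (root4 z)^-1) (W z).
  move=> z0; have q0 := root4_gt0 z0.
  apply: (@der_eq _ _ _ _ _ (derM (dF z z0) (derinv (lt0r_neq0 q0) (der_root4 z0)))).
  rewrite /W (_ : z * F z = root4 z ^+ 4 * F z); last by rewrite root4_4// ltW.
  by field; exact: lt0r_neq0.
have dH z : 0 < z -> is_derive z 1 (fun z => E z * ((z * F z) * (root4 z)^-1))
    (cos (phase x (r ^+ 2) c z) * F z + E z * W z).
  move=> z0; have q0 := root4_gt0 z0.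
  apply: (@der_eq _ _ _ _ _ (derM (der_osc x r c z0) (dW z z0))).
  congr (_ + _); rewrite (_ : z * F z = root4 z ^+ 4 * F z); last by rewrite root4_4// ltW.
  by field; exact: lt0r_neq0.
have cphase z : 0 < z -> {for z, continuous (fun z => cos (phase x (r ^+ 2) c z))}.
  move=> z0; apply: continuous_comp; last exact: continuous_cos.
  apply: cvgD; last exact: cvg_cst.
  apply: cvgD; first by apply: cvgMr; exact: cvg_id.
  by apply: cvgMr; exact: sqrt_continuous.
have cW z : 0 < z -> {for z, continuous W}.
  move=> z0; have q0 := root4_gt0 z0.
  have cV : {for z, continuous (fun z => (root4 z)^-1)}.
    by apply: cvgV; [rewrite gt_eqF|exact: cont_root4].
  apply: cvgB; first by apply: cvgM; [exact: cK|exact: cV].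
  by apply: cvgMr; apply: cvgM; [exact: cF|exact: cV].
have cE z : 0 < z -> {for z, continuous E} by move=> z0; exact: der_cont (der_osc x r c z0).
have i1 : intble `]0, +oo[ (fun z => cos (phase x (r ^+ 2) c z) * F z).
  apply: (@intble_bddM _ _ _ _ 1) => //; first exact: meas_half_cont.
  by move=> z _; rewrite ler_norml cos_geN1 cos_le1.
have WB z : 0 < z -> `|W z| <= `|K z| / root4 z + `|F z| / root4 z.
  move=> z0; rewrite /W; apply: (le_trans (ler_normB _ _)).
  have q0 := root4_gt0 z0.
  rewrite !normrM normfV (gtr0_norm q0) lerD2l ler_piMl ?mulr_ge0 ?invr_ge0 ?(ltW q0)//.
  by rewrite ger0_norm// invf_le1// ler1n.
have iWB : intble `]0, +oo[ (fun z => `|K z| / root4 z + `|F z| / root4 z) by exact: intbleD.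
have iW : intble `]0, +oo[ W.
  apply: (intble_le mP _ _ iWB); first exact: meas_half_cont.
  by move=> z; rewrite inP; exact: WB.
have r64 : 0 <= 64 / r by rewrite divr_ge0// ltW.
have iEWB : intble `]0, +oo[ (fun z => 64 / r * (`|K z| / root4 z + `|F z| / root4 z)) by exact: intbleZ.
have mEW : measurable_fun (`]0, +oo[%classic : set T) (fun z => E z * W z).
  by apply: meas_half_cont => z z0; apply: cvgM; [exact: cE|exact: cW].
have EWB z : 0 < z -> `|E z * W z| <= 64 / r * (`|K z| / root4 z + `|F z| / root4 z).
  by move=> z0; rewrite normrM ler_pM// ?WB// osc_bound.
have iEW : intble `]0, +oo[ (fun z => E z * W z).
  by apply: (intble_le mP mEW _ iEWB) => z; rewrite inP; exact: EWB.
have M0 : 0 <= M by rewrite (le_trans _ (Fz 1 ltr01))// mulr1.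
have nzF z : 0 < z -> `|z * F z * (root4 z)^-1| = `|F z| * z / root4 z.
  move=> z0; have q0 := root4_gt0 z0.
  by rewrite normrM normrM normfV (gtr0_norm q0) (gtr0_norm z0) (mulrC z).
have Hb1 z : 0 < z -> `|E z * ((z * F z) * (root4 z)^-1)| <= 64 / r * M * root4 z.
  move=> z0; have q0 := root4_gt0 z0.
  rewrite normrM nzF// -[leRHS]mulrA; apply: ler_pM => //.
  - by rewrite mulr_ge0 ?invr_ge0 ?(ltW q0)// mulr_ge0// ltW.
  - exact: osc_bound.
  have zz : z = Num.sqrt z * Num.sqrt z by rewrite -expr2 sqr_sqrtr// ltW.
  rewrite ler_pdivrMr// -mulrA -expr2 root4_2 [X in _ * X <= _]zz mulrA.
  by rewrite ler_wpM2r ?sqrtr_ge0//; exact: Fs.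
have Hb2 z : 0 < z -> `|E z * ((z * F z) * (root4 z)^-1)| <= 64 / r * M * (root4 z)^-1.
  move=> z0; have q0 := root4_gt0 z0.
  rewrite normrM nzF// -[leRHS]mulrA; apply: ler_pM => //.
  - by rewrite mulr_ge0 ?invr_ge0 ?(ltW q0)// mulr_ge0// ltW.
  - exact: osc_bound.
  by rewrite ler_wpM2r ?invr_ge0 ?(ltW q0)//; exact: Fz.
have H : \int[mu]_(z in `]0, +oo[) (cos (phase x (r ^+ 2) c z) * F z + E z * W z) = 0 - 0.
  apply: (@int_der_half _ (fun z => E z * ((z * F z) * (root4 z)^-1))) => //.
  - move=> z z0; apply: cvgD; first by apply: cvgM; [exact: cphase|exact: cF].
    by apply: cvgM; [exact: cE|exact: cW].
  - exact: intbleD.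
  - apply: norm_cvg0; apply: (@squeeze_cvgr _ _ _ _ (cst 0) (fun z => 64 / r * M * root4 z)).
    + near=> z; rewrite normr_ge0/= Hb1//; near: z; exact: nbhs_right_gt.
    + exact: cvg_cst.
    + have cr : root4 z @[z --> (0 : R)] --> (0 : R).
        by rewrite -[X in _ --> X]root40; exact: cont_root4.
      apply: cvg_at_right_filter; rewrite -[X in _ --> X](mulr0 (64 / r * M)).
      exact: cvgMr cr.
  - apply: norm_cvg0; apply: (@squeeze_cvgr _ _ _ _ (cst 0) (fun z => 64 / r * M * (root4 z)^-1)).
    + near=> z; rewrite normr_ge0/= Hb2//; near: z; apply: nbhs_pinfty_gt; exact: num_real.
    + exact: cvg_cst.
    + rewrite -[X in _ --> X](mulr0 (64 / r * M)); apply: cvgMr.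
      apply/gtr0_cvgV0; last exact: cvgy_root4.
      near=> z; apply: root4_gt0; near: z; apply: nbhs_pinfty_gt; exact: num_real.
move: H; rewrite subrr RintegralD// => /eqP; rewrite addr_eq0 => /eqP ->.
rewrite normrN; apply: (le_trans (norm_int_le mP mEW iEWB _)).
  by move=> z; rewrite inP; exact: EWB.
rewrite RintegralZl// RintegralD//.
rewrite (_ : 128 * (pi + 3) * m / r = 64 / r * ((pi + 3) * m + (pi + 3) * m)); last by ring.
by rewrite ler_wpM2l// lerD.
Unshelve. all: by end_near. Qed.

End half_line_oscillation.

(** * Dispersive estimate for tame symbols *)

Section tame_symbols.
Context {R : realType}.
Notation mu := (@lebesgue_measure R).
Notation T := (measurableTypeR R).
Implicit Types (F K G f g h : R -> R) (a b c r s t x y z M m : R).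

Lemma ge0_integral_opp f : measurable_fun (setT : set T) f -> (forall x, 0 <= f x) ->
  (\int[mu]_x (f (- x))%:E = \int[mu]_x (f x)%:E)%E.
Proof.
move=> mf f0; rewrite [RHS]integral_pushforward_opp.
rewrite (ge0_integral_pushforward (@opp_meas R))//.
  by apply/measurable_EFinP.
by move=> x _; rewrite lee_fin.
Qed.

(** The origin, where the symbols in use may be discontinuous, is a null set and can be removed
    before the one-sided Plancherel bound is applied. *)
Lemma hartley_L2 G m : intble setT G -> (forall z, z != 0 -> {for z, continuous G}) ->
  (\int[mu]_x (hartley G x ^+ 2)%:E <= m%:E)%E ->
  intble setT (fun z => G z ^+ 2) /\ \int[mu]_z (G z ^+ 2) <= m.
Proof.
move=> iG cG Hm; have mG := intble_meas iG; apply: sqr_intble => //.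
have m1 : measurable (~` [set (0 : T)]) by apply: measurableC; exact: measurable_set1.
have -> : (\int[mu]_x (G x ^+ 2)%:E = \int[mu]_(x in ~` [set (0%R : T)]) (G x ^+ 2)%:E)%E.
  rewrite -setTD integral_setD1//; first by rewrite setTD.
  by apply/measurable_EFinP; apply: measurable_funTS; exact: measurable_funX.
apply: hartley_L2_lower => // z /= z0; apply: cG; exact/eqP.
Qed.

(** A common frame for [hartley f] and [|z|^(-1/2) hartley f], whence the pointwise conditions away
    from the origin. [tame_sqrt] kills boundary terms at 0; at infinity [tame_lin] does so in the
    oscillatory estimate and [tame_quad] in the scaling identity. Integrability of [z G] and [z K]
    makes the transforms of [G] and [K] differentiable. *)
Record tame G K M : Prop := Tame {
  tame_der : forall z, z != 0 -> is_derive z 1 (fun z => z * G z) (K z) ;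
  tame_cont : forall z, z != 0 -> {for z, continuous K} ;
  tame_sqrt : forall z, z != 0 -> `|G z| * Num.sqrt `|z| <= M ;
  tame_lin : forall z, z != 0 -> `|G z| * `|z| <= M ;
  tame_quad : forall z, z != 0 -> `|G z| * `|z| ^+ 2 <= M ;
  tame_intG : intble setT G ;
  tame_intzG : intble setT (fun z => z * G z) ;
  tame_intK : intble setT K ;
  tame_intzK : intble setT (fun z => z * K z)
}.

Lemma tame_contG G K M z : tame G K M -> z != 0 -> {for z, continuous G}.
Proof.
move=> tG z0.
have cz : (y * G y) * y^-1 @[y --> z] --> (z * G z) * z^-1.
  apply: cvgM; first exact: der_cont (tame_der tG z0).
  by apply: cvgV => //; exact: cvg_id.
have : G y @[y --> z] --> G z; last by [].
have E y : y != 0 -> y * G y * y^-1 = G y by move=> y0; rewrite mulrAC divff ?mul1r.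
have nz : \forall y \near z, y != 0.
  apply/nbhs_ballP; exists `|z| => /=; first by rewrite normr_gt0.
  by move=> y; rewrite /ball/=; apply: contraTneq => ->; rewrite subr0 ltxx.
rewrite -[X in _ --> X](E z z0); apply: cvg_trans cz; apply: near_eq_cvg.
by apply: filterS nz => y y0; rewrite E.
Qed.

Lemma tame_opp G K M : tame G K M -> tame (fun z => G (- z)) (fun z => K (- z)) M.
Proof.
case=> d c s l q iG izG iK izK; split => [z z0|z z0|z z0|z z0|z z0||||].
- have := der_opp (d (- z) _); rewrite oppr_eq0 => /(_ z0) /derN; rewrite opprK.
  by under eq_fun do rewrite mulNr opprK.
- by apply: cont_opp; apply: c; rewrite oppr_eq0.
- by rewrite -(normrN z) s// oppr_eq0.
- by rewrite -(normrN z) l// oppr_eq0.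
- by rewrite -(normrN z) q// oppr_eq0.
- exact: intble_opp iG.
- apply: eq_intble (intbleN measurableT (intble_opp izG)) => // x _.
  by rewrite mulNr opprK.
- exact: intble_opp iK.
- apply: eq_intble (intbleN measurableT (intble_opp izK)) => // x _.
  by rewrite mulNr opprK.
Qed.

(* Integration by parts in frequency: [x d/dx] becomes [- d/dxi xi]. *)
Lemma tame_scaling G K M x : tame G K M ->
  x * hartley (fun z => z * G z) (- x) = - hartley K x.
Proof.
move=> tG; have M0 : 0 <= M.
  by apply: le_trans (tame_lin tG (oner_neq0 _)); rewrite mulr_ge0.
have cz z : is_derive z 1 (fun z => cas (z * x)) (cas (- (z * x)) * x).
  apply: (@dercomp _ cas (fun z => z * x)); first exact: der_cas.
  by derive; ring.
have i1 : intble setT (fun z => x * (cas (z * - x) * (z * G z))).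
  by apply: intbleZ => //; exact: intble_cas (tame_intzG tG).
have i2 : intble setT (fun z => cas (z * x) * K z) by exact: intble_cas (tame_intK tG).
have bnd z : `|cas (z * x) * (z * G z)| <= 2 * M * Num.sqrt `|z|.
  have [->|z0] := eqVneq z 0; first by rewrite !mul0r mulr0 normr0 mulr_ge0 ?sqrtr_ge0// mulr_ge0.
  rewrite normrM -mulrA ler_pM ?norm_cas_le2// normrM -{1}(sqr_sqrtr (normr_ge0 z)).
  by rewrite expr2 -mulrA mulrC ler_wpM2r ?sqrtr_ge0// mulrC (tame_sqrt tG).
have bnd2 z : z != 0 -> `|cas (z * x) * (z * G z)| <= 2 * M * `|z|^-1.
  move=> z0; rewrite normrM -mulrA ler_pM ?norm_cas_le2// normrM.
  rewrite ler_pdivlMr ?normr_gt0// mulrAC mulrC -expr2.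
  exact: (tame_quad tG).
have cv0 : cas (z * x) * (z * G z) @[z --> +oo] --> 0.
  apply: norm_cvg0; apply: (@squeeze_cvgr _ _ _ _ (cst 0) (fun z => 2 * M * z^-1)).
  - near=> z; have z0 : 0 < z by near: z; apply: nbhs_pinfty_gt; exact: num_real.
    by rewrite normr_ge0/=; have := bnd2 z (lt0r_neq0 z0); rewrite (gtr0_norm z0).
  - exact: cvg_cst.
  - rewrite -[X in _ --> X](mulr0 (2 * M)); apply: cvgMr.
    apply/gtr0_cvgV0; last exact: cvg_id.
    by near=> z; near: z; apply: nbhs_pinfty_gt; exact: num_real.
have cv1 : cas (- z * x) * (- z * G (- z)) @[z --> +oo] --> 0.
  apply: norm_cvg0; apply: (@squeeze_cvgr _ _ _ _ (cst 0) (fun z => 2 * M * z^-1)).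
  - near=> z; have z0 : 0 < z by near: z; apply: nbhs_pinfty_gt; exact: num_real.
    have nz0 : - z != 0 by rewrite oppr_eq0 gt_eqF.
    by rewrite normr_ge0/=; have := bnd2 (- z) nz0; rewrite [`|- z|]normrN (gtr0_norm z0).
  - exact: cvg_cst.
  - rewrite -[X in _ --> X](mulr0 (2 * M)); apply: cvgMr.
    apply/gtr0_cvgV0; last exact: cvg_id.
    by near=> z; near: z; apply: nbhs_pinfty_gt; exact: num_real.
have H : \int[mu]_z (x * (cas (z * - x) * (z * G z)) + cas (z * x) * K z) = 0 - 0.
  apply: (@int_der_line _ (fun z => cas (z * x) * (z * G z)) _ 0 0); [..|exact: cv0|exact: cv1].
  - move=> z z0; apply: (@der_eq _ _ _ _ _ (derM (cz z) (tame_der tG z0))).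
    by rewrite mulrN; ring.
  - move=> z z0; apply: cvgD.
      apply: cvgMr; apply: cvgM; first exact: cont_casl.
      exact: der_cont (tame_der tG z0).
    by apply: cvgM; [exact: cont_casl|exact: tame_cont tG _ z0].
  - exact: intbleD.
  - rewrite /prop_for /continuous_at !mul0r mulr0.
    apply: norm_cvg0; apply: (@squeeze_cvgr _ _ _ _ (cst 0) (fun z => 2 * M * Num.sqrt `|z|)).
    + by apply: nearW => z; rewrite normr_ge0 bnd.
    + exact: cvg_cst.
    + rewrite -[X in _ --> X](mulr0 (2 * M)); apply: cvgMr.
      have c0 : {for (0 : R), continuous (fun z : R => Num.sqrt `|z|)}.
        by apply: continuous_comp; [exact: norm_continuous|exact: sqrt_continuous].
      by have := c0; rewrite /prop_for /continuous_at normr0 sqrtr0.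
move: H; rewrite RintegralD// RintegralZl ?subrr//; last exact: intble_cas (tame_intzG tG).
by move/eqP; rewrite addr_eq0 => /eqP ->.
Unshelve. all: by end_near. Qed.

Lemma half_line_le f m : intble setT f -> (forall z, 0 <= f z) ->
  \int[mu]_z f z <= m ->
  intble `]0, +oo[ f /\ \int[mu]_(z in `]0, +oo[) f z <= m.
Proof.
move=> fi f0; have m0 := @meas_itv R `]0, +oo[.
split; first exact: intbleS fi.
apply: le_trans H.
rewrite -[leRHS](_ : \int[mu]_(z in `]0, +oo[ `|` ~` `]0, +oo[) f z = _); last by rewrite setUv.
rewrite Rintegral_setU//.
- by rewrite lerDl; apply: Rintegral_ge0.
- exact: measurableC.
- by rewrite setUv.
- exact/disj_setPCl.
Qed.

(** Four cosine integrals occur on the half-line with coefficient [1 / 2], each at most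
    [128 * (pi + 3) * m / r]. *)
Definition osc_const : R := 256 * (pi + 3).

(** Since [cas u = cos u + cos (u - pi / 2)] and a product of cosines is a half sum, what remains
    are single cosines with a shifted phase, the form to which the oscillatory bound applies. *)
Lemma cas_cos x z (a : R) : cas (z * x) * cos a =
  2^-1 * (cos (z * x + a) + cos (a - z * x)) +
  2^-1 * (cos (z * x - pi / 2 + a) + cos (a - (z * x - pi / 2))).
Proof.
set u := z * x.
rewrite [cos (u - pi / 2 + a)]cosD [cos (a - (u - pi / 2))]cosB.
rewrite [cos (u - pi / 2)]cosB [sin (u - pi / 2)]sinB cos_pihalf sin_pihalf.
by rewrite [cos (u + a)]cosD [cos (a - u)]cosB /cas; field.
Qed.

Lemma cas_phase_half F K M m x r c : 0 < r -> 0 < m -> tame F K M ->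
  \int[mu]_z (F z ^+ 2) <= m ^+ 2 -> intble setT (fun z => F z ^+ 2) ->
  \int[mu]_z ((z * F z) ^+ 2) <= m ^+ 2 -> intble setT (fun z => (z * F z) ^+ 2) ->
  \int[mu]_z (K z ^+ 2) <= m ^+ 2 -> intble setT (fun z => K z ^+ 2) ->
  \int[mu]_z ((z * K z) ^+ 2) <= m ^+ 2 -> intble setT (fun z => (z * K z) ^+ 2) ->
  `|\int[mu]_(z in `]0, +oo[) (cas (z * x) * cos (r ^+ 2 * Num.sqrt z + c) * F z)| <=
    osc_const * m / r /\
  `|\int[mu]_(z in `]0, +oo[) (cas (z * x) * cos (r ^+ 2 * Num.sqrt z + c) * F z)| <=
    osc_const * m.
Proof.
move=> r0 m0 tF b1 j1 b2 j2 b3 j3 b4 j4.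
have mP := @meas_itv R `]0, +oo[.
have [{}j1 {}b1] := half_line_le j1 (fun z => sqr_ge0 _) b1.
have [{}j2 {}b2] := half_line_le j2 (fun z => sqr_ge0 _) b2.
have [{}j3 {}b3] := half_line_le j3 (fun z => sqr_ge0 _) b3.
have [{}j4 {}b4] := half_line_le j4 (fun z => sqr_ge0 _) b4.
have iF : intble `]0, +oo[ F by exact: intbleS (tame_intG tF).
have nz z : 0 < z -> z != 0 by move=> z0; rewrite gt_eqF.
have osc x' c' : `|\int[mu]_(z in `]0, +oo[) (cos (phase x' (r ^+ 2) c' z) * F z)| <=
    128 * (pi + 3) * m / r.
  apply: (@osc_half_bound _ F K M) => //.
  - by move=> z /nz z0; exact: tame_der tF _ z0.
  - by move=> z /nz z0; exact: tame_cont tF _ z0.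
  - by move=> z z0; have := tame_sqrt tF (nz z z0); rewrite (gtr0_norm z0).
  - by move=> z z0; have := tame_lin tF (nz z z0); rewrite (gtr0_norm z0).
have ioscx x' c' : intble `]0, +oo[ (fun z => cos (phase x' (r ^+ 2) c' z) * F z).
  apply: (@intble_bddM _ _ _ _ 1) => //; last by move=> z _; rewrite ler_norml cos_geN1 cos_le1.
  apply: meas_half_cont => z z0; apply: continuous_comp; last exact: continuous_cos.
  apply: cvgD; last exact: cvg_cst.
  apply: cvgD; first by apply: cvgMr; exact: cvg_id.
  by apply: cvgMr; exact: sqrt_continuous.
have E : \int[mu]_(z in `]0, +oo[) (cas (z * x) * cos (r ^+ 2 * Num.sqrt z + c) * F z) =
  2^-1 * (\int[mu]_(z in `]0, +oo[) (cos (phase x (r ^+ 2) c z) * F z) +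
          \int[mu]_(z in `]0, +oo[) (cos (phase (- x) (r ^+ 2) c z) * F z)) +
  2^-1 * (\int[mu]_(z in `]0, +oo[) (cos (phase x (r ^+ 2) (c - pi / 2) z) * F z) +
          \int[mu]_(z in `]0, +oo[) (cos (phase (- x) (r ^+ 2) (c + pi / 2) z) * F z)).
  pose f x' c' z := cos (phase x' (r ^+ 2) c' z) * F z.
  have i2 x1 c1 x2 c2 : intble `]0, +oo[ (fun z => f x1 c1 z + f x2 c2 z).
    exact: (intbleD mP (ioscx _ _) (ioscx _ _)).
  have i3 x1 c1 x2 c2 : intble `]0, +oo[ (fun z => 2^-1 * (f x1 c1 z + f x2 c2 z)).
    exact: (intbleZ _ mP (i2 _ _ _ _)).
  have e2 x1 c1 x2 c2 : \int[mu]_(z in `]0, +oo[) (f x1 c1 z + f x2 c2 z) =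
    \int[mu]_(z in `]0, +oo[) f x1 c1 z + \int[mu]_(z in `]0, +oo[) f x2 c2 z.
    exact: (RintegralD mP (ioscx _ _) (ioscx _ _)).
  transitivity (\int[mu]_(z in `]0, +oo[) (2^-1 * (f x c z + f (- x) c z) +
      2^-1 * (f x (c - pi / 2) z + f (- x) (c + pi / 2) z))); last first.
    have e3 x1 c1 x2 c2 : \int[mu]_(z in `]0, +oo[) (2^-1 * (f x1 c1 z + f x2 c2 z)) =
      2^-1 * (\int[mu]_(z in `]0, +oo[) f x1 c1 z + \int[mu]_(z in `]0, +oo[) f x2 c2 z).
      by rewrite -e2; exact: (RintegralZl _ mP (i2 _ _ _ _)).
    by rewrite (RintegralD mP (i3 _ _ _ _) (i3 _ _ _ _)) !e3.
  apply: eq_int => z _; rewrite cas_cos /f /phase.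
  rewrite (_ : x * z + r ^+ 2 * Num.sqrt z + c = z * x + (r ^+ 2 * Num.sqrt z + c)); last by ring.
  rewrite (_ : - x * z + r ^+ 2 * Num.sqrt z + c = r ^+ 2 * Num.sqrt z + c - z * x); last by ring.
  rewrite (_ : x * z + r ^+ 2 * Num.sqrt z + (c - pi / 2) =
    z * x - pi / 2 + (r ^+ 2 * Num.sqrt z + c)); last by ring.
  rewrite (_ : - x * z + r ^+ 2 * Num.sqrt z + (c + pi / 2) =
    r ^+ 2 * Num.sqrt z + c - (z * x - pi / 2)); last by ring.
  by ring.
split.
  rewrite E /osc_const.
  move: (osc x c) (osc (- x) c) (osc x (c - pi / 2)) (osc (- x) (c + pi / 2)).
  set A1 := Rintegral _ _ _; set A2 := Rintegral _ _ _.
  set A3 := Rintegral _ _ _; set A4 := Rintegral _ _ _.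
  rewrite (_ : 256 * (pi + 3) * m / r = 2 * (128 * (pi + 3) * m / r)); last by ring.
  rewrite !ler_norml => /andP[? ?] /andP[? ?] /andP[? ?] /andP[? ?].
  by apply/andP; split; lra.
apply: (@le_trans _ _ (\int[mu]_(z in `]0, +oo[) (2 * `|F z|))).
  apply: norm_int_le => //.
  - apply: measurable_funM; last exact: intble_meas iF.
    apply: measurable_funM; first by apply: measurable_funTS; apply: cont_meas; exact: cont_casl.
    apply: meas_half_cont => z z0; apply: continuous_comp; last exact: continuous_cos.
    by apply: cvgD; [apply: cvgMr; exact: sqrt_continuous|exact: cvg_cst].
  - by apply: intbleZ => //; exact: intble_norm.
  - move=> z _; rewrite normrM ler_wpM2r// normrM -[2]mulr1 ler_pM ?norm_cas_le2//.
    by rewrite ler_norml cos_geN1 cos_le1.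
rewrite RintegralZl//; last exact: intble_norm.
have := abs_int_bound m0 iF j1 j2 b1 b2; rewrite /osc_const.
have : 0 <= pi * m by rewrite mulr_ge0 ?pi_ge0// ltW.
by lra.
Qed.

(** By the derivative rules the four functions in the hypotheses are, up to sign and reflection, the
    transforms of [G], [z G], [K] and [z K], whose norms the one-sided Plancherel bound then
    controls. Negative frequencies are positive ones of the reflected symbol, hence the factor 2. *)
Lemma tame_dispersion G K M m x r c : 0 < r -> 0 < m -> tame G K M ->
  (\int[mu]_y (hartley G y ^+ 2)%:E <= (m ^+ 2)%:E)%E ->
  (\int[mu]_y (derive1 (hartley G) y ^+ 2)%:E <= (m ^+ 2)%:E)%E ->
  (\int[mu]_y ((y * derive1 (hartley G) y) ^+ 2)%:E <= (m ^+ 2)%:E)%E ->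
  (\int[mu]_y (derive1 (fun y => y * derive1 (hartley G) y)%R y ^+ 2)%:E <= (m ^+ 2)%:E)%E ->
  `|\int[mu]_z (cas (z * x) * (cos (r ^+ 2 * Num.sqrt `|z| + c) * G z))| <=
     2 * osc_const * m / r /\
  `|\int[mu]_z (cas (z * x) * (cos (r ^+ 2 * Num.sqrt `|z| + c) * G z))| <=
     2 * osc_const * m.
Proof.
move=> r0 m0 tG n1 n2 n3 n4.
have dv y : derive1 (hartley G) y = hartley (fun z => z * G z) (- y).
  exact: (derP (der_hartley y (tame_intG tG) (tame_intzG tG))).2.
have xdv y : y * derive1 (hartley G) y = - hartley K y by rewrite dv (tame_scaling _ tG).
have dxdv y : derive1 (fun y => y * derive1 (hartley G) y) y = - hartley (fun z => z * K z) (- y).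
  under eq_fun do rewrite xdv.
  exact: (derP (derN (der_hartley y (tame_intK tG) (tame_intzK tG)))).2.
have cG z : z != 0 -> {for z, continuous G} := @tame_contG G K M z tG.
have [j1 b1] := hartley_L2 (tame_intG tG) cG n1.
have [j2 b2] : intble setT (fun z => (z * G z) ^+ 2) /\ \int[mu]_z ((z * G z) ^+ 2) <= m ^+ 2.
  apply: (@hartley_L2 (fun z => z * G z)); first exact: tame_intzG tG.
    by move=> z z0; exact: der_cont (tame_der tG z0).
  rewrite -ge0_integral_opp; last by move=> y; exact: sqr_ge0.
    by move: n2; under eq_integral do rewrite dv.
  by apply: measurable_funX; exact: meas_hartley (tame_intzG tG).
have [j3 b3] : intble setT (fun z => K z ^+ 2) /\ \int[mu]_z (K z ^+ 2) <= m ^+ 2.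
  apply: (@hartley_L2 K); [exact: tame_intK tG|exact: tame_cont tG|].
  by move: n3; under eq_integral do rewrite xdv sqrrN.
have [j4 b4] : intble setT (fun z => (z * K z) ^+ 2) /\ \int[mu]_z ((z * K z) ^+ 2) <= m ^+ 2.
  apply: (@hartley_L2 (fun z => z * K z)); first exact: tame_intzK tG.
    by move=> z z0; apply: cvgM; [exact: cvg_id|exact: tame_cont tG _ z0].
  rewrite -ge0_integral_opp; last by move=> y; exact: sqr_ge0.
    by move: n4; under eq_integral do rewrite dxdv sqrrN.
  by apply: measurable_funX; exact: meas_hartley (tame_intzK tG).
have mcos : measurable_fun (setT : set T) (fun z : R => cos (r ^+ 2 * Num.sqrt `|z| + c)).
  apply: cont_meas => z; apply: continuous_comp; last exact: continuous_cos.
  apply: cvgD; last exact: cvg_cst.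
  apply: cvgMr; apply: continuous_comp; [exact: norm_continuous|exact: sqrt_continuous].
have ii : intble setT (fun z => cas (z * x) * (cos (r ^+ 2 * Num.sqrt `|z| + c) * G z)).
  apply: intble_cas; apply: (@intble_bddM _ _ _ _ 1) => //; last exact: tame_intG tG.
  by move=> z _; rewrite ler_norml cos_geN1 cos_le1.
have mP := @meas_itv R `]0, +oo[.
rewrite int_split_half// RintegralD//; [|exact: intbleS ii|exact: intbleS (intble_opp ii)].
have -> : \int[mu]_(z in `]0, +oo[) (cas (z * x) * (cos (r ^+ 2 * Num.sqrt `|z| + c) * G z)) =
  \int[mu]_(z in `]0, +oo[) (cas (z * x) * cos (r ^+ 2 * Num.sqrt z + c) * G z).
  by apply: eq_int => z /=; rewrite in_itv/= andbT => z0; rewrite (gtr0_norm z0) mulrA.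
have -> : \int[mu]_(z in `]0, +oo[) (cas (- z * x) * (cos (r ^+ 2 * Num.sqrt `|- z| + c) * G (- z))) =
  \int[mu]_(z in `]0, +oo[) (cas (z * - x) * cos (r ^+ 2 * Num.sqrt z + c) * G (- z)).
  by apply: eq_int => z /=; rewrite in_itv/= andbT => z0; rewrite normrN (gtr0_norm z0) mulNr mulrN mulrA.
have [w1 w2] := cas_phase_half x c r0 m0 tG b1 j1 b2 j2 b3 j3 b4 j4.
have sq z (f : R -> R) : (z * f (- z)) ^+ 2 = (- z * f (- z)) ^+ 2 by rewrite mulNr sqrrN.
have [||||||||p1 p2] := cas_phase_half (- x) c r0 m0 (tame_opp tG).
- by rewrite (int_opp j1).
- exact: intble_opp j1.
- by under eq_Rintegral do rewrite sq; rewrite (int_opp j2).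
- by under eq_fun do rewrite sq; exact: intble_opp j2.
- by rewrite (int_opp j3).
- exact: intble_opp j3.
- by under eq_Rintegral do rewrite sq; rewrite (int_opp j4).
- by under eq_fun do rewrite sq; exact: intble_opp j4.
split; rewrite (le_trans (ler_normD _ _))//.
  by rewrite (_ : 2 * osc_const * m / r = osc_const * m / r + osc_const * m / r) ?lerD//; ring.
by rewrite (_ : 2 * osc_const * m = osc_const * m + osc_const * m) ?lerD//; ring.
Qed.

End tame_symbols.

(** * Schwartz data *)

Section schwartz_real.
Context {R : realType}.
Notation mu := (@lebesgue_measure R).
Notation T := (measurableTypeR R).
Implicit Types (f g h k w : R -> R) (a c x y z M N : R) (n : nat).

Definition rderive f : R -> R := derive1 f.

Definition rschwartz f : Prop :=
  (forall n x, derivable (iter n rderive f) x 1) /\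
  (forall a b : nat, exists M, forall x, `|x| ^+ a * `|iter b rderive f x| <= M).

Lemma rschwartz_is_derive f n x : rschwartz f ->
  is_derive x 1 (iter n rderive f) (iter n.+1 rderive f x).
Proof. by move=> [df _]; apply: derI => //; exact: df. Qed.

Lemma rschwartz_der f : rschwartz f -> rschwartz (rderive f).
Proof.
move=> [df bf]; split=> [n x|a b]; first by rewrite -iterSr; exact: df.
by rewrite -iterSr; exact: bf.
Qed.

Lemma rschwartz_cont f : rschwartz f -> continuous f.
Proof. by move=> sf x; exact: der_cont (rschwartz_is_derive 0 x sf). Qed.

Lemma rschwartz_intble f : rschwartz f -> intble setT f.
Proof.
move=> sf; have [_ bf] := sf.
have [M0 h0] := bf 0%N 0%N; have [M2 h2] := bf 2%N 0%N.
have p01 : 0 < 1 :> R by [].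
have iP := intbleZ ((M0 + M2) / 2) measurableT (intble_poisson 0 p01).
apply: (intble_le measurableT _ _ iP).
  by apply: cont_meas; exact: rschwartz_cont.
move=> x _; rewrite /poisson sub0r sqrrN expr1n mulr1.
have z0 : 0 < 1 + x ^+ 2 by rewrite ltr_wpDr ?sqr_ge0.
rewrite (_ : (M0 + M2) / 2 * (2 / (1 + x ^+ 2)) = (M0 + M2) / (1 + x ^+ 2)); last first.
  by field; rewrite gt_eqF.
rewrite ler_pdivlMr// mulrDr mulr1; have := h0 x; have := h2 x.
by rewrite /= real_normK ?num_real// expr0 mul1r; lra.
Qed.

Lemma iter_rderive_mulx f n : rschwartz f ->
  iter n rderive (fun x => x * f x) =
  (fun x => x * iter n rderive f x + n%:R * iter n.-1 rderive f x).
Proof.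
move=> sf; elim: n => [|n ih]; first by apply/funext => x; rewrite mul0r addr0.
rewrite iterS ih; apply/funext => x.
have d0 := rschwartz_is_derive n x sf.
have E : is_derive x 1 (fun x => n%:R * iter n.-1 rderive f x) (n%:R * iter n rderive f x).
  case: n {ih d0} => [|n]; last by apply: derZ; exact: rschwartz_is_derive.
  by rewrite mul0r; under eq_fun do rewrite mul0r; exact: dercst.
rewrite /rderive (derP (derD (derM (derid x) d0) E)).2 -[n.+1%:R]natr1 -/rderive.
by rewrite iterS; ring.
Qed.

Lemma rschwartz_mulx f : rschwartz f -> rschwartz (fun x => x * f x).
Proof.
move=> sf; split=> [n x|a b].
  rewrite iter_rderive_mulx//.
  have d1 := derM (derid x) (rschwartz_is_derive n x sf).
  have d2 := derZ n%:R (rschwartz_is_derive n.-1 x sf).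
  by have [] := derP (derD d1 d2).
have [M1 h1] := sf.2 a.+1 b; have [M2 h2] := sf.2 a b.-1.
exists (M1 + b%:R * M2) => x; rewrite iter_rderive_mulx//.
apply: (@le_trans _ _ (`|x| ^+ a * (`|x| * `|iter b rderive f x| + b%:R * `|iter b.-1 rderive f x|))).
  rewrite ler_wpM2l ?exprn_ge0// (le_trans (ler_normD _ _))// !normrM.
  by rewrite (ger0_norm (ler0n _ _)).
rewrite mulrDr mulrA -exprSr lerD//.
by rewrite mulrCA ler_wpM2l.
Qed.

Lemma rschwartz_vanish f : rschwartz f ->
  f x @[x --> +oo] --> 0 /\ f (- x) @[x --> +oo] --> 0.
Proof.
move=> sf; have [M h] := sf.2 1%N 0%N.
have M0 : 0 <= M by apply: le_trans (h 0); rewrite mulr_ge0.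
have cM : M * x^-1 @[x --> +oo] --> 0.
  rewrite -[X in _ --> X](mulr0 M); apply: cvgMr.
  apply/gtr0_cvgV0; last exact: cvg_id.
  by near=> z; near: z; apply: nbhs_pinfty_gt; exact: num_real.
split; apply: norm_cvg0; apply: (@squeeze_cvgr _ _ _ _ (cst 0) (fun z => M * z^-1)) => //; try exact: cvg_cst.
- near=> z; have z0 : 0 < z by near: z; apply: nbhs_pinfty_gt; exact: num_real.
  rewrite normr_ge0/= ler_pdivlMr// mulrC.
  by have := h z; rewrite /= expr1 (gtr0_norm z0).
- near=> z; have z0 : 0 < z by near: z; apply: nbhs_pinfty_gt; exact: num_real.
  rewrite normr_ge0/= ler_pdivlMr// mulrC.
  by have := h (- z); rewrite /= expr1 normrN (gtr0_norm z0).
Unshelve. all: by end_near. Qed.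

Lemma hartley_rderive f z : rschwartz f ->
  hartley (rderive f) z = - (z * hartley f (- z)).
Proof.
move=> sf; have sf' := rschwartz_der sf.
have i1 : intble setT (fun x => z * (cas (x * - z) * f x)).
  by apply: intbleZ => //; apply: intble_cas; exact: rschwartz_intble.
have i2 : intble setT (fun x => cas (x * z) * rderive f x).
  by apply: intble_cas; exact: rschwartz_intble.
have cz x : is_derive x 1 (fun x => cas (x * z)) (cas (- (x * z)) * z).
  apply: (@dercomp _ cas (fun x => x * z)); first exact: der_cas.
  by derive; ring.
have [v1 v2] := rschwartz_vanish sf.
have dh x : is_derive x 1 (fun x => cas (x * z) * f x)
    (z * (cas (x * - z) * f x) + cas (x * z) * rderive f x).
  apply: (@der_eq _ _ _ _ _ (derM (cz x) (rschwartz_is_derive 0 x sf))).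
  by rewrite mulrN /=; ring.
have vc h : (forall z, `|h z| <= 2) -> forall v : R -> R, v x @[x --> +oo] --> 0 ->
    h x * v x @[x --> +oo] --> 0.
  move=> h2 v v0; apply: norm_cvg0.
  apply: (@squeeze_cvgr _ _ _ _ (cst 0) (fun x => 2 * `|v x|)).
  - by apply: nearW => x; rewrite normr_ge0 normrM ler_wpM2r.
  - exact: cvg_cst.
  - rewrite -[X in _ --> X](mulr0 2); apply: cvgMr.
    by rewrite -[X in _ --> X](@normr0 _ R); exact: cvg_norm.
have : \int[mu]_x (z * (cas (x * - z) * f x) + cas (x * z) * rderive f x) = 0 - 0.
  apply: (@int_der_line _ (fun x => cas (x * z) * f x)).
  - move=> x _; apply: cvgD.
      apply: cvgMr; apply: cvgM; first exact: cont_casl.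
      exact: rschwartz_cont.
    by apply: cvgM; [exact: cont_casl|exact: rschwartz_cont].
  - exact: intbleD.
  - exact: der_cont (dh 0).
  - by apply: (vc (fun x => cas (x * z))) => // y; exact: norm_cas_le2.
  - by apply: (vc (fun x => cas (- x * z))) => // y; exact: norm_cas_le2.
rewrite RintegralD// RintegralZl//; last by apply: intble_cas; exact: rschwartz_intble.
by rewrite subrr addrC => /eqP; rewrite addr_eq0 => /eqP.
Qed.

Lemma hartley_decay f n : rschwartz f ->
  exists M, forall z, `|z| ^+ n * `|hartley f z| <= M.
Proof.
elim: n f => [|n ih] f sf.
  exists (2 * \int[mu]_x `|f x|) => z; rewrite expr0 mul1r.
  by apply: hartley_le; exact: rschwartz_intble.
have [M h] := ih _ (rschwartz_der sf).
exists M => z; have := h (- z).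
have -> : `|hartley (rderive f) (- z)| = `|z| * `|hartley f z|.
  by rewrite hartley_rderive// opprK mulNr opprK normrM.
by rewrite normrN mulrA -exprSr.
Qed.

(** Three powers are what [tame_product] spends: one [1 + |z|] on the singular weight times
    [|z|^(1/2)], two on the remaining growth [|z|^(3/2)] in [tame_quad]. *)
Lemma hartley_decay3 f : rschwartz f ->
  exists M, forall z, (1 + `|z|) ^+ 3 * `|hartley f z| <= M.
Proof.
move=> sf.
have [M0 h0] := hartley_decay 0 sf; have [M1 h1] := hartley_decay 1 sf.
have [M2 h2] := hartley_decay 2 sf; have [M3 h3] := hartley_decay 3 sf.
exists (M0 + 3 * M1 + 3 * M2 + M3) => z.
have := h0 z; have := h1 z; have := h2 z; have := h3 z.
rewrite expr0 expr1; set A := `|hartley f z|; set a := `|z|.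
by nra.
Qed.

(** The product [z * hartley f z] is the transform of [rderive f] at [- z], to which [der_hartley]
    applies; the two reflections cancel. *)
Lemma der_mul_hartley f z : rschwartz f ->
  is_derive z 1 (fun z => z * hartley f z) (- hartley (fun x => x * rderive f x) z).
Proof.
move=> sf; have sf' := rschwartz_der sf.
have E : (fun z => z * hartley f z) = (fun z => hartley (rderive f) (- z)).
  by apply/funext => y; rewrite hartley_rderive// opprK mulNr opprK.
rewrite E; have := der_hartley (- z) (rschwartz_intble sf') (rschwartz_intble (rschwartz_mulx sf')).
by rewrite opprK => /der_opp.
Qed.

(** Of the three powers of decay, one absorbs [w] times [|z|^(1/2)], one absorbs the multiplication
    by [1] or by [z], and the last leaves the integrable majorant [N * weight]. *)
Lemma intble_singular w h N :
  (forall z, z != 0 -> {for z, continuous (fun z => w z * h z)}) ->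
  (forall z, z != 0 -> `|w z| * Num.sqrt `|z| <= 1 + `|z|) ->
  (forall z, (1 + `|z|) ^+ 3 * `|h z| <= N) ->
  intble setT (fun z => w z * h z) /\ intble setT (fun z => z * (w z * h z)).
Proof.
move=> cwh wb hN.
have mP := @meas_itv R `]0, +oo[.
have iN := intbleZ N mP intble_weight.
have nz z : 0 < z -> z != 0 by move=> z0; rewrite gt_eqF.
have key (v : R -> R) : (forall z, `|v z| <= (1 + `|z|)) -> continuous v ->
    intble setT (fun z => v z * (w z * h z)).
  move=> vb cv.
  have bnd y z : 0 < z -> `|y| = z -> `|v y * (w y * h y)| <= N * weight z.
    move=> z0 yz; have y0 : y != 0 by rewrite -normr_gt0 yz.
    have s0 : 0 < Num.sqrt z by rewrite sqrtr_gt0.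
    have z1 : 0 < 1 + z by rewrite addr_gt0.
    have := wb _ y0; have := hN y; have := vb y; rewrite yz => v1 h1 w1.
    rewrite /weight root4_2 ler_pdivlMr ?mulr_gt0// !normrM.
    rewrite (_ : `|v y| * (`|w y| * `|h y|) * _ = (`|v y| * (`|w y| * Num.sqrt z)) * (`|h y| * (1 + z))); last by ring.
    apply: (@le_trans _ _ (((1 + z) * (1 + z)) * (`|h y| * (1 + z)))); last first.
      by apply: le_trans h1; rewrite le_eqVlt; apply/orP; left; apply/eqP; ring.
    by rewrite ler_wpM2r ?mulr_ge0 ?(ltW z1)// ler_pM.
  have cvwh z : z != 0 -> {for z, continuous (fun z => v z * (w z * h z))}.
    by move=> z0; apply: cvgM; [exact: cv|exact: cwh].
  apply: intble_halves; apply: (intble_le mP _ _ iN).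
  - by apply: meas_half_cont => z /nz; exact: cvwh.
  - by move=> z /=; rewrite in_itv/= andbT => z0; apply: bnd => //; rewrite gtr0_norm.
  - apply: meas_half_cont => z z0; apply: (@cont_opp _ (fun z => v z * (w z * h z))).
    by apply: cvwh; rewrite oppr_eq0 nz.
  - by move=> z /=; rewrite in_itv/= andbT => z0; apply: bnd => //; rewrite normrN gtr0_norm.
split; last by apply: (key id) => [z|z]; [rewrite lerDr|exact: cvg_id].
apply: eq_intble (key (fun=> 1) _ _) => //.
- by move=> x _; rewrite mul1r.
- by move=> z; rewrite normr1 lerDl.
- by move=> z; exact: cvg_cst.
Qed.

Lemma sqrt_le_1D a : 0 <= a -> Num.sqrt a <= 1 + a.
Proof.
by move=> a0; rewrite -{2}(sqr_sqrtr a0); have := sqr_ge0 (Num.sqrt a - 1); nra.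
Qed.

(** Euler's relation [z w' = - c w] says that [w] is homogeneous of degree [- c], so
    [(z w g)' = w (k - c g)] has the same form as [w g]. The instances are [c = 0] and
    [c = 1 / 2]. *)
Lemma tame_product g k w c N : 0 <= c -> c <= 1 ->
  (forall z, is_derive z 1 (fun z => z * g z) (k z)) ->
  continuous g -> continuous k ->
  (forall z, z != 0 -> is_derive z 1 w (- c * w z / z)) ->
  (forall z, z != 0 -> `|w z| * Num.sqrt `|z| <= 1 + `|z|) ->
  (forall z, (1 + `|z|) ^+ 3 * `|g z| <= N) ->
  (forall z, (1 + `|z|) ^+ 3 * `|k z| <= N) ->
  tame (fun z => w z * g z) (fun z => w z * (k z - c * g z)) N.
Proof.
move=> c0 c1 dg cg ck dw wb gN kN.
have kgN z : (1 + `|z|) ^+ 3 * `|k z - c * g z| <= N + N.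
  apply: (@le_trans _ _ ((1 + `|z|) ^+ 3 * (`|k z| + `|g z|))); last by rewrite mulrDr lerD.
  rewrite ler_wpM2l ?exprn_ge0 ?addr_ge0// (le_trans (ler_normB _ _))// lerD2l.
  by rewrite normrM (ger0_norm c0) ler_piMl.
have cw z : z != 0 -> {for z, continuous w} by move=> z0; exact: der_cont (dw z z0).
have cwg z : z != 0 -> {for z, continuous (fun z => w z * g z)}.
  by move=> z0; apply: cvgM; [exact: cw|exact: cg].
have cwk z : z != 0 -> {for z, continuous (fun z => w z * (k z - c * g z))}.
  move=> z0; apply: cvgM; first exact: cw.
  by apply: cvgB; [exact: ck|apply: cvgMr; exact: cg].
have [i1 i2] := intble_singular cwg wb gN.
have [i3 i4] := intble_singular cwk wb kgN.
have wg z (v : R) : z != 0 -> 0 <= v -> v <= (1 + `|z|) ^+ 2 ->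
    `|w z * g z| * (Num.sqrt `|z| * v) <= N.
  move=> z0 v0 v1; apply: le_trans (gN z); rewrite normrM.
  rewrite (_ : `|w z| * `|g z| * _ = (`|w z| * Num.sqrt `|z|) * v * `|g z|); last by ring.
  by rewrite ler_wpM2r// exprS; apply: ler_pM => //; exact: wb.
split => //.
- move=> z z0; have E : (fun z => z * (w z * g z)) = (fun z => w z * (z * g z)).
    by apply/funext => y; ring.
  rewrite E; apply: (@der_eq _ _ _ _ _ (derM (dw z z0) (dg z))).
  by field.
- move=> z z0; have := wg z 1 z0 ler01; rewrite mulr1; apply.
  by rewrite exprn_ege1// lerDl.
- move=> z z0; have := wg z (Num.sqrt `|z|) z0 (sqrtr_ge0 _).
  rewrite -expr2 sqr_sqrtr//; apply.
  rewrite (le_trans (sqrt_le_1D (normr_ge0 _)))// expr2 ler_peMr ?addr_ge0//.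
  by rewrite lerDl.
- move=> z z0; have := wg z (Num.sqrt `|z| * `|z|) z0.
  rewrite mulrA -expr2 sqr_sqrtr// -expr2; apply.
    by rewrite mulr_ge0// sqrtr_ge0.
  by rewrite expr2 ler_pM ?sqrtr_ge0 ?sqrt_le_1D// lerDr.
Qed.

Lemma der_abs_powN12 z : z != 0 ->
  is_derive z 1 (fun z => `|z| `^ (- (1 / 2))) (- (1 / 2) * `|z| `^ (- (1 / 2)) / z).
Proof.
have E y : `|y| `^ (- (1 / 2)) = (Num.sqrt `|y|)^-1.
  by rewrite powRN mul1r powR12_sqrt.
have pos y : 0 < y -> is_derive y 1 (fun z => `|z| `^ (- (1 / 2)))
    (- (1 / 2) * `|y| `^ (- (1 / 2)) / y).
  move=> y0; have s0 : 0 < Num.sqrt y by rewrite sqrtr_gt0.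
  apply: (@der_near _ (fun z => (Num.sqrt z)^-1)).
    near=> x; have x0 : 0 < x by near: x; exact: lt_nbhsr.
    by rewrite E (gtr0_norm x0).
  apply: (@der_eq _ _ _ _ _ (derinv (lt0r_neq0 s0) (is_derive1_sqrt y0))).
  rewrite E (gtr0_norm y0) (_ : (_ / y) = - (1 / 2) / Num.sqrt y / Num.sqrt y ^+ 2).
    by field; rewrite gt_eqF.
  by rewrite sqr_sqrtr// ltW.
move=> z0; have [y0|y0|y0] := ltgtP z 0; [|exact: pos|by rewrite y0 eqxx in z0].
have ny : 0 < - z by rewrite oppr_gt0.
have := der_opp (pos _ ny).
under eq_fun do rewrite normrN.
by move=> d; apply: (@der_eq _ _ _ _ _ d); rewrite normrN invrN mulrN opprK.
Unshelve. all: by end_near. Qed.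

Lemma tame_schwartz f : rschwartz f -> exists K M, tame (hartley f) K M.
Proof.
move=> sf; have sf' := rschwartz_mulx (rschwartz_der sf).
have [M1 h1] := hartley_decay3 sf; have [M2 h2] := hartley_decay3 sf'.
pose N := Num.max M1 M2.
pose k z := - hartley (fun x => x * rderive f x) z.
have tG : tame (fun z => 1 * hartley f z) (fun z => 1 * (k z - 0 * hartley f z)) N.
  apply: (@tame_product (hartley f) k (fun=> 1) 0 N).
  - exact: lexx.
  - exact: ler01.
  - by move=> z; exact: der_mul_hartley.
  - by apply: cont_hartley; exact: rschwartz_intble.
  - by move=> z; apply: cvgN; apply: cont_hartley; exact: rschwartz_intble.
  - by move=> z _; rewrite oppr0 !mul0r; exact: dercst.
  - by move=> z _; rewrite normr1 mul1r sqrt_le_1D.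
  - by move=> z; rewrite le_max h1.
  - by move=> z; rewrite /k normrN le_max h2 orbT.
exists (fun z => 1 * (k z - 0 * hartley f z)), N.
have E : (fun z => 1 * hartley f z) = hartley f by apply/funext => z; rewrite mul1r.
by rewrite E in tG.
Qed.

Lemma tame_schwartz_half f : rschwartz f ->
  exists K M, tame (fun z => `|z| `^ (- (1 / 2)) * hartley f z) K M.
Proof.
move=> sf; have sf' := rschwartz_mulx (rschwartz_der sf).
have [M1 h1] := hartley_decay3 sf; have [M2 h2] := hartley_decay3 sf'.
pose k z := - hartley (fun x => x * rderive f x) z.
exists (fun z => `|z| `^ (- (1 / 2)) * (k z - 1 / 2 * hartley f z)), (Num.max M1 M2).
apply: (@tame_product (hartley f) k (fun z => `|z| `^ (- (1 / 2))) (1 / 2)).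
- by lra.
- by lra.
- by move=> z; exact: der_mul_hartley.
- by apply: cont_hartley; exact: rschwartz_intble.
- by move=> z; apply: cvgN; apply: cont_hartley; exact: rschwartz_intble.
- by move=> z; exact: der_abs_powN12.
- move=> z z0; rewrite powRN mul1r powR12_sqrt// normfV (ger0_norm (sqrtr_ge0 _)).
  by rewrite mulVf ?lerDl// gt_eqF// sqrtr_gt0 normr_gt0.
- by move=> z; rewrite le_max h1.
- by move=> z; rewrite /k normrN le_max h2 orbT.
Qed.

End schwartz_real.

(** * The evolution in time *)

Section evolution.
Context {R : realType}.
Notation mu := (@lebesgue_measure R).
Notation T := (measurableTypeR R).
Implicit Types (f g h : R -> R) (x y z t s : R).

(** Difference quotients with step [1 / (n + 1)] are measurable and converge pointwise. The time
    derivatives of a solution are given pointwise, without continuity in space, so their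
    measurability has to be obtained this way. *)
Lemma measurable_param_derive (v vt : R -> R -> R) t :
  (forall x, is_derive t 1 (fun s => v s x) (vt t x)) ->
  (forall s, measurable_fun (setT : set T) (v s)) ->
  measurable_fun (setT : set T) (vt t).
Proof.
move=> dv mv.
apply: (@measurable_fun_cvg _ _ _ _
  (fun (n : nat) (x : T) => n.+1%:R * (v (n.+1%:R^-1 + t) x - v t x))).
  by move=> n; apply: measurable_funM => //; apply: measurable_funB.
move=> x _; have [dx ex] := derP (dv x).
have := dx; rewrite /derivable; under eq_fun do rewrite scaler1.
move=> cv; have : h^-1 *: (v (h + t) x - v t x) @[h --> 0^'] --> vt t x.
  by rewrite -ex; exact: cv.
move=> /cvgr_dnbhsP /(_ (fun n => n.+1%:R^-1)) H.
rewrite [X in X @ _](_ : _ = (fun n : nat => n.+1%:R^-1^-1 *: (v (n.+1%:R^-1 + t) x - v t x))).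
  apply: H; split=> [n|]; last exact: cvg_harmonic.
  by rewrite invr_eq0 pnatr_eq0.
by apply/funext => n; rewrite invrK.
Qed.

Lemma is_derive_hartley_param (v vt : R -> R -> R) g t z :
  (forall s x, `|s - t| < 1 -> is_derive s 1 (fun s => v s x) (vt s x)) ->
  (forall s, measurable_fun (setT : set T) (v s)) ->
  intble setT g ->
  (forall s x, `|s - t| < 1 -> `|v s x| <= g x) ->
  (forall s x, `|s - t| < 1 -> `|vt s x| <= g x) ->
  is_derive t 1 (fun s => hartley (v s) z) (hartley (vt t) z).
Proof.
move=> dv mv ig vg vtg.
have mI s : (`]t - 1, t + 1[%classic : set R) s -> `|s - t| < 1.
  by rewrite /= in_itv/= ltr_norml => /andP[? ?]; apply/andP; split; lra.
pose F s x := cas (x * z) * v s x.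
have dF s x : `|s - t| < 1 -> is_derive s 1 (F ^~ x) (cas (x * z) * vt s x).
  by move=> st; apply: derZ; exact: dv.
have It : (`]t - 1, t + 1[%classic : set R) t by rewrite /= in_itv/=; apply/andP; split; lra.
have i1 s : (`]t - 1, t + 1[%classic : set R) s -> mu.-integrable setT (EFin \o F s).
  move=> /mI st; apply: intble_cas; apply: (intble_le measurableT (mv s) _ ig) => x _.
  exact: vg.
have i2 s x : (`]t - 1, t + 1[%classic : set R) s -> [set: T] x -> derivable (F ^~ x) s 1.
  by move=> /mI st _; have [] := derP (dF s x st).
have i3 : mu.-integrable setT (EFin \o (fun x : T => 2 * `|g x|)).
  by have := intbleZ 2 measurableT (intble_norm ig).
have i4 s x : (`]t - 1, t + 1[%classic : set R) s -> [set: T] x ->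
    `|partial1of2 F s x| <= 2 * `|g x|.
  move=> /mI st _; rewrite /partial1of2 (derP (dF s x st)).2 normrM.
  rewrite ler_pM ?norm_cas_le2//.
  by rewrite (le_trans (vtg _ _ st))// ler_norm.
have t1 : `|t - t| < 1 by rewrite subrr normr0.
apply: derI.
  exact: (derivable_under_integral measurableT It i1 i2 _ i3 i4).
rewrite (differentiation_under_integral measurableT It i1 i2 _ i3 i4)//.
by apply: eq_int => x _; rewrite /partial1of2 (derP (dF t x t1)).2.
Qed.

Lemma oscillator_unique (w w1 : R -> R) (a : R) : a != 0 ->
  (forall t, is_derive t 1 w (w1 t)) ->
  (forall t, is_derive t 1 w1 (- (a ^+ 2 * w t))) ->
  forall t, w t = cos (a * t) * w 0 + sin (a * t) * (w1 0 / a).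
Proof.
move=> a0 dw dw1 t.
(* [A] and [B] undo the rotation by the angle [a * s] in the plane of [(w, w1 / a)], so both are
   constant. *)
pose A s := w s * cos (a * s) - w1 s / a * sin (a * s).
pose B s := w s * sin (a * s) + w1 s / a * cos (a * s).
have dA s : is_derive s 1 A 0.
  rewrite /A; derive; [exact: dw|exact: dw1|].
  by field.
have dB s : is_derive s 1 B 0.
  rewrite /B; derive; [exact: dw|exact: dw1|].
  by field.
have cA : A t = A 0 by exact: is_derive_0_is_cst.
have cB : B t = B 0 by exact: is_derive_0_is_cst.
have eA : A 0 = w 0 by rewrite /A mulr0 cos0 sin0 mulr1 mulr0 subr0.
have eB : B 0 = w1 0 / a by rewrite /B mulr0 cos0 sin0 mulr1 mulr0 add0r.
rewrite -eB -eA -cA -cB /A /B.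
have := cos2Dsin2 (a * t); set C := cos _; set S := sin _ => E.
rewrite -[LHS]mulr1 -E; ring.
Qed.

Lemma int_eq_off0 f g : intble setT f -> intble setT g -> (forall z, z != 0 -> f z = g z) ->
  \int[mu]_z f z = \int[mu]_z g z.
Proof.
move=> fi gi fg; rewrite !int_split_half//; apply: eq_int => z /=.
by rewrite in_itv/= andbT => z0; rewrite !fg// ?oppr_eq0 gt_eqF.
Qed.

(** Boundedness takes care of [[- 1, 1]]; outside, [|f z|] is at most [|z| * |f z|]. *)
Lemma intble_of_mulabs f M : measurable_fun (setT : set T) f -> (forall z, `|f z| <= M) ->
  intble setT (fun z => `|z| * f z) -> intble setT f.
Proof.
move=> mf fM iz.
have i1 : intble setT ((fun=> M) \_ `[- 1, 1]).
  by apply: intble_restrictT; [exact: meas_itv|apply: intble_compact => x _; exact: cvg_cst].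
have iB := intbleD measurableT i1 (intble_norm iz).
apply: (intble_le measurableT mf _ iB) => z _.
rewrite patchE mem_setE in_itv/= -ler_norml normrM normr_id.
case: ifPn => [z1|]; first by rewrite (le_trans (fM z))// lerDl mulr_ge0.
by rewrite -ltNge => z1; rewrite add0r ler_peMl// ltW.
Qed.

(** What one component of a complex solution satisfies: [rsol_eq] is [utt = - |D| u] with both
    Fourier transforms replaced by Hartley transforms. *)
Record real_solution (u ut utt : R -> R -> R) : Prop := RealSolution {
  rsol_der : forall t x, is_derive t 1 (fun s => u s x) (ut t x) ;
  rsol_der2 : forall t x, is_derive t 1 (fun s => ut s x) (utt t x) ;
  rsol_cont : forall t, continuous (u t) ;
  rsol_dom : forall M, exists g, intble setT g /\
    forall t x, `|t| <= M -> [/\ `|u t x| <= g x, `|ut t x| <= g x & `|utt t x| <= g x] ;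
  rsol_mult : forall t, intble setT (fun z => `|z| * hartley (u t) z) ;
  rsol_eq : forall t x,
    utt t x = - ((2 * pi)^-1 * hartley (fun z => `|z| * hartley (u t) z) x)
}.

Section representation.
Variables u ut utt : R -> R -> R.
Hypothesis sol : real_solution u ut utt.

Let mu_ t : measurable_fun (setT : set T) (u t).
Proof. by apply: cont_meas; exact: rsol_cont sol t. Qed.

Let mut t : measurable_fun (setT : set T) (ut t).
Proof. by apply: measurable_param_derive mu_ => x; exact: rsol_der sol t x. Qed.

Let mutt t : measurable_fun (setT : set T) (utt t).
Proof. by apply: measurable_param_derive mut => x; exact: rsol_der2 sol t x. Qed.

Lemma rsol_int t : [/\ intble setT (u t), intble setT (ut t) & intble setT (utt t)].
Proof.
have [g [ig gb]] := rsol_dom sol `|t|.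
by split; apply: (intble_le measurableT _ _ ig) => // x _;
  have [] := gb t x (lexx _).
Qed.

Let iu t : intble setT (u t). Proof. by case: (rsol_int t). Qed.
Let iutt t : intble setT (utt t). Proof. by case: (rsol_int t). Qed.

Lemma rsol_hartley_int t : intble setT (hartley (u t)).
Proof.
apply: (@intble_of_mulabs _ (2 * \int[mu]_x `|u t x|)).
- exact: meas_hartley.
- by move=> z; exact: hartley_le.
- exact: rsol_mult sol t.
Qed.

Lemma rsol_inversion t x : u t x = (2 * pi)^-1 * hartley (hartley (u t)) x.
Proof.
rewrite hartley_inversion//; [|exact: rsol_hartley_int|exact: rsol_cont sol t x].
by rewrite mulKf// mulf_neq0// gt_eqF// pi_gt0.
Qed.

(** By the equation, the transform of [|z| * hartley (u t)] is [- 2 pi] times [utt], which is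
    integrable because it is dominated; inversion therefore applies and yields an oscillator
    equation at each frequency. *)
Lemma rsol_hartley_utt t z : hartley (utt t) z = - (`|z| * hartley (u t) z).
Proof.
have pi0 : 2 * pi != 0 :> R by rewrite mulf_neq0// gt_eqF// pi_gt0.
set W := fun z => `|z| * hartley (u t) z.
have iW : intble setT W := rsol_mult sol t.
have E : hartley W = (fun x => - (2 * pi) * utt t x).
  by apply/funext => x; rewrite (rsol_eq sol t x) mulrNN mulVKf.
have iHW : intble setT (hartley W) by rewrite E; apply: intbleZ.
have cW : {for z, continuous W}.
  by apply: cvgM; [exact: norm_continuous|apply: cont_hartley; exact: iu].
have := hartley_inversion iW iHW cW; rewrite E.
have -> : hartley (fun x => - (2 * pi) * utt t x) z = - (2 * pi) * hartley (utt t) z.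
  rewrite /hartley -RintegralZl//; last exact: intble_cas.
  by apply: eq_int => x _; ring.
by rewrite mulNr => /(congr1 -%R); rewrite opprK -mulrN => /(mulfI pi0).
Qed.

Lemma near_dom t : exists g, intble setT g /\ forall s x, `|s - t| < 1 ->
  [/\ `|u s x| <= g x, `|ut s x| <= g x & `|utt s x| <= g x].
Proof.
have [g [ig gb]] := rsol_dom sol (`|t| + 1); exists g; split=> // s x st; apply: gb.
rewrite -[s](subrK t) (le_trans (ler_normD _ _))// addrC lerD2l; exact: ltW.
Qed.

Lemma rsol_hartley t z : z != 0 -> hartley (u t) z =
  cos (Num.sqrt `|z| * t) * hartley (u 0) z +
  sin (Num.sqrt `|z| * t) * (hartley (ut 0) z / Num.sqrt `|z|).
Proof.
move=> z0; have a0 : Num.sqrt `|z| != 0 by rewrite gt_eqF// sqrtr_gt0 normr_gt0.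
apply: (@oscillator_unique (fun t => hartley (u t) z) (fun t => hartley (ut t) z)) => // s.
  have [g [ig gb]] := near_dom s.
  apply: (@is_derive_hartley_param u ut g) => //.
  - by move=> r x _; exact: rsol_der sol r x.
  - by move=> r x st; case: (gb r x st).
  - by move=> r x st; case: (gb r x st).
have [g [ig gb]] := near_dom s.
rewrite sqr_sqrtr// -rsol_hartley_utt.
apply: (@is_derive_hartley_param ut utt g) => //.
- by move=> r x _; exact: rsol_der2 sol r x.
- by move=> r x st; case: (gb r x st).
- by move=> r x st; case: (gb r x st).
Qed.

Lemma rsol_dispersion (m : R) t x : 0 < m -> 0 < t ->
  rschwartz (u 0) -> rschwartz (ut 0) ->
  let v0 := u 0 in
  let v1 := fun x => (2 * pi)^-1 * hartley (fun z => `|z| `^ (- (1 / 2)) * hartley (ut 0) z) x in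
  (forall v, v = v0 \/ v = v1 ->
  [/\ (\int[mu]_y (v y ^+ 2)%:E <= (m ^+ 2)%:E)%E,
      (\int[mu]_y (rderive v y ^+ 2)%:E <= (m ^+ 2)%:E)%E,
      (\int[mu]_y ((y * rderive v y) ^+ 2)%:E <= (m ^+ 2)%:E)%E &
      (\int[mu]_y (rderive (fun y => y * rderive v y)%R y ^+ 2)%:E <= (m ^+ 2)%:E)%E]) ->
  `|u t x| <= 4 * osc_const * m / Num.sqrt t /\ `|u t x| <= 4 * osc_const * m.
Proof.
move=> m0 t0 s0 s1 v0 v1 hv.
have p0 : 0 < 2 * pi :> R by rewrite mulr_gt0// pi_gt0.
have r0 : 0 < Num.sqrt t by rewrite sqrtr_gt0.
have rt : Num.sqrt t ^+ 2 = t by rewrite sqr_sqrtr// ltW.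
pose G1 z := `|z| `^ (- (1 / 2)) * hartley (ut 0) z.
have [K0 [M0 tG0]] := tame_schwartz s0.
have [K1 [M1 tG1]] := tame_schwartz_half s1.
have mp0 : 0 < 2 * pi * m by rewrite mulr_gt0.
(* Both transforms are [2 pi] times a function controlled by [m]. *)
have scale (G K : R -> R) (M : R) (v : R -> R) : tame G K M -> (forall y, hartley G y = 2 * pi * v y) ->
  v = v0 \/ v = v1 -> forall c,
  `|\int[mu]_z (cas (z * x) * (cos (t * Num.sqrt `|z| + c) * G z))| <= 2 * osc_const * (2 * pi * m) / Num.sqrt t /\
  `|\int[mu]_z (cas (z * x) * (cos (t * Num.sqrt `|z| + c) * G z))| <= 2 * osc_const * (2 * pi * m).
  move=> tG HG vv c; have [N1 N2 N3 N4] := hv v vv.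
  have HGE : hartley G = (fun y => 2 * pi * v y) by apply/funext.
  have dG := fun y => der_hartley y (tame_intG tG) (tame_intzG tG).
  have vE : v = (fun y => (2 * pi)^-1 * hartley G y).
    by apply/funext => y; rewrite HG mulKf// gt_eqF.
  have dv y : is_derive y 1 v ((2 * pi)^-1 * hartley (fun z => z * G z) (- y)).
    by rewrite vE; apply: derZ; exact: dG.
  have rv y : derive1 (hartley G) y = 2 * pi * rderive v y.
    by rewrite (derP (dG y)).2 /rderive (derP (dv y)).2 mulVKf// gt_eqF.
  have xdv y : y * rderive v y = - ((2 * pi)^-1 * hartley K y).
    rewrite /rderive (derP (dv y)).2 mulrCA (tame_scaling _ tG) mulrN//.
  have xdG y : y * derive1 (hartley G) y = - hartley K y.
    by rewrite (derP (dG y)).2 (tame_scaling _ tG).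
  have dK := fun y => der_hartley y (tame_intK tG) (tame_intzK tG).
  have rv2 y : derive1 (fun y => y * derive1 (hartley G) y) y =
      2 * pi * rderive (fun y => y * rderive v y) y.
    rewrite (_ : (fun y => y * derive1 (hartley G) y) = (fun y => - hartley K y)); last exact/funext.
    rewrite /rderive (_ : (fun y => y * rderive v y) = (fun y => - ((2 * pi)^-1 * hartley K y))); last exact/funext.
    rewrite (derP (derN (dK y))).2 (derP (derN (derZ _ (dK y)))).2.
    by rewrite mulrN mulVKf// gt_eqF.
  have sc (f h : R -> R) : (forall y, h y = 2 * pi * f y) ->
      (\int[mu]_y (f y ^+ 2)%:E <= (m ^+ 2)%:E)%E ->
      measurable_fun (setT : set T) f ->
      (\int[mu]_y (h y ^+ 2)%:E <= ((2 * pi * m) ^+ 2)%:E)%E.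
    move=> hf fm mf; have [f1 f2] := sqr_intble measurableT mf fm.
    have E y : h y ^+ 2 = (2 * pi) ^+ 2 * f y ^+ 2 by rewrite hf exprMn.
    have hi : intble setT (fun y => h y ^+ 2).
      by apply: eq_intble (intbleZ ((2 * pi) ^+ 2) measurableT f1) => // y _; rewrite E.
    apply: intble_sqr => //.
    rewrite (@eq_int _ _ _ (fun y => (2 * pi) ^+ 2 * f y ^+ 2)); last by move=> y _; rewrite E.
    by rewrite RintegralZl// (exprMn _ (2 * pi)) ler_wpM2l// sqr_ge0.
  have mv : measurable_fun (setT : set T) v.
    by rewrite vE; apply: measurable_funM => //; apply: meas_hartley; exact: tame_intG tG.
  have mdv : measurable_fun (setT : set T) (rderive v).
    rewrite (_ : rderive v = (fun y => (2 * pi)^-1 * hartley (fun z => z * G z) (- y))); last first.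
      by apply/funext => y; rewrite /rderive (derP (dv y)).2.
    apply: measurable_funM => //; apply: cont_meas => y; apply: cont_opp; apply: cont_hartley.
    exact: tame_intzG tG.
  have mxdv : measurable_fun (setT : set T) (fun y => y * rderive v y).
    by apply: measurable_funM.
  have mdxdv : measurable_fun (setT : set T) (rderive (fun y => y * rderive v y)).
    rewrite (_ : rderive _ = (fun y => - ((2 * pi)^-1 * hartley (fun z => z * K z) (- y)))); last first.
      rewrite (_ : (fun y => y * rderive v y) = (fun y => - ((2 * pi)^-1 * hartley K y))); last exact/funext.
      by apply/funext => y; rewrite /rderive (derP (derN (derZ _ (dK y)))).2.
    apply: cont_meas => y; apply: cvgN; apply: cvgMr; apply: cont_opp; apply: cont_hartley.
    exact: tame_intzK tG.
  have := @tame_dispersion _ G K M (2 * pi * m) x (Num.sqrt t) c r0 mp0 tG.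
  rewrite rt; apply.
  - exact: sc HG N1 mv.
  - exact: sc rv N2 mdv.
  - by apply: (sc _ _ _ N3 mxdv) => y; rewrite rv; ring.
  - exact: sc rv2 N4 mdxdv.
have HG0 y : hartley (hartley (u 0)) y = 2 * pi * v0 y.
  by rewrite /v0 [in RHS]rsol_inversion mulVKf// gt_eqF.
have HG1 y : hartley G1 y = 2 * pi * v1 y by rewrite /v1 mulVKf// gt_eqF.
(* The sine in the oscillator formula is a cosine shifted by [- pi / 2], and its division by
   [|z|^(1/2)] is absorbed into [G1]: hence the shifts [0] and [- (pi / 2)]. *)
have [a1 a2] := scale _ _ _ v0 tG0 HG0 (or_introl erefl) 0.
have [b1 b2] := scale _ _ _ v1 tG1 HG1 (or_intror erefl) (- (pi / 2)).
have mcos c : measurable_fun (setT : set T) (fun z : R => cos (t * Num.sqrt `|z| + c)).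
  apply: cont_meas => z; apply: continuous_comp; last exact: continuous_cos.
  apply: cvgD; last exact: cvg_cst.
  apply: cvgMr; apply: continuous_comp; [exact: norm_continuous|exact: sqrt_continuous].
have icos (G : R -> R) c : intble setT G ->
    intble setT (fun z => cas (z * x) * (cos (t * Num.sqrt `|z| + c) * G z)).
  move=> iG; apply: intble_cas; apply: (@intble_bddM _ _ _ _ 1) => //.
  by move=> z _; rewrite ler_norml cos_geN1 cos_le1.
have E : hartley (hartley (u t)) x =
    \int[mu]_z (cas (z * x) * (cos (t * Num.sqrt `|z| + 0) * hartley (u 0) z)) +
    \int[mu]_z (cas (z * x) * (cos (t * Num.sqrt `|z| + - (pi / 2)) * G1 z)).
  have j0 := icos _ 0 (tame_intG tG0); have j1 := icos _ (- (pi / 2)) (tame_intG tG1).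
  rewrite -RintegralD//; apply: int_eq_off0.
  - by apply: intble_cas; exact: rsol_hartley_int.
  - exact: intbleD.
  move=> z z0; rewrite rsol_hartley// /G1 addr0 cosB cos_pihalf sin_pihalf mulr0 add0r mulr1 (mulrC t).
  rewrite powRN mul1r powR12_sqrt//; ring.
have uE : `|u t x| = (2 * pi)^-1 * `|hartley (hartley (u t)) x|.
  by rewrite rsol_inversion normrM ger0_norm// invr_ge0 ltW.
(* [A] stands for [(Num.sqrt t)^-1] and for [1], the two regimes. *)
have bd A : `|\int[mu]_z (cas (z * x) * (cos (t * Num.sqrt `|z| + 0) * hartley (u 0) z))| <= 2 * osc_const * (2 * pi * m) * A ->
  `|\int[mu]_z (cas (z * x) * (cos (t * Num.sqrt `|z| + - (pi / 2)) * G1 z))| <= 2 * osc_const * (2 * pi * m) * A ->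
  `|u t x| <= 4 * osc_const * m * A.
  move=> h1 h2; rewrite uE ler_pdivrMl// E (le_trans (ler_normD _ _))//.
  rewrite (_ : 2 * pi * _ = 2 * osc_const * (2 * pi * m) * A + 2 * osc_const * (2 * pi * m) * A); last by ring.
  exact: lerD.
split; first exact: bd.
by have := bd 1; rewrite !mulr1; apply.
Qed.

End representation.
End evolution.

(** * Complex-valued functions *)

Section components.
Context {R : realType}.
Notation mu := (@lebesgue_measure R).
Notation T := (measurableTypeR R).
Implicit Types (a b w : R -> R) (f g : R -> R[i]) (c : bool) (s x y z xi : R).

Definition cosint a : R -> R := fun xi => \int[mu]_x (cos (x * xi) * a x).
Definition sinint a : R -> R := fun xi => \int[mu]_x (sin (x * xi) * a x).

Lemma intble_cosM a xi : intble setT a -> intble setT (fun x => cos (x * xi) * a x).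
Proof.
move=> ia; apply: (@intble_bddM _ _ _ _ 1) => //.
  apply: cont_meas => x; apply: continuous_comp; [exact: cont_lin|exact: continuous_cos].
by move=> x _; rewrite ler_norml cos_geN1 cos_le1.
Qed.

Lemma intble_sinM a xi : intble setT a -> intble setT (fun x => sin (x * xi) * a x).
Proof.
move=> ia; apply: (@intble_bddM _ _ _ _ 1) => //.
  apply: cont_meas => x; apply: continuous_comp; [exact: cont_lin|exact: continuous_sin].
by move=> x _; rewrite ler_norml sin_geN1 sin_le1.
Qed.

Lemma cosintN a xi : cosint a (- xi) = cosint a xi.
Proof. by apply: eq_int => x _; rewrite mulrN cosN. Qed.

Lemma sinintN a xi : intble setT a -> sinint a (- xi) = - sinint a xi.
Proof.
move=> ia; rewrite -[RHS]mulN1r [in RHS]/sinint -RintegralZl//; last exact: intble_sinM.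
by apply: eq_int => x _; rewrite mulrN sinN; ring.
Qed.

Lemma hartleyE a xi : intble setT a -> hartley a xi = cosint a xi + sinint a xi.
Proof.
move=> ia; rewrite -RintegralD//; [|exact: intble_cosM|exact: intble_sinM].
by apply: eq_int => x _; rewrite mulrDl.
Qed.

Lemma eq_int_odd a b : intble setT a -> intble setT b ->
  (forall x, a (- x) - b (- x) = - (a x - b x)) -> \int[mu]_x a x = \int[mu]_x b x.
Proof.
move=> ia ib ab; apply/eqP; rewrite -subr_eq0 -RintegralB//.
by apply/eqP; apply: int_odd => //; exact: intbleB.
Qed.

(** Each summand is half the sum or difference of the whole and its reflection. This is how one
    integrability condition on a mixed transform splits into separate ones for cosine and sine
    transforms. *)
Lemma intble_even_odd a b : intble setT (fun x => a x + b x) ->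
  (forall x, a (- x) = a x) -> (forall x, b (- x) = - b x) ->
  intble setT a /\ intble setT b.
Proof.
move=> iab ea ob; have io := intble_opp iab.
have ia := intbleZ 2^-1 measurableT (intbleD measurableT iab io).
have ib := intbleZ 2^-1 measurableT (intbleB measurableT iab io).
by split; [apply: eq_intble ia|apply: eq_intble ib] => // x _; rewrite ea ob; field.
Qed.

(** A boolean selects the component, so that each argument is made once for both. *)
Definition cpart c (z : R[i]) : R := if c then complex.Re z else complex.Im z.

Lemma fourier_parts f xi : cintegrable f ->
  complex.Re (fourier f xi) =
    cosint (fun x => complex.Re (f x)) xi + sinint (fun x => complex.Im (f x)) xi /\
  complex.Im (fourier f xi) =
    cosint (fun x => complex.Im (f x)) xi - sinint (fun x => complex.Re (f x)) xi.
Proof.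
move=> [ia ib]; split; rewrite /fourier /cintegral/=.
  rewrite -RintegralD//; [|exact: intble_cosM|exact: intble_sinM].
  by apply: eq_int => x _; case: (f x) => p q /=; rewrite cosN sinN; ring.
rewrite -RintegralB//; [|exact: intble_cosM|exact: intble_sinM].
by apply: eq_int => x _; case: (f x) => p q /=; rewrite cosN sinN; ring.
Qed.

(** Cosine and sine transforms are kept apart because the Fourier transform of a complex function
    mixes the cosine transform of one component with the sine transform of the other. *)
Definition multiplier_intble s (a : R -> R) : Prop :=
  intble setT (fun z => `|z| `^ s * cosint a z) /\
  intble setT (fun z => `|z| `^ s * sinint a z).

Lemma hartley_multiplier_intble s a : intble setT a ->
  intble setT (fun z => `|z| `^ s * hartley a z) <-> multiplier_intble s a.
Proof.
move=> ia; split=> [i|[i1 i2]].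
  apply: intble_even_odd => [|z|z].
  - by apply: eq_intble i => // z _; rewrite hartleyE// mulrDr.
  - by rewrite normrN cosintN.
  - by rewrite normrN sinintN// mulrN.
by apply: eq_intble (intbleD measurableT i1 i2) => // z _; rewrite hartleyE// mulrDr.
Qed.

Lemma absD_cpart s f x c : cintegrable f ->
  (forall c, multiplier_intble s (fun x => cpart c (f x))) ->
  cpart c (absD s f x) =
  (2 * pi)^-1 * hartley (fun z => `|z| `^ s * hartley (fun y => cpart c (f y)) z) x.
Proof.
move=> cf mf; have [ia ib] := cf; have [jca jsa] := mf true; have [jcb jsb] := mf false.
have ic : intble setT (fun y => cpart c (f y)) by case: c.
have jh := intble_cas x ((hartley_multiplier_intble s ic).2 (mf c)).
rewrite /absD /inv_fourier /cintegral/=.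
rewrite [LHS](_ : _ = (2 * pi)^-1 * \int[mu]_z cpart c
    (cis (x * z) * ((`|z| `^ s)%:C * fourier f z))); last first.
  by case: c {ic jh} => /=; ring.
(* The integrands agree up to products of an even and an odd function. *)
congr (_ * _); apply: eq_int_odd => //.
  have jc a : intble setT (fun z => `|z| `^ s * cosint a z) ->
      intble setT (fun z => cos (z * x) * (`|z| `^ s * cosint a z)).
    by move=> i; exact: intble_cosM.
  case: c {ic jh}.
    apply: eq_intble (intbleB measurableT
      (intble_cosM x (intbleD measurableT jca jsb))
      (intble_sinM x (intbleB measurableT jcb jsa))) => // z _.
    have [] := fourier_parts z cf; case: (fourier f z) => p q /= -> ->.
    by rewrite (mulrC x z); ring.
  apply: eq_intble (intbleD measurableT
    (intble_cosM x (intbleB measurableT jcb jsa))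
    (intble_sinM x (intbleD measurableT jca jsb))) => // z _.
  have [] := fourier_parts z cf; case: (fourier f z) => p q /= -> ->.
  by rewrite (mulrC x z); ring.
move=> z; have [] := fourier_parts z cf; have [] := fourier_parts (- z) cf.
case: (fourier f z) => p q; case: (fourier f (- z)) => p' q' /= -> -> -> ->.
rewrite !hartleyE// !cosintN !sinintN// normrN (mulrC x) mulNr (mulrC x) /cas !cosN !sinN.
by rewrite /cis !cosN !sinN; case: c {ic jh} => /=; ring.
Qed.

Lemma cpart_norm c (z : R[i]) : `|cpart c z| <= Normc.normc z.
Proof.
case: z => p q; rewrite /cpart /Normc.normc; case: c => /=.
  by rewrite -sqrtr_sqr ler_wsqrtr// lerDl sqr_ge0.
by rewrite -sqrtr_sqr ler_wsqrtr// lerDr sqr_ge0.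
Qed.

Lemma normc_cpart (z : R[i]) : Normc.normc z <= `|cpart true z| + `|cpart false z|.
Proof.
case: z => p q; rewrite /cpart /Normc.normc/= -[leRHS]ger0_norm ?addr_ge0//.
rewrite -sqrtr_sqr ler_wsqrtr// sqrrD !real_normK ?num_real//.
by rewrite addrAC lerDl mulrn_wge0// mulr_ge0.
Qed.

Lemma cpart_cderive c f : (fun x => cpart c (cderive f x)) = rderive (fun x => cpart c (f x)).
Proof. by case: c. Qed.

Lemma cpart_cderivable c f x : cderivable f x ->
  is_derive x 1 (fun y => cpart c (f y)) (cpart c (cderive f x)).
Proof. by case: c => -[d1 d2]; [exact: derI d1 erefl|exact: derI d2 erefl]. Qed.

Lemma iter_cpart_cderive c f n :
  (fun x => cpart c (iter n (@cderive R) f x)) = iter n rderive (fun x => cpart c (f x)).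
Proof. by elim: n => //= n ih; rewrite cpart_cderive ih. Qed.

Lemma schwartz_cpart c f : schwartz f -> rschwartz (fun x => cpart c (f x)).
Proof.
move=> [df bf]; split=> [n x|p q].
  by rewrite -iter_cpart_cderive; have [] := derP (cpart_cderivable c (df n x)).
have [M h] := bf p q; exists M => x; apply: le_trans (h x).
by rewrite -iter_cpart_cderive ler_wpM2l ?exprn_ge0// cpart_norm.
Qed.

Lemma schwartz_cintegrable f : schwartz f -> cintegrable f.
Proof.
by move=> sf; split; [have := schwartz_cpart true sf|have := schwartz_cpart false sf];
  exact: rschwartz_intble.
Qed.

(** The integral of a nonnegative function is a supremum over the simple functions below it, hence
    monotone even where measurability is unknown, as for the functions whose [L2norm] is taken. *)
Lemma le_nonneg_integral (p q : T -> \bar R) :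
  (forall x, 0 <= p x)%E -> (forall x, p x <= q x)%E ->
  (\int[mu]_x p x <= \int[mu]_x q x)%E.
Proof.
move=> p0 pq; have q0 x : (0 <= q x)%E by apply: le_trans (pq x).
rewrite !ge0_integralTE//; apply: le_ereal_sup => _ [h hp <-]; exists h => // x.
exact: le_trans (pq x).
Qed.

Lemma L2norm_cpart c f (m : R) : 0 <= m -> (L2norm f <= m%:E)%E ->
  (\int[mu]_y (cpart c (f y) ^+ 2)%:E <= (m ^+ 2)%:E)%E.
Proof.
move=> m0 fm; apply: (@le_trans _ _ (L2norm f `^ 2)%E).
  rewrite /L2norm powR_Lnorm//; apply: le_nonneg_integral => y.
    by rewrite lee_fin sqr_ge0.
  have nn : 0 <= Normc.normc (f y) by rewrite (le_trans _ (cpart_norm c _)).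
  rewrite abse_EFin ger0_norm// poweR_EFin lee_fin powR_mulrn//.
  by rewrite -(real_normK (num_real (cpart _ _))) lerXn2r ?nnegrE ?cpart_norm//.
have n0 := Lnorm_ge0 mu 2%:E (fun x => (Normc.normc (f x))%:E).
move: fm n0; rewrite -/(L2norm f); case: (L2norm f) => [r| |]//=.
rewrite !lee_fin => rm r0; rewrite powR_mulrn// lerXn2r//.
Qed.

End components.

(** * From a complex solution to its real components *)

Section complex_evolution.
Context {R : realType}.
Notation mu := (@lebesgue_measure R).
Notation T := (measurableTypeR R).
Variables (u0 u1 : R -> R[i]) (u : R -> R -> R[i]).
Hypotheses (su0 : schwartz u0) (su1 : schwartz u1) (sol : is_solution u0 u1 u).
Implicit Types (c : bool) (t x m : R).

Lemma sol_cont_cpart c t : continuous (fun x => cpart c (u t x)).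
Proof. by case: c; case: (sol_continuous sol t). Qed.

Lemma sol_dominated_cpart c t : exists g, intble setT g /\ forall s x, `|s| <= t ->
  [/\ `|cpart c (u s x)| <= g x, `|cpart c (dt u s x)| <= g x &
      `|cpart c (dt (dt u) s x)| <= g x].
Proof.
have [g [ig h]] := sol_dominated sol t; exists g; split=> // s x /(h s x)[h1 h2 h3].
by split; apply: le_trans (cpart_norm _ _) _.
Qed.

Lemma sol_intble_cpart c t : intble setT (fun x => cpart c (u t x)).
Proof.
have [g [ig h]] := sol_dominated_cpart c `|t|.
apply: (intble_le measurableT _ _ ig); first by apply: cont_meas; exact: sol_cont_cpart.
by move=> x _; case: (h t x (lexx _)).
Qed.

Lemma sol_cintegrable t : cintegrable (u t).
Proof. by split; [exact: (sol_intble_cpart true t)|exact: (sol_intble_cpart false t)]. Qed.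

(** Each component of the Fourier transform is an even cosine transform plus or minus an odd sine
    transform; parity separates them, and the even weight [|z|] respects the separation. *)
Lemma sol_multiplier_cpart c t : multiplier_intble 1 (fun x => cpart c (u t x)).
Proof.
have cu := sol_cintegrable t; have [iu1 iu2] := cu; have [j1 j2] := sol_multiplier sol t.
have [i1 i2] : intble setT (fun z => `|z| `^ 1 * cosint (fun x => cpart true (u t x)) z) /\
    intble setT (fun z => `|z| `^ 1 * sinint (fun x => cpart false (u t x)) z).
  apply: intble_even_odd => [|z|z].
  - apply: eq_intble j1 => // z _.
    have [] := fourier_parts z cu; case: (fourier _ z) => p q /= -> _.
    by rewrite mul0r subr0 powRr1// mulrDr.
  - by rewrite normrN cosintN.
  - by rewrite normrN sinintN// mulrN.
have [i3 i4] : intble setT (fun z => `|z| `^ 1 * cosint (fun x => cpart false (u t x)) z) /\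
    intble setT (fun z => - (`|z| `^ 1 * sinint (fun x => cpart true (u t x)) z)).
  apply: intble_even_odd => [|z|z].
  - apply: eq_intble j2 => // z _.
    have [] := fourier_parts z cu; case: (fourier _ z) => p q /= _ ->.
    by rewrite mul0r addr0 powRr1// mulrDr mulrN.
  - by rewrite normrN cosintN.
  - by rewrite normrN sinintN// mulrN.
case: c; split=> //.
by apply: eq_intble (intbleN measurableT i4) => // z _; rewrite opprK.
Qed.

Lemma real_solution_cpart c : real_solution (fun t x => cpart c (u t x))
  (fun t x => cpart c (dt u t x)) (fun t x => cpart c (dt (dt u) t x)).
Proof.
split.
- by move=> t x; exact: cpart_cderivable (sol_derivable sol t x).
- by move=> t x; exact: cpart_cderivable (sol_derivable2 sol t x).
- exact: sol_cont_cpart.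
- exact: sol_dominated_cpart.
- move=> t; have := (hartley_multiplier_intble 1 (sol_intble_cpart c t)).2 (sol_multiplier_cpart c t).
  by apply: eq_intble => // z _; rewrite powRr1.
- move=> t x; have /eqP := sol_equation sol t x.
  rewrite addr_eq0 => /eqP ->.
  rewrite [LHS](_ : _ = - cpart c (absD 1 (u t) x)); last by case: c; case: (absD _ _ _).
  rewrite absD_cpart//; [|exact: sol_cintegrable|by move=> b; exact: sol_multiplier_cpart].
  by under [in LHS]eq_fun do rewrite powRr1//.
Qed.

Lemma sol_dispersion c m t x : 0 < m -> 0 < t ->
  (forall v, v = u \/ v = (fun s => absD (- (1 / 2)) (dt u s)) ->
    [/\ (L2norm (v 0%R) <= m%:E)%E, (L2norm (dx v 0%R) <= m%:E)%E,
        (L2norm (Lfield v 0%R) <= m%:E)%E & (L2norm (dx (Lfield v) 0%R) <= m%:E)%E]) ->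
  `|cpart c (u t x)| <= 4 * osc_const * m / Num.sqrt t /\
  `|cpart c (u t x)| <= 4 * osc_const * m.
Proof.
move=> m0 t0 hv; have eu0 : u 0 = u0 by apply/funext => y; exact: sol_init sol y.
have eu1 : dt u 0 = u1 by apply/funext => y; exact: sol_init_dt sol y.
apply: (rsol_dispersion (real_solution_cpart c)) => //.
- by rewrite eu0; exact: schwartz_cpart.
- by rewrite eu1; exact: schwartz_cpart.
have key (V : R -> R -> R[i]) v : v = (fun y => cpart c (V 0 y)) ->
    V = u \/ V = (fun s => absD (- (1 / 2)) (dt u s)) ->
    [/\ (\int[mu]_y (v y ^+ 2)%:E <= (m ^+ 2)%:E)%E,
      (\int[mu]_y (rderive v y ^+ 2)%:E <= (m ^+ 2)%:E)%E,
      (\int[mu]_y ((y * rderive v y) ^+ 2)%:E <= (m ^+ 2)%:E)%E &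
      (\int[mu]_y (rderive (fun y => y * rderive v y)%R y ^+ 2)%:E <= (m ^+ 2)%:E)%E].
  move=> -> /hv [h1 h2 h3 h4].
  have dxE (W : R -> R -> R[i]) : rderive (fun y => cpart c (W 0 y)) = (fun y => cpart c (dx W 0 y)).
    by rewrite /dx cpart_cderive.
  have LE : (fun y => y * rderive (fun y => cpart c (V 0 y)) y) = (fun y => cpart c (Lfield V 0 y)).
    (* The factor [t / 2] vanishes at time 0 and removes [dt V] whatever value [cderive] takes
       there; differentiability in time of [|D|^(-1/2) (dt u)] is not at hand. *)
    apply/funext => y; rewrite dxE /Lfield mul0r.
    by case: (dx V 0 y) => p q; case: (dt V 0 y) => p' q'; case: c dxE => _ /=; ring.
  have L2 := fun h => L2norm_cpart c (ltW m0) h.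
  split; [exact: L2 h1|by rewrite dxE; exact: L2 h2| |].
    under eq_integral do rewrite (congr1 (fun f => f _) LE).
    exact: L2 h3.
  by rewrite LE dxE; exact: L2 h4.
move=> v [|] -> {v}; first by apply: (key u) => //; left.
apply: (key (fun s => absD (- (1 / 2)) (dt u s))); last by right.
have cu : cintegrable (dt u 0) by rewrite eu1; exact: schwartz_cintegrable.
apply/funext => y; rewrite absD_cpart// => b.
apply/hartley_multiplier_intble.
  by apply: rschwartz_intble; rewrite eu1; exact: schwartz_cpart.
have [|K [M /tame_intG//]] := @tame_schwartz_half _ (fun x => cpart b (dt u 0 x)).
by rewrite eu1; exact: schwartz_cpart.
Qed.

End complex_evolution.

(** * The two time regimes and the final estimate *)

Section decay.
Context {R : realType}.

Lemma osc_const_gt0 : 0 < osc_const :> R.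
Proof. by rewrite /osc_const; have := pi_gt0 R; lra. Qed.

(** The exponent enters through [0 <= 5 / 14 <= 1 / 2] alone. *)
Lemma powR_decay (B v t : R) : 0 < t -> v <= B / Num.sqrt t -> v <= B -> 0 <= B ->
  v <= B / t `^ (5 / 14).
Proof.
move=> t0 v1 v2 B0; have p0 : 0 < t `^ (5 / 14) by rewrite powR_gt0.
have s0 : 0 < Num.sqrt t by rewrite sqrtr_gt0.
have [t1|/ltW t1] := lerP 1 t.
  apply: (le_trans v1); rewrite ler_wpM2l// lef_pV2 ?posrE//.
  have <- : t `^ 2^-1 = Num.sqrt t by rewrite powR12_sqrt// ltW.
  by rewrite ler_powR//; lra.
apply: (le_trans v2); rewrite ler_peMr// invf_ge1// -[leRHS](powRr0 t).
by rewrite ger_powR ?t0//; lra.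
Qed.

Lemma le_sum_term (I : finType) (P : pred I) (F : I -> \bar R) i :
  (forall i, 0 <= F i)%E -> P i -> (F i <= \sum_(i | P i) F i)%E.
Proof.
move=> F0 Pi; rewrite (bigD1 i)//= leeDl// sume_ge0//.
Qed.

End decay.

Theorem theorem4p7 (R : realType) :
  exists C : R, 0 < C /\
    forall (u0 u1 : R -> R[i]) (u : R -> R -> R[i]),
      schwartz u0 -> schwartz u1 -> is_solution u0 u1 u ->
      forall t : R, 0 < t ->
        (ereal_sup (range (fun y : R => (Normc.normc (u t (y * t ^+ 2)%R))%:E))
         <= (C / t `^ (5 / 14))%:E *
            \sum_(k : 'I_3 * 'I_3 * 'I_3 | (k.1.1 + k.1.2 + k.2 <= 2)%N)
              (L2norm (Gamma k.1.1 k.1.2 k.2 u 0%R) +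
               L2norm (Gamma k.1.1 k.1.2 k.2
                         (fun s => absD (- (1 / 2)) (dt u s)) 0%R)))%E.
Proof.
have o0 := @osc_const_gt0 R.
(* Twice the constant [4 * osc_const] of a real solution, as the real and imaginary parts are
   added. *)
exists (8 * osc_const); split; first by rewrite mulr_gt0.
move=> u0 u1 u su0 su1 sol t t0.
set w := fun s => absD (- (1 / 2)) (dt u s).
have p0 : 0 < t `^ (5 / 14) by rewrite powR_gt0.
have C0 : 0 < 8 * osc_const / t `^ (5 / 14) by rewrite divr_gt0// mulr_gt0.
set F := fun k : 'I_3 * 'I_3 * 'I_3 =>
  (L2norm (Gamma k.1.1 k.1.2 k.2 u 0%R) + L2norm (Gamma k.1.1 k.1.2 k.2 w 0%R))%E.
have F0 k : (0 <= F k)%E by rewrite adde_ge0// Lnorm_ge0.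
rewrite -/(F _); set S := (\sum_(k | _) F k)%E.
have S0 : (0 <= S)%E by rewrite sume_ge0.
have FS (k2 k3 : 'I_3) v : (k2 + k3 <= 2)%N -> v = u \/ v = w ->
    (L2norm (Gamma 0 k2 k3 v 0%R) <= S)%E.
  move=> k23 vw; apply: le_trans (@le_sum_term R _ _ F (ord0, k2, k3) F0 _); last by [].
  by case: vw => ->; rewrite /F/=; [apply: leeDl|apply: leeDr]; rewrite Lnorm_ge0.
apply: ge_ereal_sup => _ [y _ <-].
(* The sum is infinite for instance when [|D|^(-1/2) (dt u 0)] is not square integrable; the right
   side is then infinite as well. *)
case: S S0 FS => [S| |]//= S0 FS; last by rewrite gt0_muley ?lte_fin// leey.
rewrite -EFinM lee_fin; rewrite lee_fin in S0.
apply/ler_addgt0Pr => e e0.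
(* The dispersive estimates divide by [m], while [S] may be zero; the enlargement makes [m] positive
   and costs exactly [e] in the conclusion. *)
pose m := S + e * (8 * osc_const / t `^ (5 / 14))^-1.
have m0 : 0 < m by rewrite ltr_wpDl// divr_gt0.
have -> : 8 * osc_const / t `^ (5 / 14) * S + e = 8 * osc_const * m / t `^ (5 / 14).
  by rewrite /m; field; rewrite !gt_eqF.
have FM (k2 k3 : 'I_3) v : (k2 + k3 <= 2)%N -> v = u \/ v = w ->
    (L2norm (Gamma 0 k2 k3 v 0%R) <= m%:E)%E.
  move=> k23 vw; apply: le_trans (FS _ _ _ k23 vw) _.
  by rewrite lee_fin lerDl ltW// divr_gt0.
pose i1 : 'I_3 := @Ordinal 3 1 isT.
have hc c : `|cpart c (u t (y * t ^+ 2))| <= 4 * osc_const * m / t `^ (5 / 14).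
  have [|h1 h2] := @sol_dispersion R u0 u1 u su0 su1 sol c m t (y * t ^+ 2) m0 t0.
    move=> v vw; split.
    - exact: (FM ord0 ord0).
    - exact: (FM i1 ord0).
    - exact: (FM ord0 i1).
    - exact: (FM i1 i1).
  have B0 : 0 <= 4 * osc_const * m by rewrite ltW// (mulr_gt0 _ m0)// (mulr_gt0 _ o0).
  exact: powR_decay t0 h1 h2 B0.
apply: (le_trans (normc_cpart _)).
rewrite (_ : 8 * _ * _ / _ = 4 * osc_const * m / t `^ (5 / 14) + 4 * osc_const * m / t `^ (5 / 14)).
  exact: lerD.
by ring.
Qed.
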